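(* Let $T$ be a uniformly acyclic tree on $2\times 2$, $\xi<\aleph_1$, $A_{1+\xi}$ a ${\bf\Sigma}^0_{1+\xi}$ subset of $[T]$, $X$, $Y$ Polish spaces, and $A$, $B$ disjoint analytic subsets of $X\times Y$. Then one of the following holds: (a) $A$ is separable from $B$ by a potentially ${\bf\Pi}^0_{1+\xi}$ set, i.e. there is a Borel set $C\subseteq X\times Y$ which is potentially ${\bf\Pi}^0_{1+\xi}$ with $A\subseteq C$ and $C\cap B=\emptyset$. (b) There are continuous maps $u:2^{\mathbb{N}}\to X$ and $v:2^{\mathbb{N}}\to Y$ such that $A_{1+\xi}\subseteq (u\times v)^{-1}(A)$ and $[T]\setminus A_{1+\xi}\subseteq (u\times v)^{-1}(B)$. If moreover $A_{1+\xi}$ is not potentially ${\bf\Pi}^0_{1+\xi}$ (as a subset of $2^{\mathbb{N}}\times2^{\mathbb{N}}$), then exactly one of (a), (b) holds.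
   Context: A Borel set $A\subseteq X\times Y$ ($X,Y$ Polish) is potentially in a class $\Gamma$ if there are finer Polish topologies $\sigma$ on $X$ and $\tau$ on $Y$ such that $A\in\Gamma([X,\sigma]\times[Y,\tau])$. A tree on $2\times 2$ is a set $T$ of pairs $(s,t)\in 2^{<\mathbb{N}}\times 2^{<\mathbb{N}}$ with $|s|=|t|$, closed under taking restrictions to a common shorter length; $[T]:=\{(\alpha,\beta)\in 2^{\mathbb{N}}\times2^{\mathbb{N}}:\forall n\ (\alpha|n,\beta|n)\in T\}$, a closed subset of $2^{\mathbb{N}}\times2^{\mathbb{N}}$ with the subspace topology. For a relation $R$ on a set $E$: an $R$-path is a finite sequence $(e_i)_{i\le n}$ with $(e_i,e_{i+1})\in R$ for $i<n$; an $R$-cycle is an $R$-path $(e_i)_{i\le n}$ with $n\ge 3$ such that for $0\le i\ne j\le n$, $e_i=e_j$ iff $\{i,j\}=\{0,n\}$; $R$ is acyclic if there is no $R$-cycle. A tree $T$ on $2\times2$ is uniformly acyclic if for each $p>0$: the relation $T\cap(2^p\times 2^p)$ on $2^p$ is irreflexive and antisymmetric, and the symmetric relation generated by $T\cap(2^p\times2^p)$ is acyclic. *)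

(* Defs.v *)
From HB Require Import structures.
From mathcomp Require Import all_boot all_order all_algebra.
From mathcomp Require Import all_classical all_reals all_analysis.
From mathcomp Require Import wochoice.

Set Implicit Arguments.
Unset Strict Implicit.
Unset Printing Implicit Defensive.

Import Order.TTheory GRing.Theory Num.Theory.

Local Open Scope classical_set_scope.
Local Open Scope ring_scope.

(* An ordinal below aleph_1, given as the order type of a countable
   (possibly finite or empty) well-ordered set. *)
Record countable_ordinal := CountableOrdinal {
  ord_carrier : countType ;
  ord_le : rel ord_carrier ;
  ord_wo : well_order ord_le }.

(* [Some w] stands for the ordinal of the proper initial segment below [w], and
   [None] for the whole ordinal; so [Some w] with [w] in [ord_below o] ranges
   over the ordinals smaller than [o]. *)
Definition ord_below (xi : countable_ordinal) (o : option (ord_carrier xi)) :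
    set (ord_carrier xi) :=
  if o is Some w then [set w' | ord_le w' w /\ w' <> w] else setT.

(* The class Sigma^0_{1+o}: open sets when o = 0, and countable unions of
   Pi^0_{1+o'} sets with o' < o when o > 0. *)
Inductive Sigma0_rec (xi : countable_ordinal) (Z : topologicalType) :
    option (ord_carrier xi) -> set Z -> Prop :=
| Sigma0_open o U : ord_below o = set0 -> open U -> Sigma0_rec o U
| Sigma0_bigcup o (w : nat -> ord_carrier xi) (F : nat -> set Z) :
    (forall n, ord_below o (w n)) ->
    (forall n, Sigma0_rec (Some (w n)) (~` F n)) ->
    Sigma0_rec o (\bigcup_n F n).

(* Sigma^0_{1+xi} and Pi^0_{1+xi}. *)
Definition Sigma0_1p (xi : countable_ordinal) (Z : topologicalType) (S : set Z) :=
  Sigma0_rec (None : option (ord_carrier xi)) S.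

Definition Pi0_1p (xi : countable_ordinal) (Z : topologicalType) (S : set Z) :=
  Sigma0_1p xi (~` S).

Definition is_metric (R : realType) (Z : Type) (d : Z -> Z -> R) :=
  [/\ forall x y, 0 <= d x y,
      forall x y, d x y = 0 <-> x = y,
      forall x y, d x y = d y x &
      forall x y z, d x z <= d x y + d y z].

Definition metric_complete (R : realType) (Z : Type) (d : Z -> Z -> R) :=
  forall u : nat -> Z,
    (forall e, 0 < e ->
       exists N, forall m n, (N <= m)%N -> (N <= n)%N -> d (u m) (u n) < e) ->
    exists l, forall e, 0 < e ->
       exists N, forall n, (N <= n)%N -> d (u n) l < e.

Definition metric_open (R : realType) (Z : Type) (d : Z -> Z -> R) (U : set Z) :=
  forall x, U x -> exists2 e, 0 < e & [set y | d x y < e] `<=` U.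

Definition polish (R : realType) (Z : topologicalType) :=
  (exists2 D : set Z, countable D & dense D) /\
  (exists d : Z -> Z -> R,
     [/\ is_metric d, metric_complete d &
         forall U : set Z, open U <-> metric_open d U]).

Definition borel (Z : topologicalType) (S : set Z) := <<s @open Z >> S.

Definition analytic (R : realType) (Z : topologicalType) (S : set Z) :=
  exists (P : topologicalType) (f : P -> Z),
    [/\ polish R P, continuous f & range f = S].

(* [Topological X] is the type of topological structures on the type X, and
   [Topological.Pack sigma] is X equipped with the topology sigma. *)
Definition finer_polish (R : realType) (X : topologicalType)
    (sigma : Topological X) :=
  (forall U : set X, open U -> @open (Topological.Pack sigma) U) /\
  polish R (Topological.Pack sigma).

Definition potentially_Pi0_1p (R : realType) (xi : countable_ordinal)
    (X Y : topologicalType) (S : set (X * Y)) :=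
  exists (sigma : Topological X) (tau : Topological Y),
    [/\ finer_polish R sigma, finer_polish R tau &
        @Pi0_1p xi (Topological.Pack sigma * Topological.Pack tau)%type S].

Definition tree2x2 (T : set (seq bool * seq bool)) :=
  (forall s t, T (s, t) -> size s = size t) /\
  (forall s t n, T (s, t) -> T (take n s, take n t)).

Definition branches (T : set (seq bool * seq bool)) :
    set (cantor_space * cantor_space) :=
  [set ab | forall n, T (mkseq ab.1 n, mkseq ab.2 n)].

(* Only the values of [e] on {0, ..., n} matter. *)
Definition rel_path (E : Type) (r : E -> E -> Prop) (n : nat) (e : nat -> E) :=
  forall i, (i < n)%N -> r (e i) (e i.+1).

Definition rel_cycle (E : Type) (r : E -> E -> Prop) (n : nat) (e : nat -> E) :=
  [/\ (3 <= n)%N, rel_path r n e &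
      forall i j, (i <= n)%N -> (j <= n)%N -> i <> j ->
        (e i = e j <-> (i = 0%N /\ j = n) \/ (i = n /\ j = 0%N))].

Definition rel_acyclic (E : Type) (r : E -> E -> Prop) :=
  ~ exists n e, rel_cycle r n e.

Definition level_rel (T : set (seq bool * seq bool)) (p : nat)
    (s t : p.-tuple bool) : Prop :=
  T (tval s, tval t).

Definition uniformly_acyclic (T : set (seq bool * seq bool)) :=
  forall p, (0 < p)%N ->
    [/\ forall s : p.-tuple bool, ~ level_rel T s s,
        forall s t : p.-tuple bool, level_rel T s t -> level_rel T t s -> s = t &
        rel_acyclic (fun s t : p.-tuple bool => level_rel T s t \/ level_rel T t s)].

Definition separable_by_pot_Pi0_1p (R : realType) (xi : countable_ordinal)
    (X Y : topologicalType) (A B : set (X * Y)) :=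
  exists C : set (X * Y),
    [/\ borel C, potentially_Pi0_1p R xi C, A `<=` C & C `&` B = set0].

Definition continuous_reduction (T : set (seq bool * seq bool))
    (A1 : set (cantor_space * cantor_space))
    (X Y : topologicalType) (A B : set (X * Y)) :=
  exists (u : cantor_space -> X) (v : cantor_space -> Y),
    [/\ continuous u, continuous v,
        A1 `<=` (fun ab => (u ab.1, v ab.2)) @^-1` A &
        branches T `\` A1 `<=` (fun ab => (u ab.1, v ab.2)) @^-1` B].

(* Main.v *)
Require Import Defs.
From HB Require Import structures.
From mathcomp Require Import all_boot all_order all_algebra.
From mathcomp Require Import all_classical all_reals all_analysis.
From mathcomp Require Import wochoice zify ring lra.

Set Implicit Arguments.
Unset Strict Implicit.
Unset Printing Implicit Defensive.

Import Order.TTheory GRing.Theory Num.Theory.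

Local Open Scope classical_set_scope.

(** A boldface argument replaces the Gandy-Harrington topology. Flatten a derivation of the
    class of [A1] into countably many codes and attach to each level [o <= xi] a tree order
    [ts_rel o] on finite sequences (true stages), such that along every branch of [T]
    infinitely many initial segments are true at level [xi], and [A1] becomes open for the
    order of level [xi].

    Call a family [C u t] admissible when [C u t] is potentially of class [u] and misses the
    cell of the node [t], a piece of [A] or [B] from which the [C u t'] attached to earlier
    nodes [t'] have been removed. Admissible families are countably directed, so one may
    keep only the approximations that are realized by a configuration of points for every
    admissible family. Suppose that such an approximation could not be extended at an edge
    [s] of the next level. By acyclicity, the configurations satisfying all constraints but
    that of [s] give a full analytic rectangle; Lusin's theorem encloses it in a Borel
    rectangle, which cut down by the conditions of lower class can be added to some [C u t],
    and the enlarged family has no configuration at the previous level. So the construction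
    never stops unless [B] is covered by a potentially [Sigma^0_{1+xi}] set missing [A].

    The alternatives exclude each other because finer Polish topologies can be pulled back
    along continuous maps: the graph of such a map remains closed. *)

(** * Analytic sets as images of closed subsets of the Baire space *)

(** A new node [s] inherits its code not from the node just below it but from its last predecessor
    [c] at the top level, which may lie far back. Along a branch these predecessors link the true
    stages, so codes converge there, and whatever was chosen at false stages is dropped. The
    obstacle is therefore to return from the node below [s] to [c], keeping the constraints of the
    other edges. A point that avoids [C (Some w) t] for all admissible [C] behaves like a point in
    the closure of the cell of [t] for a topology of class w; imposing this at later nodes is what
    keeps the return possible. The return is made in jumps, each to an earlier node whose level with
    respect to [s] is strictly larger. A jump away from a node of level v uses a set of class v, so
    the conditions still in force must have class below v and be finitely many. Bounding decisions
    by the height of a node serves this too: each node then meets finitely many levels, even for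
    infinite xi. Countable unions of Borel rectangles play the role of basic open sets throughout
    the construction; finer Polish topologies are built from them separately. *)

Lemma dependent_choice (T : Type) (P : nat -> T -> Prop) (r : nat -> T -> T -> Prop) x0 :
  P 0 x0 -> (forall n x, P n x -> exists y, P n.+1 y /\ r n x y) ->
  exists f : nat -> T, [/\ f 0 = x0, forall n, P n (f n) & forall n, r n (f n) (f n.+1)].
Proof.
move=> P0 step.
pose S n := {x | P n x}.
have nxt n (x : S n) : {y : S n.+1 | r n (sval x) (sval y)}.
  have [y [Py ry]] := cid (step n _ (svalP x)).
  by exists (exist _ y Py).
pose F := fix F n : S n := if n is m.+1 then sval (nxt m (F m)) else exist _ x0 P0.
exists (fun n => sval (F n)); split=> // n; first exact: svalP.
exact: (svalP (nxt n (F n))).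
Qed.

Definition baire := nat -> nat.

Definition agree (n : nat) (b c : baire) := forall i, (i < n)%N -> b i = c i.

Lemma agreeC n b c : agree n b c -> agree n c b.
Proof. by move=> h i lt_in; rewrite h. Qed.

Lemma agreeW m n b c : (m <= n)%N -> agree n b c -> agree m b c.
Proof. by move=> lmn h i im; apply: h; apply: leq_trans lmn. Qed.

Lemma agree_trans n b c d : agree n b c -> agree n c d -> agree n b d.
Proof. by move=> h h' i im; rewrite h // h'. Qed.

Definition bclosed (F : set baire) :=
  forall b, (forall n, exists2 c, F c & agree n b c) -> F b.

Definition bproj (k : nat) (b : baire) : baire := fun n => b (pickle (k, n)).

Lemma bproj_agree k n : exists N, forall b c, agree N b c ->
  agree n (bproj k b) (bproj k c).
Proof.
elim: n => [|n [N hN]]; first by exists 0.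
exists (maxn N (pickle (k, n)).+1) => b c h i; rewrite ltnS leq_eqVlt.
case/orP=> [/eqP->|lt_in]; first by apply: h; rewrite leq_max leqnn orbT.
by apply: (hN b c) => //; apply: agreeW h; rewrite leq_maxl.
Qed.

Lemma bproj_surj (bs : nat -> baire) : exists b, forall k, bproj k b = bs k.
Proof.
exists (fun m => if unpickle m is Some kn then bs kn.1 kn.2 else 0) => k.
by apply/funext => n; rewrite /bproj pickleK.
Qed.

Definition bshift (b : baire) : baire := fun n => b n.+1.
Definition bcons (k : nat) (b : baire) : baire :=
  fun n => if n is m.+1 then b m else k.

Lemma bshift_cons k b : bshift (bcons k b) = b.
Proof. by apply/funext. Qed.

Lemma bshift_agree n b c : agree n.+1 b c -> agree n (bshift b) (bshift c).
Proof. by move=> h i im; apply: h. Qed.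

(* The family [op] is only meant to be a subbasis of a topology. *)
Definition bcont (Z : Type) (op : set (set Z)) (F : set baire) (g : baire -> Z) :=
  forall b, F b -> forall U, op U -> U (g b) ->
    exists n, forall c, F c -> agree n b c -> U (g c).

Definition ana (Z : Type) (op : set (set Z)) (S : set Z) :=
  exists F g, [/\ bclosed F, bcont op F g & S = g @` F].

Definition hausdorff_base (Z : Type) (op : set (set Z)) :=
  forall x y : Z, x <> y -> exists U V, [/\ op U, op V, U x, V y & U `&` V = set0].

Definition opcont (Z Z' : Type) (op : set (set Z)) (op' : set (set Z'))
  (f : Z -> Z') := forall U, op' U -> op (f @^-1` U).

Lemma bclosed_bproj k F : bclosed F -> bclosed (fun b => F (bproj k b)).
Proof.
move=> cF b hb; apply: cF => n; have [N hN] := bproj_agree k n.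
by have [c Fc bc] := hb N; exists (bproj k c) => //; apply: hN.
Qed.

Lemma bclosed_bshift F : bclosed F -> bclosed (fun b => F (bshift b)).
Proof.
move=> cF b hb; apply: cF => n.
by have [c Fc bc] := hb n.+1; exists (bshift c) => //; apply: bshift_agree.
Qed.

Lemma bclosed_forall (I : Type) (F : I -> set baire) :
  (forall i, bclosed (F i)) -> bclosed (fun b => forall i, F i b).
Proof.
move=> cF b hb i; apply: cF => n; have [c Fc bc] := hb n.
by exists c => //; apply: Fc.
Qed.

Lemma bclosed_setI F G : bclosed F -> bclosed G -> bclosed (F `&` G).
Proof.
by move=> cF cG b hb; split; [apply: cF|apply: cG] => n;
  have [c [Fc Gc] bc] := hb n; exists c.
Qed.

Lemma bcont_sub Z (op : set (set Z)) (F G : set baire) g :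
  F `<=` G -> bcont op G g -> bcont op F g.
Proof.
move=> FG cg b Fb U opU Ub; have [n hn] := cg b (FG _ Fb) U opU Ub.
by exists n => c Fc; apply: hn; apply: FG.
Qed.

Lemma bcont_bproj Z (op : set (set Z)) F k g :
  bcont op F g -> bcont op (fun b => F (bproj k b)) (fun b => g (bproj k b)).
Proof.
move=> cg b Fb U opU Ub; have [n hn] := cg _ Fb U opU Ub.
have [N hN] := bproj_agree k n; exists N => c Fc bc.
by apply: hn => //; apply: hN.
Qed.

Lemma bcont_bshift Z (op : set (set Z)) F g :
  bcont op F g -> bcont op (fun b => F (bshift b)) (fun b => g (bshift b)).
Proof.
move=> cg b Fb U opU Ub; have [n hn] := cg _ Fb U opU Ub.
by exists n.+1 => c Fc bc; apply: hn => //; apply: bshift_agree.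
Qed.

Lemma bcont_comp Z Z' (op : set (set Z)) (op' : set (set Z')) F g (f : Z -> Z') :
  opcont op op' f -> bcont op F g -> bcont op' F (f \o g).
Proof. by move=> cf cg b Fb U opU Ub; apply: (cg b Fb (f @^-1` U)) => //; apply: cf. Qed.

Lemma bclosed_eq Z (op : set (set Z)) (F : set baire) g1 g2 :
  hausdorff_base op -> bclosed F -> bcont op F g1 -> bcont op F g2 ->
  bclosed (fun b => F b /\ g1 b = g2 b).
Proof.
move=> sop cF c1 c2 b hb.
have Fb : F b by apply: cF => n; have [c [Fc _] bc] := hb n; exists c.
split=> //; apply: contrapT => /sop[U [V [opU opV Ub Vb UV0]]].
have [n hn] := c1 b Fb U opU Ub; have [m hm] := c2 b Fb V opV Vb.
have [c [Fc e] bc] := hb (maxn n m).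
suff : (U `&` V) (g1 c) by rewrite UV0.
split; first by apply: hn => //; apply: agreeW bc; rewrite leq_maxl.
by rewrite e; apply: hm => //; apply: agreeW bc; rewrite leq_maxr.
Qed.

(** * Closure properties of analytic sets *)

Section ana_theory.
Variables (Z : Type) (op : set (set Z)).
Hypothesis sop : hausdorff_base op.

(** The parametrization is a total function on the Baire space, so even the empty set needs a point
    of [Z]. *)
Lemma ana_set0 (z : Z) : ana op set0.
Proof.
exists set0, (fun=> z); split; last by rewrite image_set0.
- by move=> b /(_ 0)[].
- by [].
Qed.

(** A point of the intersection is coded by one code for each set, all with the same image. Equality
    of images is a closed condition because the base separates points. *)
Lemma ana_bigcap (S : nat -> set Z) :
  (forall n, ana op (S n)) -> ana op (\bigcap_n S n).
Proof.
move=> /choice[F /choice[g h]].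
exists (fun b => forall n, F n (bproj n b) /\ g n (bproj n b) = g 0 (bproj 0 b)),
  (fun b => g 0 (bproj 0 b)); split.
- pose G b := forall n, F n (bproj n b).
  have cG : bclosed G.
    by apply: bclosed_forall => n; apply: bclosed_bproj; have [] := h n.
  have cgn n : bcont op G (fun b => g n (bproj n b)).
    apply: (@bcont_sub _ _ _ (fun b => F n (bproj n b))); first by move=> b; apply.
    by apply: bcont_bproj; have [] := h n.
  have := @bclosed_forall nat (fun n b => G b /\ g n (bproj n b) = g 0 (bproj 0 b)).
  move=> /(_ (fun n => bclosed_eq sop cG (cgn n) (cgn 0))) H b hb n.
  suff [Gb eb] : G b /\ g n (bproj n b) = g 0 (bproj 0 b) by split.
  apply: H => k; have [c Fc bc] := hb k; exists c => // m.
  by split=> [i|]; have [] := Fc m => //; have [] := Fc i.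
- apply: (@bcont_sub _ _ _ (fun b => F 0 (bproj 0 b))); first by move=> b /(_ 0)[].
  by apply: bcont_bproj; have [] := h 0.
- apply/seteqP; split=> [z Sz|z [b Fb <-] n _]; last first.
    by have [_ _ ->] := h n; exists (bproj n b); have [] := Fb n.
  have /choice[bs hbs] : forall n, exists b, F n b /\ g n b = z.
    by move=> n; have := Sz n I; have [_ _ ->] := h n => -[b Fb <-]; exists b.
  have [b hb] := bproj_surj bs; exists b; last by rewrite hb; have [] := hbs 0.
  by move=> n; rewrite !hb; have [? ->] := hbs n; have [_ ->] := hbs 0.
Qed.

Lemma ana_bigcup (S : nat -> set Z) :
  (forall n, ana op (S n)) -> ana op (\bigcup_n S n).
Proof.
move=> /choice[F /choice[g h]].
exists (fun b => F (b 0) (bshift b)), (fun b => g (b 0) (bshift b)); split.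
- move=> b hb; have [cF _ _] := h (b 0); apply: cF => n.
  have [c Fc bc] := hb n.+1; exists (bshift c); last exact: bshift_agree.
  by rewrite (bc 0).
- move=> b Fb U opU Ub; have [_ cg _] := h (b 0).
  have [n hn] := cg _ Fb U opU Ub; exists n.+1 => c Fc bc.
  have e : c 0 = b 0 by rewrite (bc 0).
  by rewrite e; rewrite e in Fc; apply: hn => //; apply: bshift_agree.
- apply/seteqP; split=> [z [n _]|z [b Fb <-]].
    have [_ _ ->] := h n => -[b Fb <-]; exists (bcons n b) => //=;
    by rewrite bshift_cons.
  by exists (b 0) => //; have [_ _ ->] := h (b 0); exists (bshift b).
Qed.

Lemma ana_setI S1 S2 : ana op S1 -> ana op S2 -> ana op (S1 `&` S2).
Proof.
move=> a1 a2; have -> : S1 `&` S2 = \bigcap_n (if n is 0 then S1 else S2).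
  apply/seteqP; split=> [z [? ?] [|n]//|z h].
  by split; [apply: (h 0 I)|apply: (h 1%N I)].
by apply: ana_bigcap => -[|n].
Qed.

Hypothesis anaT : ana op setT.

(** The codes of points of [U] form only a relatively open set. Storing in the first digit a length
    of agreement that guarantees membership in [U] turns it into a closed one. *)
Lemma ana_opI U : op U -> ana op U.
Proof.
have [F [g [cF cg sT]]] := anaT => opU.
exists (fun b => F (bshift b) /\
    forall c, F c -> agree (b 0) (bshift b) c -> U (g c)), (fun b => g (bshift b)).
split.
- move=> b hb; split; first by apply: (bclosed_bshift cF) => n;
    have [c [Fc _] bc] := hb n; exists c.
  move=> c Fc bc; have [d [Fd hd] bd] := hb (b 0).+1; apply: hd => //.
  rewrite -(bd 0) //; apply: agree_trans bc; apply: agreeC; exact: bshift_agree.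
- by apply: bcont_sub (bcont_bshift cg) => b [].
- apply/seteqP; split=> [z Uz|z [b [Fb hb] <-]]; last exact: hb.
  have [b Fb e] : (g @` F) z by rewrite -sT.
  subst z; have [n hn] := cg b Fb U opU Uz.
  by exists (bcons n b) => //=; rewrite bshift_cons.
Qed.

Lemma ana_opC U : op U -> ana op (~` U).
Proof.
have [F [g [cF cg sT]]] := anaT => opU.
exists (fun b => F b /\ ~ U (g b)), g; split.
- move=> b hb; have Fb : F b by apply: cF => n; have [c [Fc _] bc] := hb n; exists c.
  split=> // Ub; have [n hn] := cg b Fb U opU Ub.
  by have [c [Fc Uc] bc] := hb n; apply: Uc; apply: hn.
- by apply: bcont_sub cg => b [].
- apply/seteqP; split=> [z Uz|z [b [Fb hb] <-]//].
  have [b Fb e] : (g @` F) z by rewrite -sT.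
  by exists b => //; rewrite e.
Qed.

Lemma sigma_op_biana S : <<s op >> S -> ana op S /\ ana op (~` S).
Proof.
move=> sS; apply: (sS [set S | ana op S /\ ana op (~` S)]); split; last first.
  by move=> U opU; split; [apply: ana_opI|apply: ana_opC].
split=> [|A [a b]|A h] /=.
- rewrite setC0; split=> //; have [F [g [_ _ sT]]] := anaT.
  (* When [Z] is empty, the code of the whole space has an empty domain and serves for the empty
     set. *)
  have [z|nz] := pselect (exists z : Z, True); first by have [z0 _] := z; apply: ana_set0.
  exists F, g; have [cF cg _] : [/\ bclosed F, bcont op F g & True].
    split=> // [b hb|b Fb]; last by exfalso; apply: nz; exists (g b).
    by exfalso; apply: nz; exists (g b).
  by split=> //; rewrite -sT; apply/seteqP; split=> // z; exfalso; apply: nz; exists z.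
- by rewrite setTD setCK.
- split; first by apply: ana_bigcup => n; have [] := h n.
  by rewrite setC_bigcup; apply: ana_bigcap => n; have [] := h n.
Qed.

End ana_theory.

Lemma ana_image Z Z' (op : set (set Z)) (op' : set (set Z')) (f : Z -> Z') S :
  opcont op op' f -> ana op S -> ana op' (f @` S).
Proof.
move=> cf [F [g [cF cg ->]]]; exists F, (f \o g); split=> //.
  exact: bcont_comp cf cg.
by rewrite -image_comp.
Qed.

(** The codes are those of the fibre product: a code of a point of [Z] paired with a code of its
    image in [S]. *)
Lemma ana_preimage Z Z' (op : set (set Z)) (op' : set (set Z')) (f : Z -> Z') S :
  hausdorff_base op' -> ana op setT -> opcont op op' f -> ana op' S ->
  ana op (f @^-1` S).
Proof.
move=> sop [F0 [g0 [cF0 cg0 sT]]] cf [F [g [cF cg ->]]].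
exists (fun b => (F0 (bproj 0 b) /\ F (bproj 1 b)) /\ f (g0 (bproj 0 b)) = g (bproj 1 b)),
  (fun b => g0 (bproj 0 b)); split.
- apply: (bclosed_eq sop).
  + exact: (bclosed_setI (bclosed_bproj cF0) (bclosed_bproj cF)).
  + apply: (@bcont_sub _ _ _ (fun b => F0 (bproj 0 b))); first by move=> b [].
    exact: (bcont_comp cf (@bcont_bproj _ _ _ 0 _ cg0)).
  + apply: (@bcont_sub _ _ _ (fun b => F (bproj 1 b))); first by move=> b [].
    exact: bcont_bproj.
- apply: (@bcont_sub _ _ _ (fun b => F0 (bproj 0 b))); first by move=> b [[]].
  exact: bcont_bproj.
- apply/seteqP; split=> [z [b Fb e]|z [b [[F0b Fb] e] <-]]; last by exists (bproj 1 b).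
  have [b0 F0b e0] : (g0 @` F0) z by rewrite -sT.
  have [c hc] := bproj_surj (fun k => if k is 0 then b0 else b).
  by exists c; rewrite ?hc // e0.
Qed.

Definition inN (q : seq nat) (b : baire) := forall i, (i < size q)%N -> b i = nth 0 q i.

Definition piece (Z : Type) (F : set baire) (g : baire -> Z) (q : seq nat) : set Z :=
  g @` (F `&` inN q).

Lemma bclosed_inN F q : bclosed F -> bclosed (F `&` inN q).
Proof.
move=> cF b hb; split; first by apply: cF => n; have [c [Fc _] bc] := hb n; exists c.
move=> i iq; have [c [_ qc] bc] := hb (size q).
by rewrite bc // qc.
Qed.

Lemma piece0 Z F (g : baire -> Z) : piece F g [::] = g @` F.
Proof. by congr image; apply/seteqP; split=> [b []|b Fb]. Qed.

Lemma inN_rcons q b : inN q b -> inN (rcons q (b (size q))) b.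
Proof.
move=> h i; rewrite size_rcons ltnS leq_eqVlt nth_rcons => /orP[/eqP->|iq].
  by rewrite ltnn eqxx.
by rewrite iq h.
Qed.

Lemma piece_rcons Z F (g : baire -> Z) q z :
  piece F g q z -> exists j, piece F g (rcons q j) z.
Proof.
move=> [b [Fb qb] <-]; exists (b (size q)), b => //; split=> //.
exact: inN_rcons.
Qed.

Lemma ana_piece Z (op : set (set Z)) F g q :
  bclosed F -> bcont op F g -> ana op (piece F g q).
Proof.
move=> cF cg; exists (F `&` inN q), g; split=> //; first exact: bclosed_inN.
by apply: bcont_sub cg => b [].
Qed.

Lemma sigmaC Z (op : set (set Z)) E : <<s op >> E -> <<s op >> (~` E).
Proof.
by rewrite -setTD; have [_ + _] := smallest_sigma_algebra setT op; apply.
Qed.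

Lemma sigmaT Z (op : set (set Z)) : <<s op >> setT.
Proof. by have := sigmaC (@sigma_algebra0 _ setT op); rewrite setC0. Qed.

Lemma sigmaU Z (op : set (set Z)) (E : nat -> set Z) :
  (forall n, <<s op >> (E n)) -> <<s op >> (\bigcup_n E n).
Proof. by have [_ _] := smallest_sigma_algebra setT op; apply. Qed.

(* Lusin's separation theorem: non-separability passes to a pair of one-step refinements,
   and along the resulting branches it contradicts the separation of the two limit points. *)
Lemma lusin_separation Z (op : set (set Z)) S1 S2 :
  hausdorff_base op -> ana op S1 -> ana op S2 -> S1 `&` S2 = set0 ->
  exists E, [/\ <<s op >> E, S1 `<=` E & E `&` S2 = set0].
Proof.
move=> sop [F1 [g1 [cF1 cg1 e1]]] [F2 [g2 [cF2 cg2 e2]]] S120.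
pose Sep A B := exists E, [/\ <<s op >> E, A `<=` E & E `&` B = set0].
rewrite -/(Sep S1 S2).
have [//|nS] := pselect (Sep S1 S2); exfalso.
pose St (q : seq nat * seq nat) :=
  ~ Sep (piece F1 g1 q.1) (piece F2 g2 q.2) /\ size q.1 = size q.2.
have step q : St q -> exists ij : nat * nat, St (rcons q.1 ij.1, rcons q.2 ij.2).
  move=> [nq sq]; apply: contrapT => /forallNP h; apply: nq.
  have h' i j : Sep (piece F1 g1 (rcons q.1 i)) (piece F2 g2 (rcons q.2 j)).
    apply: contrapT => nh; apply: (h (i, j)); split=> //=.
    by rewrite !size_rcons sq.
  have /choice[E hE] : forall ij : nat * nat, exists E,
    [/\ <<s op >> E, piece F1 g1 (rcons q.1 ij.1) `<=` E
      & E `&` piece F2 g2 (rcons q.2 ij.2) = set0] by move=> [i j]; apply: h'.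
  (* This is the union over [i] of the intersections over [j] of [E (i, j)], written with the
     operations of a sigma-algebra. *)
  exists (\bigcup_i ~` (\bigcup_j ~` E (i, j))); split.
  - apply: (@sigmaU) => i; apply: (@sigmaC); apply: (@sigmaU) => j; apply: (@sigmaC).
    by have [] := hE (i, j).
  - move=> z zp; have [i hi] := piece_rcons zp; exists i => // -[j _ nE]; apply: nE.
    by have [_ sub _] := hE (i, j); apply: sub.
  - rewrite -subset0 => z [[i _ hi] zp]; have [j hj] := piece_rcons zp.
    have [_ _ <-] := hE (i, j); split=> //.
    by apply: contrapT => nE; apply: hi; exists j.
have St0 : St ([::], [::]) by split=> //; rewrite !piece0 -e1 -e2.
have [qs [qs0 Stq qsS]] := @dependent_choice _ (fun=> St)
  (fun _ q q' => exists i j, q' = (rcons q.1 i, rcons q.2 j)) _ St0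
  (fun _ q Sq => let: ex_intro ij h := step q Sq in
    ex_intro _ _ (conj h (ex_intro _ _ (ex_intro _ _ erefl)))).
have szq n : size (qs n).1 = n /\ size (qs n).2 = n.
  elim: n => [|n [IH1 IH2]]; first by rewrite qs0.
  by have [i [j ->]] := qsS n; rewrite /= !size_rcons IH1 IH2.
pose b1 n := nth 0 (qs n.+1).1 n; pose b2 n := nth 0 (qs n.+1).2 n.
have inb n : inN (qs n).1 b1 /\ inN (qs n).2 b2.
  elim: n => [|n [IH1 IH2]]; first by rewrite qs0.
  have [s1 s2] := szq n; have [i [j e]] := qsS n.
  have B1 : b1 n = i by rewrite /b1 /= e /= nth_rcons s1 ltnn eqxx.
  have B2 : b2 n = j by rewrite /b2 /= e /= nth_rcons s2 ltnn eqxx.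
  rewrite /= e /=; split; first by rewrite -B1 -{2}s1; apply: inN_rcons.
  by rewrite -B2 -{2}s2; apply: inN_rcons.
have agr (F : set baire) q b n : size q = n -> inN q b ->
    (exists2 c, F c & inN q c) -> exists2 c, F c & agree n b c.
  move=> sq qb [c Fc qc]; exists c => // i im; rewrite qb ?qc ?sq //.
have ne n : (exists2 c, F1 c & inN (qs n).1 c) /\
            (exists2 c, F2 c & inN (qs n).2 c).
  have [nq _] := Stq n; split; apply: contrapT => he; apply: nq.
    exists set0; split; [exact: sigma_algebra0| |by rewrite set0I].
    by move=> z [c [Fc qc] _]; apply: he; exists c.
  exists setT; split=> //; first exact: sigmaT.
  rewrite -subset0 => z [_ [c [Fc qc] _]]; apply: he; by exists c.
have F1b : F1 b1.
  by apply: cF1 => n; apply: agr (szq n).1 (inb n).1 (ne n).1.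
have F2b : F2 b2.
  by apply: cF2 => n; apply: agr (szq n).2 (inb n).2 (ne n).2.
have /sop[U [V [opU opV Ub Vb UV0]]] : g1 b1 <> g2 b2.
  move=> e; have : (S1 `&` S2) (g1 b1) by rewrite e1 e2 e; split; [exists b1|exists b2].
  by rewrite S120.
have [n hn] := cg1 _ F1b U opU Ub; have [m hm] := cg2 _ F2b V opV Vb.
have [nq _] := Stq (maxn n m); apply: nq; set k := maxn n m.
exists U; split; first exact: sub_sigma_algebra.
  move=> _ [c [Fc qc] <-]; apply: hn => // i im; rewrite (inb k).1 ?qc //;
  by rewrite (szq k).1 (leq_trans im) // leq_maxl.
rewrite -subset0 => z [Uc [c [Fc qc] e]]; rewrite -UV0; split=> //; rewrite -e.
apply: hm => // i im; rewrite (inb k).2 ?qc //;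
by rewrite (szq k).2 (leq_trans im) // leq_maxr.
Qed.

(** * True stages *)

Section true_stages.
Variables (Om : Type) (lt : Om -> Om -> Prop).
Hypothesis lt_wf : well_founded lt.
Hypothesis lt_trans : forall x y z, lt x y -> lt y z -> lt x z.
Hypothesis lt_total : forall x y, [\/ lt x y, x = y | lt y x].

Variables (K : eqType) (Br : set (nat -> K)).
Variables (ord : seq nat -> Om) (G : seq nat -> set (nat -> K)) (leaf : set (seq nat)).
Hypothesis leafP : forall a z, leaf a -> Br z -> G a z ->
  exists k, forall z', Br z' -> mkseq z' k = mkseq z k -> G a z'.
Hypothesis nodeP : forall a z, ~ leaf a -> Br z ->
  (G a z <-> exists i, ~ G (rcons a i) z).
Hypothesis ord_child : forall a i, ~ leaf a -> lt (ord (rcons a i)) (ord a).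

Lemma lt_irr x : ~ lt x x.
Proof. by elim/(well_founded_ind lt_wf): x => x IH xx; apply: (IH x). Qed.

(* For [D : data] at level [o], [D.1 a] is the set of nodes declaring the code [a] true,
   and [D.2 a s] says that [s] decides [a]: a decision is respected by the successors of
   [s] in the order of the next level. *)
Let data := ((seq nat -> seq K -> Prop) * (seq nat -> seq K -> Prop))%type.

Let condD (D : data) o (s t : seq K) :=
  forall a, ord a = o -> D.2 a s -> D.1 a t -> D.1 a s.

Definition ts_rel_step o (rec : forall v, lt v o -> data) (s t : seq K) :=
  prefix s t /\ forall v (h : lt v o), condD (rec v h) v s t.

(** At a node of the derivation [G a] is the union of the complements of its children, so [a] is
    declared true once [s] or a predecessor of [s] has decided some child without declaring it
    true. *)
Definition ts_open_step o (rec : forall v, lt v o -> data) (a : seq nat) (s : seq K) :=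
  (leaf a /\ forall z, Br z -> mkseq z (size s) = s -> G a z) \/
  (~ leaf a /\ exists i r v (h : lt v o), [/\ ord (rcons a i) = v,
     ts_rel_step rec r s, (rec v h).2 (rcons a i) r & ~ (rec v h).1 (rcons a i) r]).

Definition ts_height (r : seq K -> seq K -> Prop) (s : seq K) :=
  count (fun i => `[< r (take i s) s >]) (iota 0 (size s)).

Definition ts_new (r : seq K -> seq K -> Prop) (O : seq K -> Prop) (s : seq K) :=
  O s /\ forall i, (i < size s)%N -> r (take i s) s -> ~ O (take i s).

(* [s] decides [a] only if no code of index at most that of [a] is entered at [s]; bounding
   the index by the height makes the orders stabilize at limit levels. *)
Definition ts_step o (rec : forall v, lt v o -> data) : data :=
  (ts_open_step rec,
   fun a s => (pickle a < ts_height (ts_rel_step rec) s)%N /\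
     forall b, ord b = o -> (pickle b <= pickle a)%N ->
       ~ ts_new (ts_rel_step rec) (ts_open_step rec b) s).

Definition ts_data : Om -> data := Fix lt_wf (fun=> data) ts_step.

Definition ts_open o := (ts_data o).1.
Definition ts_dec o := (ts_data o).2.

Definition ts_cond o (s t : seq K) :=
  forall a, ord a = o -> ts_dec o a s -> ts_open o a t -> ts_open o a s.

Definition ts_rel o (s t : seq K) := prefix s t /\ forall v, lt v o -> ts_cond v s t.

Lemma ts_dataE o : ts_data o = ts_step (fun v (_ : lt v o) => ts_data v).
Proof.
rewrite /ts_data Fix_eq // => x f g fg; congr ts_step.
by apply: functional_extensionality_dep => v; apply: funext => h.
Qed.

Lemma ts_relE o : ts_rel_step (fun v (_ : lt v o) => ts_data v) = ts_rel o.
Proof. by []. Qed.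

Lemma ts_openE o a s : ts_open o a s <->
  (leaf a /\ forall z, Br z -> mkseq z (size s) = s -> G a z) \/
  (~ leaf a /\ exists i r v, [/\ lt v o, ord (rcons a i) = v,
     ts_rel o r s, ts_dec v (rcons a i) r & ~ ts_open v (rcons a i) r]).
Proof.
rewrite {1}/ts_open ts_dataE /= /ts_open_step ts_relE; split.
  case=> [?|[la [i [r [v [h [e R d O]]]]]]]; [by left|right; split=> //].
  by exists i, r, v.
case=> [?|[la [i [r [v [h e R d O]]]]]]; [by left|right; split=> //].
by exists i, r, v, h.
Qed.

Lemma ts_decE o a s : ts_dec o a s <-> (pickle a < ts_height (ts_rel o) s)%N /\
     forall b, ord b = o -> (pickle b <= pickle a)%N ->
       ~ ts_new (ts_rel o) (ts_open o b) s.
Proof.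
rewrite {1}/ts_dec /ts_open ts_dataE /= ts_relE.
by [].
Qed.

Lemma ts_rel_refl o s : ts_rel o s s.
Proof. by split=> [|v vo a av d O]; first exact: prefix_refl. Qed.

Lemma ts_relW o v s t : lt v o -> ts_rel o s t -> ts_rel v s t.
Proof. by move=> vo [p c]; split=> // u uv; apply: c; apply: lt_trans vo. Qed.

Lemma ts_rel_prefix o s t : ts_rel o s t -> prefix s t. Proof. by case. Qed.

Lemma ts_decW o a b s : pickle b <= pickle a -> ts_dec o a s -> ts_dec o b s.
Proof.
move=> ba; rewrite !ts_decE => -[h n]; split; first exact: leq_ltn_trans h.
by move=> c oc cb; apply: n => //; apply: leq_trans ba.
Qed.

Lemma prefix_take_eq (s t : seq K) : prefix s t -> s = take (size s) t.
Proof. by rewrite prefixE => /eqP. Qed.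

Lemma count_height_le (P Q : nat -> bool) m n :
  (m <= n)%N -> (forall i, (i < m)%N -> P i -> Q i) ->
  (count P (iota 0 m) <= count Q (iota 0 n))%N.
Proof.
move=> mn PQ; rewrite -(subnKC mn) iotaD count_cat.
apply: leq_trans (leq_addr _ _); rewrite -!sum1_count.
rewrite [leqRHS]big_mkcond [leqLHS]big_mkcond /= big_seq [leqRHS]big_seq.
apply: leq_sum => i; rewrite mem_iota add0n => /PQ.
by case: (P i) => // ->.
Qed.

(** What [s] decides is still decided by [t]. The height does not drop, since predecessors of [s]
    precede [t]; and a code of no larger index entered at [t] would, by the condition between [s]
    and [t], be open already at [s]. *)
Let cond_trans_of o : (forall s t u, ts_rel o s t -> ts_rel o t u -> ts_rel o s u) ->
  forall s t u, ts_rel o s t -> ts_cond o s t -> ts_cond o t u -> ts_cond o s u.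
Proof.
move=> tr s t u rst cst ctu a av ds Ou; have pst := ts_rel_prefix rst.
have [est|nst] := eqVneq s t; first by rewrite est in ds *; apply: ctu.
apply: (cst a av ds); apply: (ctu a av) => //.
rewrite ts_decE; split.
  apply: leq_trans ((ts_decE _ _ _).1 ds).1 _; apply: count_height_le.
    exact: size_prefix.
  move=> i isz /asboolP rs; apply/asboolP.
  suff <- : take i s = take i t by apply: tr rst.
  by rewrite (prefix_take_eq pst) take_takel // ltnW.
move=> b bv ba [Ob nb].
have szst : (size s < size t)%N.
  rewrite ltn_neqAle size_prefix // andbT; apply: contra_neq nst => e.
  by rewrite (prefix_take_eq pst) e take_size.
have := nb _ szst; rewrite -(prefix_take_eq pst) => /(_ rst); apply.
by apply: (cst b bv) => //; apply: ts_decW ds.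
Qed.

Lemma ts_rel_trans o s t u : ts_rel o s t -> ts_rel o t u -> ts_rel o s u.
Proof.
elim/(well_founded_ind lt_wf): o s t u => o IH s t u rst rtu.
split; first by apply: prefix_trans (ts_rel_prefix rtu); apply: ts_rel_prefix rst.
move=> v vo; apply: (cond_trans_of (IH v vo)) (ts_relW vo rst) _ _.
  by have [_] := rst; apply.
by have [_] := rtu; apply.
Qed.

Lemma ts_cond_trans o s t u :
  ts_rel o s t -> ts_cond o s t -> ts_cond o t u -> ts_cond o s u.
Proof. exact: (cond_trans_of (@ts_rel_trans o)). Qed.

Lemma ts_open_up o a s t : ts_rel o s t -> ts_open o a s -> ts_open o a t.
Proof.
move=> rst; rewrite !ts_openE.
case=> [[la h]|[la [i [r [v [vo e rs d nO]]]]]]; [left|right]; split=> //.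
  move=> z Bz e; apply: h => //; have p := ts_rel_prefix rst.
  have := congr1 (take (size s)) e; rewrite -(prefix_take_eq p) => <-.
  rewrite /mkseq -map_take take_iota; set m := minn _ _.
  have -> : m = size s by apply/minn_idPl; apply: size_prefix.
  by rewrite size_map size_iota.
by exists i, r, v; split=> //; apply: ts_rel_trans rst.
Qed.

(** This is what makes the predecessors of a node a chain: of two prefixes preceding the same node,
    the shorter one precedes the longer one. *)
Lemma ts_club o r s t : ts_rel o s t -> ts_cond o r t -> ts_cond o r s.
Proof. by move=> st rt a ao dr Os; apply: rt => //; apply: ts_open_up st Os. Qed.

Lemma ts_height_size r s : (ts_height r s <= size s)%N.
Proof. by have := count_size (fun i => `[< r (take i s) s >]) (iota 0 (size s)); rewrite size_iota. Qed.

(** A failure requires a code decided at [r], whose index is below the height of [r]. So finitely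
    many levels can ever separate [r] from its extensions. *)
Lemma ts_cond_finite o r t : ~ ts_cond o r t ->
  exists a, ord a = o /\ (pickle a < size r)%N.
Proof.
move=> nc; apply: contrapT => no; apply: nc => a ao /ts_decE[h _] _.
by exfalso; apply: no; exists a; split=> //; apply: leq_trans h (ts_height_size _ _).
Qed.

(** The empty sequence has height 0 and decides nothing. *)
Lemma ts_rel_nil o t : ts_rel o [::] t.
Proof.
split; first exact: prefix0s.
by move=> v vo a av /ts_decE[].
Qed.

(** * True stages along a fixed branch *)

Section branch.
Variables (z : nat -> K) (Bz : Br z).
Let pre k := mkseq z k.

(** A code that is decided but not open counts as rejected; correctness means that the branch
    confirms every rejection. *)
Definition ts_correct o k :=
  forall a, ord a = o -> ts_dec o a (pre k) -> G a z -> ts_open o a (pre k).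

Definition ts_true o k := forall v, lt v o -> ts_correct v k.

Let inf o := forall N, exists2 k, (N <= k)%N & ts_true o k.
Let sound o := forall a, ord a = o ->
  (G a z <-> exists2 k, ts_true o k & ts_open o a (pre k)).

Lemma take_pre i k : (i <= k)%N -> take i (pre k) = pre i.
Proof. by move=> ik; rewrite /pre /mkseq -map_take take_iota (minn_idPl ik). Qed.

Lemma prefix_pre i k : (i <= k)%N -> prefix (pre i) (pre k).
Proof. by move=> ik; rewrite prefixE size_mkseq take_pre. Qed.

Lemma ts_trueW o v k : lt v o -> ts_true o k -> ts_true v k.
Proof. by move=> vo t u uv; apply: t; apply: lt_trans vo. Qed.

Lemma ts_true_rel o i k : (forall v, lt v o -> sound v) ->
  (i <= k)%N -> ts_true o i -> ts_true o k -> ts_rel o (pre i) (pre k).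
Proof.
move=> so ik ti tk; split; first exact: prefix_pre.
move=> v vo a av d Ok; apply: (ti v vo) => //; apply/(so v vo a av).
by exists k => //; apply: ts_trueW tk.
Qed.

(** If the branch opens a code at some true stage [j], the code is still open at a true stage beyond
    both [j] and [k]. The stage [i] precedes that one as well, so its decision must agree. *)
Lemma ts_true_pred o i k : (forall v, lt v o -> sound v) -> inf o ->
  (i <= k)%N -> ts_rel o (pre i) (pre k) -> ts_true o k -> ts_true o i.
Proof.
move=> so io ik rik tk v vo a av d /(so v vo a av)[j tj Oj].
have [l lkj tl] := io (maxn k j).
have kl : (k <= l)%N by apply: leq_trans lkj; rewrite leq_maxl.
have jl : (j <= l)%N by apply: leq_trans lkj; rewrite leq_maxr.
have [_ ril] : ts_rel o (pre i) (pre l).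
  exact: ts_rel_trans rik (ts_true_rel so kl tk tl).
apply: (ril v vo a av) => //; apply: ts_open_up Oj.
apply: ts_true_rel => //; last exact: ts_trueW tl.
by move=> u uv; apply: so; apply: lt_trans vo.
Qed.

Lemma ts_height_true o k : (forall v, lt v o -> sound v) -> inf o -> ts_true o k ->
  ts_height (ts_rel o) (pre k) = count (fun i => `[< ts_true o i >]) (iota 0 k).
Proof.
move=> so io tk; rewrite /ts_height size_mkseq; apply: eq_in_count => i.
rewrite mem_iota add0n /= => ik; rewrite take_pre ?(ltnW ik) //.
apply: asbool_equiv_eq; split=> h.
  by apply: ts_true_pred h tk => //; apply: ltnW.
by apply: ts_true_rel => //; apply: ltnW.
Qed.

Lemma ts_new_once o b i k : (forall v, lt v o -> sound v) -> (i < k)%N ->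
  ts_true o i -> ts_true o k ->
  ts_open o b (pre i) -> ~ ts_new (ts_rel o) (ts_open o b) (pre k).
Proof.
move=> so ik ti tk Oi [Ok /(_ i)]; rewrite size_mkseq take_pre ?(ltnW ik) //.
by move=> /(_ ik); apply=> //; apply: ts_true_rel => //; apply: ltnW.
Qed.

Lemma inf_count (P : nat -> Prop) : (forall N, exists2 k, (N <= k)%N & P k) ->
  forall n, exists N, forall k, (N <= k)%N ->
    (n < count (fun i => `[< P i >]) (iota 0 k))%N.
Proof.
move=> infP; elim=> [|n [N hN]].
  have [k _ Pk] := infP 0; exists k.+1 => l kl.
  by rewrite -has_count; apply/hasP; exists k; [rewrite mem_iota|apply/asboolP].
have [k Nk Pk] := infP N; exists k.+1 => l kl.
have e : iota 0 k.+1 = iota 0 k ++ [:: k] by rewrite -addn1 iotaD.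
rewrite -(subnKC kl) iotaD count_cat e count_cat /=.
have -> : `[< P k >] by apply/asboolP.
by rewrite addn0 addn1 addSn ltnS; apply: leq_trans (leq_addr _ _); apply: hN.
Qed.

(** At true stages the height counts the earlier true stages and tends to infinity. A code is new at
    no more than one true stage, so the finitely many codes of index at most that of [b] eventually
    stop blocking decisions. *)
Lemma ts_dec_eventually o b : (forall v, lt v o -> sound v) -> inf o ->
  exists N, forall k, (N <= k)%N -> ts_true o k -> ts_dec o b (pre k).
Proof.
move=> so io.
have [N1 hN1] := inf_count io (pickle b).
suff [N2 hN2] : exists N, forall c k, (pickle c < (pickle b).+1)%N -> (N <= k)%N ->
    ts_true o k -> ~ ts_new (ts_rel o) (ts_open o c) (pre k).
  exists (maxn N1 N2) => k; rewrite geq_max => /andP[k1 k2] tk.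
  rewrite ts_decE; split; first by rewrite ts_height_true //; apply: hN1.
  by move=> c _ cb; apply: hN2.
elim: (pickle b).+1 => [|n [N hN]]; first by exists 0.
have [[i [c [pc ti Oi]]]|no] :=
  pselect (exists i c, [/\ pickle c = n, ts_true o i & ts_open o c (pre i)]).
  exists (maxn N i.+1) => d k; rewrite ltnS leq_eqVlt geq_max => + /andP[Nk ik] tk.
  case/orP=> [/eqP pd|dn]; last exact: hN.
  have e : d = c by apply: (pcan_inj pickleK); rewrite pd.
  by rewrite e; apply: ts_new_once Oi.
exists N => d k; rewrite ltnS leq_eqVlt => + Nk tk.
case/orP=> [/eqP pd|dn]; last exact: hN.
by move=> [Od _]; apply: no; exists k, d.
Qed.

(** If a child of [a] is false, a true stage late enough to decide it opens [a]. Conversely, were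
    the child rejected by [r] true, it would be open at a later true stage, against the relation
    between [r] and that stage. *)
Lemma ts_sound o : (forall v, lt v o -> sound v) -> (forall v, lt v o -> inf v) ->
  inf o -> sound o.
Proof.
move=> so iv io a ao; have [la|la] := pselect (leaf a).
  split=> [Ga|[k tk /ts_openE[[_ h]|[]//]]]; last first.
    by apply: h => //; rewrite size_mkseq.
  have [k hk] := leafP la Bz Ga; have [l kl tl] := io k.
  exists l => //; apply/ts_openE; left; split=> // z' Bz'.
  rewrite size_mkseq => e; apply: hk => //.
  by rewrite -[mkseq z k](take_pre kl) -e /mkseq -map_take take_iota (minn_idPl kl).
split=> [/(nodeP la Bz)[i nGi]|].
  pose b := rcons a i; pose v := ord b.
  have vo : lt v o by rewrite -ao; apply: ord_child.
  have sv u : lt u v -> sound u by move=> uv; apply: so; apply: lt_trans vo.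
  have [N hN] := ts_dec_eventually b sv (iv v vo).
  have [k Nk tk] := io N; exists k => //; apply/ts_openE; right; split=> //.
  exists i, (pre k), v; split=> //; first exact: ts_rel_refl.
    by apply: hN => //; apply: ts_trueW tk.
  move=> Ob; apply: nGi; apply/(so v vo b erefl); exists k => //.
  exact: ts_trueW tk.
move=> [k tk /ts_openE[[]//|[_ [i [r [v [vo e rs d nO]]]]]]].
apply/(nodeP la Bz); exists i => /(so v vo _ e)[j tj Oj].
have [l lkj tl] := io (maxn k j).
have kl : (k <= l)%N by apply: leq_trans lkj; rewrite leq_maxl.
have jl : (j <= l)%N by apply: leq_trans lkj; rewrite leq_maxr.
apply: nO; have [_ rl] := ts_rel_trans rs (ts_true_rel so kl tk tl).
apply: (rl v vo) => //; apply: ts_open_up Oj; apply: ts_true_rel => //.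
  by move=> u uv; apply: so; apply: lt_trans vo.
exact: ts_trueW tl.
Qed.

Lemma ex_least (P : nat -> Prop) : (exists n, P n) ->
  exists n, P n /\ forall m, P m -> (n <= m)%N.
Proof.
move=> [n Pn]; have ex : exists n, `[< P n >] by exists n; apply/asboolP.
exists (ex_minn ex); case: ex_minnP => m /asboolP Pm h; split=> // k Pk.
by apply: h; apply/asboolP.
Qed.

(* Among the failures of correctness beyond [N], one with a code of least index [a]
   cannot exist: the true stage at which [a] is first entered is itself incorrect,
   with a witness of smaller index. *)
Lemma ts_correct_inf o : (forall v, lt v o -> sound v) -> inf o -> sound o ->
  forall N, exists2 k, (N <= k)%N & ts_true o k /\ ts_correct o k.
Proof.
move=> sv io so N; apply: contrapT => no.
have fail k : (N <= k)%N -> ts_true o k -> exists a,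
    [/\ ord a = o, ts_dec o a (pre k), G a z & ~ ts_open o a (pre k)].
  move=> Nk tk; apply: contrapT => nf; apply: no; exists k => //; split=> // a ao da Ga.
  by apply: contrapT => nO; apply: nf; exists a.
pose P n := exists k a, [/\ (N <= k)%N, ts_true o k, pickle a = n &
  [/\ ord a = o, ts_dec o a (pre k), G a z & ~ ts_open o a (pre k)]].
have [n [[k [a [Nk tk an [ao da Ga nO]]]] min]] : exists n, P n /\ forall m, P m -> (n <= m)%N.
  apply: ex_least; have [k Nk tk] := io N; have [a h] := fail k Nk tk.
  by exists (pickle a), k, a.
have [j [[tj Oj] minj]] : exists j, (ts_true o j /\ ts_open o a (pre j)) /\
    forall m, ts_true o m /\ ts_open o a (pre m) -> (j <= m)%N.
  by apply: ex_least; have /(so a ao)[j tj Oj] := Ga; exists j.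
have kj : (k <= j)%N.
  rewrite leqNgt; apply/negP => jk; apply: nO; apply: ts_open_up Oj.
  by apply: ts_true_rel => //; apply: ltnW.
have new : ts_new (ts_rel o) (ts_open o a) (pre j).
  split=> // i; rewrite size_mkseq => ij; rewrite take_pre ?(ltnW ij) // => rij Oi.
  have ti : ts_true o i by apply: ts_true_pred rij tj => //; apply: ltnW.
  by have := minj i (conj ti Oi); rewrite leqNgt ij.
have [b [bo db Gb nOb]] := fail j (leq_trans Nk kj) tj.
have : (n <= pickle b)%N.
  by apply: min; exists j, b; split=> //; apply: leq_trans kj.
have [_ /(_ a ao)] := (ts_decE _ _ _).1 db.
rewrite an => hn nb; exact: hn.
Qed.

(** This isolates the last level that can matter to a stage of height at most [n], so successor and
    limit levels are treated alike. *)
Lemma ord_max n o : (forall a, (pickle a < n)%N -> ~ lt (ord a) o) \/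
  exists v, lt v o /\ forall a, (pickle a < n)%N -> lt (ord a) o ->
    ord a = v \/ lt (ord a) v.
Proof.
elim: n => [|n IH]; first by left.
have [[a [an ao]]|no] := pselect (exists a, pickle a = n /\ lt (ord a) o); last first.
  have nn b : (pickle b < n.+1)%N -> lt (ord b) o -> (pickle b < n)%N.
    rewrite ltnS leq_eqVlt => /orP[/eqP pb bo|//].
    by exfalso; apply: no; exists b.
  case: IH => [IH|[v [vo IH]]]; [left|right; exists v; split=> //].
    by move=> b bn bo; apply: (IH b) => //; apply: nn.
  by move=> b bn bo; apply: IH => //; apply: nn.
right.
have uniq_a b : pickle b = n -> b = a.
  by move=> bn; apply: (pcan_inj pickleK); rewrite an.
case: IH => [IH|[v [vo IH]]].
  exists (ord a); split=> // b; rewrite ltnS leq_eqVlt => /orP[/eqP/uniq_a->|bn bo].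
    by left.
  by case: (IH b).
have [av|av|va] := lt_total (ord a) v.
- exists v; split=> // b; rewrite ltnS leq_eqVlt => /orP[/eqP/uniq_a->|bn bo].
    by right.
  exact: IH.
- exists v; split=> // b; rewrite ltnS leq_eqVlt => /orP[/eqP/uniq_a->|bn bo].
    by left.
  exact: IH.
- exists (ord a); split=> // b; rewrite ltnS leq_eqVlt => /orP[/eqP/uniq_a->|bn bo].
    by left.
  by right; have [->//|bv] := IH b bn bo; apply: lt_trans va.
Qed.

Lemma ts_inf o : (forall v, lt v o -> sound v) -> (forall v, lt v o -> inf v) -> inf o.
Proof.
move=> so iv N.
(* Only the finitely many levels of codes of index below [N] can discard a stage
   having at most [N] predecessors; [T] is what remains after the last such level. *)
have [T [infT TP]] : exists T : nat -> Prop,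
    (forall M, exists2 k, (M <= k)%N & T k) /\
    forall v, lt v o ->
      (forall k, T k -> ts_correct v k) \/
      ((forall a, (pickle a < N)%N -> ord a <> v) /\ forall k, ts_true v k -> T k).
  have [h|[v [vo h]]] := ord_max N o.
    exists (fun=> True); split; first by move=> M; exists M.
    by move=> v vo; right; split=> // a aN e; apply: (h a) => //; rewrite e.
  exists (fun k => ts_true v k /\ ts_correct v k); split.
    apply: ts_correct_inf; [|exact: iv|exact: so].
    by move=> u uv; apply: so; apply: lt_trans vo.
  move=> u uo; have [uv|->|vu] := lt_total u v; first by left=> k [t _]; apply: t.
    by left=> k [].
  right; split=> [a aN e|k tk].
    rewrite -e in uo; have [e'|lt'] := h a aN uo.
      by apply: (@lt_irr v); rewrite -e e' in vu.
    by apply: (@lt_irr v); rewrite e in lt'; apply: lt_trans vu lt'.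
  split; last exact: tk.
  exact: ts_trueW tk.
have [k [[Nk Tk] mink]] : exists k, ((N <= k)%N /\ T k) /\
    forall m, (N <= m)%N /\ T m -> (k <= m)%N.
  by apply: ex_least; have [k Nk Tk] := infT N; exists k.
exists k => //.
(* Since [k] is the first member of [T] from [N] on, all earlier members lie below [N]; at the later
   levels this bounds the height of [k] by [N]. *)
have cnt : (count (fun i => `[< T i >]) (iota 0 k) <= N)%N.
  rewrite -(subnKC Nk) iotaD count_cat add0n.
  have -> : count (fun i => `[< T i >]) (iota N (k - N)) = 0.
    apply/eqP; rewrite -leqn0 leqNgt -has_count; apply/hasPn => i.
    rewrite mem_iota subnKC // => /andP[Ni ik]; apply/asboolP => Ti.
    by have := mink i (conj Ni Ti); rewrite leqNgt ik.
  by rewrite addn0; have := count_size (fun i => `[< T i >]) (iota 0 N); rewrite size_iota.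
move=> v; elim/(well_founded_ind lt_wf): v => v IH vo.
have tv : ts_true v k by move=> u uv; apply: IH => //; apply: lt_trans vo.
have [h|[h1 h2]] := TP v vo; first exact: h.
move=> a av /ts_decE[ha _] _; exfalso; apply: (h1 a) => //.
apply: leq_trans ha _; apply: leq_trans cnt.
rewrite ts_height_true //; [|by move=> u uv; apply: so; apply: lt_trans vo|exact: iv].
by apply: sub_count => i /asboolP/h2 Ti; apply/asboolP.
Qed.

Lemma ts_true_inf_sound o : inf o /\ sound o.
Proof.
elim/(well_founded_ind lt_wf): o => o IH.
have iv v : lt v o -> inf v by move=> /IH[].
have so v : lt v o -> sound v by move=> /IH[].
by have io := ts_inf so iv; split=> //; apply: ts_sound.
Qed.

End branch.
End true_stages.

(** * Acyclic relations *)

(** A shortest closed subwalk is a cycle: irreflexivity excludes length 1 and the absence of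
    backtracking excludes length 2. *)
Lemma nonbacktracking_cycle (V : Type) (r : V -> V -> Prop) (w : nat -> V) N :
  (forall x, ~ r x x) -> (0 < N)%N -> w 0 = w N -> rel_path r N w ->
  (forall i, (i.+2 <= N)%N -> w i <> w i.+2) -> exists n e, rel_cycle r n e.
Proof.
move=> irr N0 w0N pw nb.
have [n [[n0 [i [iN wi]]] min]] : exists n, ((0 < n)%N /\ exists i, (i + n <= N)%N /\
    w i = w (i + n)%N) /\ forall m, ((0 < m)%N /\ exists i, (i + m <= N)%N /\
    w i = w (i + m)%N) -> (n <= m)%N.
  by apply: ex_least; exists N; split=> //; exists 0; rewrite add0n.
have n1 : n <> 1%N.
  move=> n1; subst n; have := pw i; rewrite -addn1 -wi => h; apply: (irr (w i)).
  exact: h.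
have n2 : n <> 2.
  by move=> n2; subst n; rewrite addn2 in iN wi; apply: (nb i).
exists n, (fun k => w (i + k)%N); split; first by lia.
  by move=> k kn; rewrite addnS; apply: pw; lia.
move=> a b an bn ab; split; last first.
  by case=> -[-> ->]; rewrite addn0.
wlog lt_ab : a b an bn ab / (a < b)%N => [wl|e].
  move=> e; have [lt_ab|ge_ab] := ltnP a b; first exact: wl.
  have lt_ba : (b < a)%N by lia.
  by have [[-> ->]|[-> ->]] := wl b a bn an (nesym ab) lt_ba (esym e); [right|left].
have nba : (n <= b - a)%N.
  apply: min; split; first by lia.
  exists (i + a)%N; split; first by lia.
  by rewrite e; congr w; lia.
by left; lia.
Qed.

(** The argument takes place in the bipartite double cover, because every vertex carries separate
    points of [X] and of [Y], and an edge binds the first at its source to the second at its target.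
    A simple path from the left copy of [s0] to the right copy of [t0] has odd length and projects
    to a walk that the edge closes without backtracking. *)
Lemma acyclic_edge_cut (V : finType) (r : V -> V -> Prop) (s0 t0 : V) :
  (forall x, ~ r x x) -> rel_acyclic (fun s t => r s t \/ r t s) -> r s0 t0 ->
  exists CL CR : set V, [/\ CL s0, ~ CR t0 &
    forall s t, r s t -> (s, t) <> (s0, t0) -> (CL s <-> CR t)].
Proof.
move=> irr acy r0.
pose e0 s t := r s t /\ (s, t) <> (s0, t0).
pose e1 (u v : V + V) : bool := match u, v with
  | inl s, inr t => `[< e0 s t >] | inr t, inl s => `[< e0 s t >] | _, _ => false end.
pose x0 : V + V := inl s0.
exists (fun s => connect e1 x0 (inl s)), (fun t => connect e1 x0 (inr t)); split.
- exact: connect0.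
- move=> /connectP[p pp lp].
  move: lp; case: (shortenP pp) => {pp}p pp up _ lp.
  pose v i := nth x0 (x0 :: p) i.
  pose w i := match v i with inl s => s | inr t => t end.
  pose right i := if v i is inr _ then true else false.
  have step i : (i < size p)%N -> e1 (v i) (v i.+1).
    by move=> ip; move/(pathP x0): pp => /(_ i ip).
  have side i : (i <= size p)%N -> right i = odd i.
    elim: i => // i IH ip; have := step i ip; rewrite /= -IH ?(ltnW ip) // /right.
    by rewrite /e1; case: (v i) => ?; case: (v i.+1) => ?.
  have injv i j : (i <= size p)%N -> (j <= size p)%N -> v i = v j -> i = j.
    by move=> ip jp /eqP; rewrite nth_uniq //= => /eqP.
  have injw i j : (i <= size p)%N -> (j <= size p)%N -> odd i = odd j -> w i = w j -> i = j.
    move=> ip jp oij wij; apply: injv => //; move: oij wij; rewrite -!side // /right /w.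
    by case: (v i) => ?; case: (v j) => ? // _ ->.
  have vN : v (size p) = inr t0 by rewrite /v -[size p]/((size (x0 :: p)).-1) nth_last.
  have oddN : odd (size p) by rewrite -side // /right vN.
  (* One step past its end the sequence returns the default [x0], which closes the walk at [s0]. *)
  have wN1 : w (size p).+1 = s0 by rewrite /w /v nth_default.
  apply: acy; apply: (@nonbacktracking_cycle _ _ w (size p).+1) => //.
  + by move=> x [] /irr.
  + move=> i; rewrite ltnS leq_eqVlt => /orP[/eqP->|ip].
      by rewrite wN1 /w vN; right.
    have := step i ip; rewrite /w /e1.
    by case: (v i) => ?; case: (v i.+1) => ? // /asboolP[]; [left|right].
  + move=> i; rewrite ltnS leq_eqVlt => /orP[/eqP ip|ip]; last first.
      move=> /injw e; have := e (ltnW (ltnW ip)) ip; rewrite /= negbK.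
      by move=> /(_ erefl); lia.
    (* At the closing edge, [w i = s0] with [i] even forces [i = 0] on a simple path; the path would
       then be the removed edge itself. *)
    rewrite ip wN1 => wi.
    have i0 : i = 0.
      apply: injw => //; first by rewrite -ip.
      by move: oddN; rewrite -ip /=; case: odd.
    have p1 : size p = 1%N by lia.
    have := step 0; rewrite p1 => /(_ isT); rewrite p1 in vN; rewrite vN.
    by rewrite /e1 /v /= => /asboolP[_]; apply.
- move=> s t rst ne.
  have est : e0 s t by [].
  split=> h; apply: connect_trans h _; apply: connect1 => /=; exact/asboolP.
Qed.

Local Open Scope ring_scope.

(** * Complete separable metrics and refinements of Polish topologies *)

Section metrics.
Variable R : realType.

(* Separability phrased so that it passes to subspaces, sums and joins: the sets [B i]
   need not be open. *)
Definition csep (X : Type) (d : X -> X -> R) := exists B : nat -> set X,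
  forall x (e : R), 0 < e -> exists i, B i x /\ forall y, B i y -> d x y < e.

Definition polish_metric (X : Type) (d : X -> X -> R) :=
  [/\ is_metric d, metric_complete d & csep d].

Definition refines (X : Type) (d d' : X -> X -> R) :=
  forall x (e : R), 0 < e -> exists2 e', 0 < e' & forall y, d' x y < e' -> d x y < e.

Lemma csepI (I : countType) (X : Type) (d : X -> X -> R) (B : I -> set X) :
  (forall x (e : R), 0 < e -> exists i, B i x /\ forall y, B i y -> d x y < e) -> csep d.
Proof.
move=> h; exists (fun n => if unpickle n is Some i then B i else set0) => x e e0.
by have [i hi] := h x e e0; exists (pickle i); rewrite pickleK.
Qed.

Lemma refines_refl X (d : X -> X -> R) : refines d d.
Proof. by move=> x e e0; exists e. Qed.

Lemma refines_trans X (d d' d'' : X -> X -> R) :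
  refines d d' -> refines d' d'' -> refines d d''.
Proof.
move=> h h' x e e0; have [e1 e10 h1] := h x e e0; have [e2 e20 h2] := h' x e1 e10.
by exists e2 => // y /h2/h1.
Qed.

Lemma refines_open X (d d' : X -> X -> R) U :
  refines d d' -> metric_open d U -> metric_open d' U.
Proof.
move=> h oU x Ux; have [e e0 hU] := oU x Ux; have [e' e'0 he] := h x e e0.
by exists e' => // y /he yx; apply: hU.
Qed.

Lemma metric_open_ball X (d : X -> X -> R) x e : is_metric d ->
  metric_open d [set y | d x y < e].
Proof.
move=> [d0 _ dC dT] y /= xy; exists (e - d x y); first by rewrite subr_gt0.
by move=> z /= yz; have := dT x y z; lra.
Qed.

Definition einv (n : nat) : R := n.+1%:R^-1.

Lemma inv_small (e : R) : 0 < e -> exists n : nat, einv n < e.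
Proof.
move=> e0; have [n] := ltr_add_invr (x := e) (y := 0) e0.
by rewrite add0r => h; exists n.
Qed.

Lemma inv_gt0 (n : nat) : 0 < einv n :> R.
Proof. by rewrite /einv invr_gt0 ltr0n. Qed.

Lemma inv_le (m n : nat) : (m <= n)%N -> einv n <= einv m :> R.
Proof. by move=> mn; rewrite /einv lef_pV2 ?posrE ?ltr0n // ler_nat. Qed.

Lemma polish_has_metric (Z : topologicalType) : polish R Z ->
  exists2 d : Z -> Z -> R, polish_metric d & forall U : set Z, open U <-> metric_open d U.
Proof.
move=> [[D cD dD] [d [md cd oU]]]; exists d => //; split=> //.
have [f fi] := countable_injP _ cD.
pose B (i : nat * nat) : set Z :=
  [set y | exists2 x, D x & f x = i.1 /\ d x y < einv i.2].
apply: (@csepI _ _ _ B) => x e e0.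
have [d0 dE dC dT] := md.
have [n hn] := @inv_small (e / 2) ltac:(lra).
have [x' [bx' Dx']] : ([set y | d x y < einv n] `&` D) !=set0.
  apply: dD; last by apply/oU; apply: metric_open_ball.
  exists x => /=; rewrite (dE x x).2 //; exact: inv_gt0.
exists (f x', n); split; first by exists x' => //; rewrite dC.
move=> y [x'' Dx'' [/fi e'' xy]].
rewrite {}e'' ?inE //= in xy; have := dT x x' y; rewrite /= in bx'; lra.
Qed.

(** The digit [b n] names a set [B (b n)] of diameter at most [1/(n+1)]. Requiring only that
    finitely many of these sets meet keeps the set of codes closed; completeness then supplies the
    limit point. *)
Lemma polish_metric_ana (X : Type) (x0 : X) (d : X -> X -> R) : polish_metric d ->
  ana (metric_open d) setT.
Proof.
move=> [md cd [B hB]]; have [d0 dE dC dT] := md.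
pose sm (n i : nat) := forall x y, B i x -> B i y -> d x y < einv n.
pose F (b : baire) := forall n, (exists y, forall m, (m <= n)%N -> B (b m) y) /\ sm n (b n).
pose P b l := forall n y, B (b n) y -> d y l <= einv n.
have lim b : exists l, F b -> P b l.
  have [Fb|nF] := pselect (F b); last by exists x0.
  have /choice[y hy] := fun n => (Fb n).1.
  have [|l hl] := cd y.
    move=> e e0; have [N hN] := inv_small e0; exists N => m n Nm Nn.
    by apply: lt_trans hN; apply: (Fb N).2; apply: hy.
  exists l => _ n z Bz; apply/ler_addgt0Pr => e e0.
  have [N hN] := hl e e0.
  have h1 : d z (y (maxn n N)) < einv n by apply: (Fb n).2 => //; apply: hy; apply: leq_maxl.
  have := hN (maxn n N) (leq_maxr _ _); have := dT z (y (maxn n N)) l; lra.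
have /choice[g hg] := lim.
exists F, g; split.
- move=> b hb n; have [c Fc bc] := hb n.+1; have [[y hy] s] := Fc n; split.
    by exists y => m mn; rewrite bc //; apply: hy.
  by rewrite bc.
- move=> b Fb U oU Ub; have [e e0 hU] := oU _ Ub.
  have [n hn] := @inv_small (e / 2) ltac:(lra).
  exists n.+1 => c Fc bc; apply: hU => /=.
  have [[y hy] _] := Fc n.
  have h1 := hg c Fc n y (hy n (leqnn _)).
  have h2 : d y (g b) <= einv n by apply: hg => //; rewrite bc //; apply: hy.
  have := dT (g b) y (g c); rewrite (dC (g b) y); lra.
- apply/seteqP; split=> // x _.
  have /choice[b hb] : forall n, exists i, B i x /\ sm n i.
    move=> n; have e0 : 0 < einv n / 2 :> R by have := inv_gt0 n; lra.
    have [i [Bx hi]] := hB x _ e0; exists i; split=> // y z /hi xy /hi xz.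
    have := dT y x z; rewrite (dC y x); lra.
  have Fb : F b.
    move=> n; split; last by have [] := hb n.
    by exists x => m _; have [] := hb m.
  exists b => //; apply/esym/dE/eqP; rewrite eq_le d0 andbT.
  apply/ler_addgt0Pr => e e0; rewrite add0r; have [n hn] := inv_small e0.
  by apply: le_trans (ltW hn); apply: hg => //; have [] := hb n.
Qed.

Lemma cauchy_unique_limit X (d : X -> X -> R) x y : is_metric d ->
  (forall e : R, 0 < e -> exists z, d x z < e /\ d y z < e) -> x = y.
Proof.
move=> [d0 dE dC dT] h; apply/dE/eqP; rewrite eq_le d0 andbT.
apply/ler_addgt0Pr => e e0; rewrite add0r.
have [z [xz yz]] := h (e / 2) ltac:(lra).
by have := dT x z y; rewrite (dC z y); lra.
Qed.

Definition closed_graph (X M : Type) (d : X -> X -> R) (r : M -> M -> R) (h : X -> M) :=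
  forall x m, (forall e : R, 0 < e -> exists y, d x y < e /\ r (h y) m < e) -> h x = m.

(** This is the metric of the graph of [h], complete because the graph is closed; the projection to
    the second factor makes [h] continuous for it. *)
Lemma polish_metric_graph (X M : Type) (d : X -> X -> R) (r : M -> M -> R) (h : X -> M) :
  polish_metric d -> polish_metric r -> closed_graph d r h ->
  let d' := fun x y => d x y + r (h x) (h y) in
  [/\ polish_metric d', refines d d' & forall x (e : R), 0 < e ->
    exists2 e', 0 < e' & forall y, d' x y < e' -> r (h x) (h y) < e].
Proof.
move=> [[d0 dE dC dT] cd [B hB]] [[r0 rE rC rT] cr [B' hB']] cg d'.
have le_d x y : d x y <= d' x y by rewrite /d' lerDl.
have le_r x y : r (h x) (h y) <= d' x y by rewrite /d' lerDr.
split; [split| |]; last 2 first.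
- by move=> x e e0; exists e => // y; apply: le_lt_trans.
- by move=> x e e0; exists e => // y; apply: le_lt_trans.
- split.
  + by move=> x y; rewrite addr_ge0.
  + move=> x y; split=> [e|->].
      by apply/dE/eqP; rewrite eq_le d0 andbT -e le_d.
    by rewrite /d' (dE y y).2 // (rE _ _).2 // addr0.
  + by move=> x y; rewrite /d' dC rC.
  + by move=> x y z; have := dT x y z; have := rT (h x) (h y) (h z); rewrite /d'; lra.
- move=> u cu.
  have [|l hl] := cd u.
    move=> e e0; have [N hN] := cu e e0; exists N => m n Nm Nn.
    by apply: le_lt_trans (hN m n Nm Nn).
  have [|k hk] := cr (h \o u).
    move=> e e0; have [N hN] := cu e e0; exists N => m n Nm Nn.
    exact: le_lt_trans (le_r _ _) (hN m n Nm Nn).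
  have e : h l = k.
    apply: cg => e e0; have [N hN] := hl e e0; have [N' hN'] := hk e e0.
    exists (u (maxn N N')); rewrite dC; split; first by apply: hN; apply: leq_maxl.
    by apply: hN'; apply: leq_maxr.
  exists l => e' e0; have [N hN] := hl (e' / 2) ltac:(lra).
  have [N' hN'] := hk (e' / 2) ltac:(lra).
  exists (maxn N N') => n; rewrite geq_max => /andP[/hN h1 /hN' h2].
  by rewrite /d' e; move: h2 => /=; lra.
- apply: (@csepI (nat * nat)%type _ _ (fun i => B i.1 `&` h @^-1` B' i.2)) => x e e0.
  have [i [Bi hi]] := hB x (e / 2) ltac:(lra).
  have [j [Bj hj]] := hB' (h x) (e / 2) ltac:(lra).
  exists (i, j); split=> // y [/hi h1 /hj h2]; rewrite /d'; lra.
Qed.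

Lemma polish_metric_real : polish_metric (fun x y : R => `|x - y|).
Proof.
split.
- split=> [x y|x y|x y|x y z].
  + exact: normr_ge0.
  + split=> [/eqP|->]; last by rewrite subrr normr0.
    by rewrite normr_eq0 subr_eq0 => /eqP.
  + exact: distrC.
  + exact: ler_distD.
- move=> u cu.
  (* The limit is obtained as the lower limit of [u], the supremum of its eventual lower bounds. *)
  pose S := [set x | exists N, forall n, (N <= n)%N -> x <= u n].
  have key e : 0 < e -> exists N, (forall n, (N <= n)%N -> `|u n - u N| < e) /\
      (S (u N - e) /\ ubound S (u N + e)).
    move=> /cu[N hN]; exists N; split; first by move=> n Nn; apply: hN.
    split=> [|x [M hM]].
      exists N => n Nn; have := hN n N Nn (leqnn _); rewrite ltr_norml => /andP[+ _]; lra.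
    have := hM (maxn M N) (leq_maxl _ _); have := hN (maxn M N) N (leq_maxr _ _) (leqnn _).
    by rewrite ltr_norml => /andP[_]; lra.
  have hs : has_sup S.
    by have [N [_ [h1 h2]]] := key 1 ltr01; split; [exists (u N - 1)|exists (u N + 1)].
  exists (sup S) => e e0; have [N [h0 [h1 h2]]] := key (e / 3) ltac:(lra).
  exists N => n /h0; rewrite ltr_norml => /andP[a1 a2].
  have b1 := ub_le_sup hs.2 h1; have b2 := ge_sup hs.1 h2.
  by rewrite ltr_norml; apply/andP; split; lra.
- apply: (@csepI (rat * rat)%type _ _ (fun q => [set x | ratr q.1 < x < ratr q.2])).
  move=> x e e0.
  have [q] := @rat_in_itvoo R (x - e / 2) x ltac:(lra).
  have [q'] := @rat_in_itvoo R x (x + e / 2) ltac:(lra).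
  rewrite !in_itv /= => /andP[a1 a2] /andP[a3 a4].
  exists (q, q'); split; first by rewrite /= a4 a1.
  by move=> y /= /andP[b1 b2]; rewrite ltr_norml; apply/andP; split; lra.
Qed.

(** The function [h] is the inverse of the truncated distance to the complement on [U], and -1
    elsewhere. It blows up at the boundary, so its graph is closed, and its sign separates [U] from
    its complement once it is made continuous. *)
Lemma open_clopen_refinement (X : Type) (d : X -> X -> R) U : polish_metric d ->
  metric_open d U -> exists d', [/\ polish_metric d', refines d d',
    metric_open d' U & metric_open d' (~` U)].
Proof.
move=> pd oU; have [[d0 dE dC dT] cd _] := pd.
pose D x := [set e : R | 0 <= e <= 1 /\ forall y, d x y < e -> U y].
pose r x := sup (D x).
have D0 x : D x 0 by split; [rewrite lexx ler01|move=> y; rewrite ltNge d0].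
have hsD x : has_sup (D x).
  by split; [exists 0|exists 1 => e [/andP[]]].
have r_ge x e : D x e -> e <= r x by move=> De; apply: ub_le_sup => //; have [] := hsD x.
have r_le x c : (forall e, D x e -> e <= c) -> r x <= c.
  by move=> h; apply: ge_sup => //; have [] := hsD x.
have r0 x : 0 <= r x by apply: r_ge.
have rU x : U x -> 0 < r x.
  move=> Ux; have [e e0 he] := oU x Ux.
  apply: lt_le_trans (r_ge x (Num.min e 1) _); first by rewrite lt_min e0 ltr01.
  split; first by rewrite le_min (ltW e0) ler01 ge_min lexx orbT.
  by move=> y xy; apply: he; apply: lt_le_trans xy _; rewrite ge_min lexx.
have rNU x : ~ U x -> r x = 0.
  move=> nU; apply/eqP; rewrite eq_le r0 andbT; apply: r_le => e [_ h].
  by rewrite leNgt; apply/negP => e0; apply: nU; apply: h; rewrite (dE x x).2.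
have r_lip x y : r x <= r y + d x y.
  apply: r_le => e [/andP[e0 e1] h]; have [de|de] := leP e (d x y).
    by have := r0 y; lra.
  rewrite -lerBlDr; apply: r_ge; split; first by have dxy := d0 x y; apply/andP; split; lra.
  by move=> z yz; apply: h; have := dT x y z; lra.
pose h x := if `[< U x >] then (r x)^-1 else -1.
have hU x : U x -> h x = (r x)^-1 by move=> Ux; rewrite /h asboolT.
have hNU x : ~ U x -> h x = -1 by move=> Ux; rewrite /h asboolF.
have h0 x : U x -> 0 < h x by move=> Ux; rewrite hU // invr_gt0 rU.
have cg : closed_graph d (fun x y : R => `|x - y|) h.
  move=> x m hx; have [Ux|nU] := pselect (U x); last first.
    rewrite (hNU x nU); apply/eqP; rewrite -subr_eq0 -normr_le0.
    apply/ler_addgt0Pr => e e0; rewrite add0r.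
    (* Within [c] of a point outside [U], the values of [h] on [U] are at least [|m| + 2], whereas
       they should lie within [c <= 1] of [m]. *)
    pose c := (`|m| + 2)^-1; have c0 : 0 < c by rewrite invr_gt0; have := normr_ge0 m; lra.
    have [y [xy hy]] := hx (Num.min e c) ltac:(by rewrite lt_min e0).
    rewrite lt_min in xy; rewrite lt_min in hy; case/andP: xy => xe xc; case/andP: hy => ye yc.
    have [Uy|nUy] := pselect (U y); last by rewrite hNU // in ye; apply: ltW.
    exfalso; have ry := rU y Uy; have := r_lip y x; rewrite (rNU x nU) add0r dC => ryx.
    have hyc : c^-1 <= h y by rewrite hU // lef_pV2 ?posrE //; lra.
    have c1 : c <= 1 by rewrite invf_le1; have := normr_ge0 m; lra.
    move: yc hyc; rewrite /c invrK ltr_norml => /andP[_]; rewrite -/c.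
    by have := ler_norm m; lra.
  have rx := rU x Ux; rewrite (hU x Ux).
  apply/eqP; rewrite -subr_eq0 -normr_le0; apply/ler_addgt0Pr => e e0; rewrite add0r.
  (* The second term keeps [r y] above [r x / 2]; the third then bounds the difference of the
     inverses of [r x] and [r y] by [e / 2]. *)
  pose c := Num.min (e / 2) (Num.min (r x / 2) (e * (r x / 2) * r x / 2)).
  have p0 : 0 < e * (r x / 2) * r x / 2 by rewrite !divr_gt0 ?mulr_gt0 ?divr_gt0.
  have c0 : 0 < c by rewrite !lt_min p0 !andbT; apply/andP; split; lra.
  have [y [xy hy]] := hx c c0.
  rewrite !lt_min in xy; rewrite !lt_min in hy.
  case/and3P: xy => x1 x2 x3; case/and3P: hy => y1 y2 y3.
  have ry1 := r_lip x y; have ry2 := r_lip y x; rewrite (dC y x) in ry2.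
  have ry : r x / 2 <= r y by lra.
  have Uy : U y by apply: contrapT => /rNU; lra.
  rewrite hU // in y1.
  have yx : `|(r x)^-1 - (r y)^-1| <= e / 2.
    have ry0 : 0 < r y by lra.
    have -> : (r x)^-1 - (r y)^-1 = (r y - r x) / (r x * r y).
      by field; apply/andP; split; lra.
    rewrite normrM normfV (gtr0_norm (mulr_gt0 rx ry0)) ler_pdivrMr ?mulr_gt0 //.
    apply: (@le_trans _ _ (d x y)); first by rewrite ler_norml; apply/andP; split; lra.
    apply: le_trans (ltW x3) _.
    have -> : e * (r x / 2) * r x / 2 = e / 2 * (r x * (r x / 2)) by lra.
    by rewrite ler_pM2l ?ler_pM2l //; lra.
  have := ler_distD (r y)^-1 (r x)^-1 m; lra.
have [pd' rd' rh] := polish_metric_graph pd polish_metric_real cg.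
set d' := (fun x y : X => _) in pd' rd' rh.
exists d'; split=> //; first exact: refines_open oU.
move=> x nU; have [e' e0 he] := rh x 1 ltr01; exists e' => // y /= /he.
rewrite (hNU x nU) ltr_norml => /andP[b _] Uy; have := h0 y Uy; lra.
Qed.

(** The join is the supremum of the distances [d n] truncated at [1/(n+1)], so that smallness
    depends on finitely many of them. Since all refine [d0], the limits of a sequence for the
    various [d n] coincide, and completeness follows. *)
Lemma metric_join (X : Type) (d0 : X -> X -> R) (d : nat -> X -> X -> R) :
  is_metric d0 -> (forall n, polish_metric (d n)) -> (forall n, refines d0 (d n)) ->
  exists d', polish_metric d' /\ forall n, refines (d n) d'.
Proof.
move=> md0 pd rd.
pose m n x y : R := Num.min (d n x y) (einv n).
pose D x y := range (fun n => m n x y).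
pose s x y := sup (D x y).
have d_ge0 n x y : 0 <= d n x y by have [[]] := pd n.
have d_eq n x y : d n x y = 0 <-> x = y by have [[]] := pd n.
have dC n x y : d n x y = d n y x by have [[]] := pd n.
have dT n x y z : d n x z <= d n x y + d n y z by have [[]] := pd n.
have hsD x y : has_sup (D x y).
  split; first by exists (m 0 x y), 0.
  exists 1 => _ [n _ <-]; rewrite ge_min; apply/orP; right.
  by rewrite /einv invf_le1 ?ltr0n // ler1n.
have ms n x y : m n x y <= s x y.
  by apply: ub_le_sup; [have [] := hsD x y|exists n].
have sm x y c : (forall n, m n x y <= c) -> s x y <= c.
  by move=> h; apply: ge_sup; [have [] := hsD x y|move=> _ [n _ <-]].
have m0 n x y : 0 <= m n x y by rewrite le_min d_ge0 ltW // inv_gt0.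
have s0 x y : 0 <= s x y by apply: le_trans (ms 0 x y).
have dsmall n x y e : e <= einv n -> s x y < e -> d n x y < e.
  move=> en se; have := le_lt_trans (ms n x y) se; rewrite gt_min => /orP[//|].
  by rewrite ltNge en.
have ssmall x y e N : einv N <= e -> (forall n, (n <= N)%N -> d n x y <= e) -> s x y <= e.
  move=> Ne h; apply: sm => n; rewrite ge_min; have [nN|Nn] := leqP n N.
    by rewrite h.
  by apply/orP; right; apply: le_trans Ne; apply: inv_le; apply: ltnW.
have rds n : refines (d n) s.
  move=> x e e0; exists (Num.min e (einv n)); first by rewrite lt_min e0 inv_gt0.
  move=> y h; apply: lt_le_trans (dsmall n x y _ _ h) _; first by rewrite ge_min lexx orbT.
  by rewrite ge_min lexx.
exists s; split=> //; split.
- split=> // [x y|x y|x y z].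
  + split=> [e|->]; last first.
      apply/eqP; rewrite eq_le s0 andbT; apply: sm => n.
      by rewrite ge_min (d_eq n y y).2 // lexx.
    apply/(d_eq 0); apply/eqP; rewrite eq_le d_ge0 andbT.
    have := ms 0 x y; rewrite e ge_min => /orP[//|].
    by rewrite leNgt inv_gt0.
  + by congr sup; apply/seteqP; split=> _ [n _ <-]; exists n => //; rewrite /m dC.
  + apply: sm => n; have := ms n x y; have := ms n y z; have := m0 n x y; have := m0 n y z.
    rewrite /m; have := dT n x y z; have := inv_gt0 n; 
    by rewrite /Num.min; case: ifP; case: ifP; case: ifP; lra.
- move=> u cu.
  have cun n e : 0 < e -> exists N, forall a b, (N <= a)%N -> (N <= b)%N -> d n (u a) (u b) < e.
    move=> e0; have [N hN] := cu (Num.min e (einv n)) ltac:(by rewrite lt_min e0 inv_gt0).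
    exists N => a b Na Nb; apply: lt_le_trans (dsmall n _ _ _ _ (hN a b Na Nb)) _.
      by rewrite ge_min lexx orbT.
    by rewrite ge_min lexx.
  have /choice[l hl] : forall n, exists l, forall e, 0 < e ->
      exists N, forall a, (N <= a)%N -> d n (u a) l < e.
    by move=> n; have [_ c _] := pd n; apply: c; apply: cun.
  have ll n : l n = l 0.
    apply: (cauchy_unique_limit md0) => e e0.
    have [e1 e10 h1] := rd n (l n) e e0; have [e2 e20 h2] := rd 0 (l 0) e e0.
    have [N1 hN1] := hl n e1 e10; have [N2 hN2] := hl 0 e2 e20.
    exists (u (maxn N1 N2)); split; [apply: h1|apply: h2]; rewrite dC.
      by apply: hN1; apply: leq_maxl.
    by apply: hN2; apply: leq_maxr.
  exists (l 0) => e e0; have [K hK] := @inv_small (e / 2) ltac:(lra).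
  suff [N hN] : exists N, forall a n, (N <= a)%N -> (n <= K)%N -> d n (u a) (l 0) < e / 2.
    exists N => a Na; apply: (@le_lt_trans _ _ (e / 2)); last by lra.
    by apply: (@ssmall _ _ _ K); [exact: ltW|move=> n nK; apply: ltW; apply: hN].
  elim: K {hK} => [|K [N hN]].
    have [N hN] := hl 0 (e / 2) ltac:(lra); exists N => a n Na.
    by rewrite leqn0 => /eqP->; apply: hN.
  have [N' hN'] := hl K.+1 (e / 2) ltac:(lra); rewrite ll in hN'.
  exists (maxn N N') => a n; rewrite geq_max => /andP[Na N'a].
  rewrite leq_eqVlt => /orP[/eqP->|nK]; first exact: hN'.
  exact: hN.
- have /choice[B hB] : forall n, exists B : nat -> set X,
    forall x (e : R), 0 < e -> exists i, B i x /\ forall y, B i y -> d n x y < e.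
    by move=> n; have [] := pd n.
  apply: (@csepI (seq nat) _ _ (fun l => [set x | forall n, (n < size l)%N -> B n (nth 0 l n) x])).
  move=> x e e0; have [K hK] := @inv_small (e / 2) ltac:(lra).
  have /choice[i hi] : forall n, exists i, B n i x /\ forall y, B n i y -> d n x y < e / 2.
    by move=> n; apply: hB; lra.
  exists (mkseq i K.+1); split.
    move=> n; rewrite size_mkseq => nK; rewrite nth_mkseq //; by have [] := hi n.
  move=> y hy; apply: (@le_lt_trans _ _ (e / 2)); last by lra.
  apply: (@ssmall _ _ _ K); first exact: ltW.
  move=> n nK; apply: ltW; apply: (hi n).2.
  by have := hy n; rewrite size_mkseq nth_mkseq ?ltnS //; apply.
Qed.

Lemma borel_clopen_refinement (X : Type) (d : X -> X -> R) S : polish_metric d ->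
  <<s metric_open d >> S -> exists d', [/\ polish_metric d', refines d d',
    metric_open d' S & metric_open d' (~` S)].
Proof.
move=> pd sS; pose P S := exists d', [/\ polish_metric d', refines d d',
    metric_open d' S & metric_open d' (~` S)].
apply: (sS P); split; last by move=> U oU; apply: open_clopen_refinement.
split=> [|A [d' [p r o1 o2]]|A].
- exists d; split=> //; first exact: refines_refl.
  by move=> x _; exists 1; [exact: ltr01|move=> y _ []].
- by exists d'; rewrite setTD setCK.
- move=> /choice[d' hd'].
  have md : is_metric d by have [] := pd.
  have [|||d1 [p1 r1]] := @metric_join X d d' => //.
  + by move=> n; have [] := hd' n.
  + by move=> n; have [] := hd' n.
  have oA : metric_open d1 (\bigcup_n A n).
    move=> x [n _ Ax]; have [_ _ oA _] := hd' n.
    have [e e0 he] := refines_open (r1 n) oA Ax.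
    by exists e => // y /he Ay; exists n.
  have [d2 [p2 r2 o2 o2']] := open_clopen_refinement p1 oA.
  exists d2; split=> //; apply: refines_trans r2.
  by apply: refines_trans (r1 0); have [] := hd' 0.
Qed.

Lemma borel_seq_refinement (X : Type) (d : X -> X -> R) (S : nat -> set X) :
  polish_metric d -> (forall n, <<s metric_open d >> (S n)) ->
  exists d', [/\ polish_metric d', refines d d' & forall n, metric_open d' (S n)].
Proof.
move=> pd sS.
have /choice[d' hd'] := fun n => borel_clopen_refinement pd (sS n).
have md : is_metric d by have [] := pd.
have [|||d1 [p1 r1]] := @metric_join X d d' => //.
- by move=> n; have [] := hd' n.
- by move=> n; have [] := hd' n.
exists d1; split=> //; first by apply: refines_trans (r1 0); have [] := hd' 0.
by move=> n; apply: refines_open (r1 n) _; have [] := hd' n.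
Qed.

End metrics.

Local Close Scope ring_scope.

Local Open Scope ring_scope.

(** * From metrics to topologies *)

Section metric_topology.
Variables (R : realType) (X : choiceType) (d : X -> X -> R).

(** An alias of [X] whose type mentions the metric, so that the topological structure can attach to
    it and not to [X]. *)
Definition metric_space of is_metric d : Type := X.

Hypothesis md : is_metric d.

HB.instance Definition _ := Choice.on (metric_space md).

Lemma metric_openT : metric_open d setT.
Proof. by move=> x _; exists 1. Qed.

Lemma metric_openI : setI_closed (metric_open d).
Proof.
move=> U V oU oV x [Ux Vx]; have [e e0 he] := oU x Ux; have [f f0 hf] := oV x Vx.
exists (Num.min e f); first by rewrite lt_min e0.
by move=> y /=; rewrite lt_min => /andP[ye yf]; split; [apply: he|apply: hf].
Qed.

Lemma metric_open_bigU (I : Type) (f : I -> set X) :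
  (forall i, metric_open d (f i)) -> metric_open d (\bigcup_i f i).
Proof.
move=> h x [i _ fx]; have [e e0 he] := h i x fx.
by exists e => // y /he fy; exists i.
Qed.

HB.instance Definition _ := isOpenTopological.Build (metric_space md)
  metric_openT metric_openI metric_open_bigU.

Definition metric_topological : Topological X :=
  Topological.class (metric_space md : topologicalType).

Lemma metric_topologicalE U :
  @open (Topological.Pack metric_topological) U <-> metric_open d U.
Proof. by []. Qed.

End metric_topology.

Lemma metric_polish (R : realType) (X : choiceType) (d : X -> X -> R)
    (md : is_metric d) : polish_metric d ->
  polish R (Topological.Pack (metric_topological md)).
Proof.
move=> [_ cd [B hB]]; split; last by exists d; split.
have [x0|nX] := pselect (exists x : X, True); last first.
  exists set0 => //; move=> U [x Ux]; exfalso; apply: nX; by exists x.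
have [x1 _] := x0.
have /choice[f hf] : forall i, exists x, (exists y, B i y) -> B i x.
  by move=> i; have [[y By]|n] := pselect (exists y, B i y); [exists y|exists x1].
exists (range f); first exact: card_image_le.
move=> U [x Ux] /metric_topologicalE/(_ x Ux)[e e0 he].
have [i [Bx hi]] := hB x e e0; exists (f i); split; last by exists i.
by apply: he => /=; apply: hi; apply: hf; exists x.
Qed.

Lemma prod_openP (X Y : topologicalType) (W : set (X * Y)) :
  open W <-> forall x y, W (x, y) -> exists U V, [/\ open U, open V, U x, V y & U `*` V `<=` W].
Proof.
split=> [oW x y Wxy|h].
  move: oW; rewrite openE => /(_ _ Wxy)[[P Q] [/= Px Qy] PQ].
  exists P^°, Q^°; split; [exact: open_interior|exact: open_interior|exact: Px|exact: Qy|].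
  move=> [a b] [/= /interior_subset Pa /interior_subset Qb]; exact: PQ.
rewrite openE => -[x y] /h[U [V [oU oV Ux Vy UV]]].
by exists (U, V) => //=; split; apply: open_nbhs_nbhs.
Qed.

Lemma prod_metric_openP (R : realType) (X Y : choiceType) (d : X -> X -> R)
    (d' : Y -> Y -> R) (md : is_metric d) (md' : is_metric d') (W : set (X * Y)) :
  @open (Topological.Pack (metric_topological md) *
         Topological.Pack (metric_topological md'))%type W <->
  forall x y, W (x, y) -> exists2 e, 0 < e & forall a b, d x a < e -> d' y b < e -> W (a, b).
Proof.
rewrite prod_openP; split=> h x y Wxy.
  have [U [V [oU oV Ux Vy UV]]] := h x y Wxy.
  have [e e0 he] := (oU : metric_open d U) x Ux.
  have [f f0 hf] := (oV : metric_open d' V) y Vy.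
  exists (Num.min e f); first by rewrite lt_min e0.
  move=> a b; rewrite !lt_min => /andP[xa _] /andP[_ yb]; apply: UV.
  by split; [apply: he|apply: hf].
have [e e0 he] := h x y Wxy.
exists [set a | d x a < e], [set b | d' y b < e]; split.
- exact: metric_open_ball.
- exact: metric_open_ball.
- by have [_ E _ _] := md; rewrite /= (E x x).2.
- by have [_ E _ _] := md'; rewrite /= (E y y).2.
- by move=> [a b] [/= xa yb]; apply: he.
Qed.

(** * The hierarchy over an abstract family of basic sets *)

Section hierarchy.
Variable xi : countable_ordinal.
Notation ordl := (option (ord_carrier xi)).

(** The base is a parameter because two instances are used: open sets, and countable unions of Borel
    rectangles. With the latter, potential classes are handled without fixing any topology. *)
Inductive sigma_over (Z : Type) (op : set (set Z)) : ordl -> set Z -> Prop :=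
| sig_open o U : ord_below o = set0 -> op U -> sigma_over op o U
| sig_bigcupC o (w : nat -> ord_carrier xi) (F : nat -> set Z) :
    (forall n, ord_below o (w n)) -> (forall n, sigma_over op (Some (w n)) (~` F n)) ->
    sigma_over op o (\bigcup_n F n).

Lemma Sigma0_sig (Z : topologicalType) o (S : set Z) :
  Sigma0_rec o S <-> sigma_over (@open Z) o S.
Proof.
split; elim=> {o S} [v U b oU|v w F b _ IH].
- exact: sig_open.
- exact: sig_bigcupC IH.
- exact: Sigma0_open.
- exact: Sigma0_bigcup IH.
Qed.

Lemma sig_sub Z (op op' : set (set Z)) o S : op `<=` op' -> sigma_over op o S -> sigma_over op' o S.
Proof.
move=> sub; elim=> {o S} [v U b oU|v w F b _ IH]; last exact: sig_bigcupC IH.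
by apply: sig_open => //; apply: sub.
Qed.

Lemma sig_preimage Z Z' (op : set (set Z)) (op' : set (set Z')) (f : Z -> Z') o S :
  opcont op op' f -> sigma_over op' o S -> sigma_over op o (f @^-1` S).
Proof.
move=> cf; elim=> {o S} [v U b oU|v w F b _ IH].
  by apply: sig_open => //; apply: cf.
by rewrite preimage_bigcup; apply: sig_bigcupC b _.
Qed.

Lemma sig_sigma Z (op G : set (set Z)) o S : op `<=` <<s G >> -> sigma_over op o S -> <<s G >> S.
Proof.
move=> sub; elim=> {o S} [v U b oU|v w F b _ IH]; first exact: sub.
by apply: (@sigmaU) => n; rewrite -[F n]setCK; apply: (@sigmaC).
Qed.

Definition olt (o1 o2 : ordl) := if o1 is Some w then ord_below o2 w else False.

Let le := @ord_le xi.
Let wle : well_order le := @ord_wo xi.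

Lemma ord_least (P : set (ord_carrier xi)) : P !=set0 ->
  exists z, P z /\ forall x, P x -> le z x.
Proof.
move=> [x Px]; have [|z [[zP h] _]] := wle (A := [pred x | `[< P x >]]).
  by exists x; rewrite unfold_in; apply/asboolP.
exists z; split; first by move: zP; rewrite unfold_in => /asboolP.
by move=> y Py; apply: h; rewrite unfold_in; apply/asboolP.
Qed.

Lemma ord_total x y : le x y \/ le y x.
Proof.
have [|z [[->|->] h]] := @ord_least [set x; y]; first by exists x; left.
  by left; apply: h; right.
by right; apply: h; left.
Qed.

Lemma ord_refl x : le x x.
Proof. by case: (ord_total x x). Qed.

(** Antisymmetry is contained in the uniqueness of minima required by [well_order]. *)
Lemma ord_anti x y : le x y -> le y x -> x = y.
Proof.
move=> xy yx; have [|z [_ u]] := wle (A := [pred t | `[< t = x \/ t = y >]]).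
  by exists x; rewrite unfold_in; apply/asboolP; left.
have hx : z = x.
  apply: u; split=> [|t]; rewrite unfold_in; first by apply/asboolP; left.
  by move=> /asboolP[->|->] //; apply: ord_refl.
rewrite -hx; apply: u; split=> [|t]; rewrite unfold_in; first by apply/asboolP; right.
by move=> /asboolP[->|->] //; apply: ord_refl.
Qed.

Lemma ord_trans x y z : le x y -> le y z -> le x z.
Proof.
move=> xy yz; have [|t [tP h]] := @ord_least [set t | [\/ t = x, t = y | t = z]].
  by exists x; constructor 1.
case: tP => ?; subst t; first by apply: h; constructor 3.
  by rewrite (ord_anti xy) //; apply: h; constructor 1.
by rewrite -(ord_anti yz) //; apply: h; constructor 2.
Qed.

Lemma olt_trans o1 o2 o3 : olt o1 o2 -> olt o2 o3 -> olt o1 o3.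
Proof.
case: o1 => // x; case: o2 => [y|]; case: o3 => [z|] //=.
move=> [xy nxy] [yz nyz]; split; first exact: ord_trans yz.
by move=> e; subst z; apply: nyz; apply: ord_anti.
Qed.

Lemma olt_total o1 o2 : [\/ olt o1 o2, o1 = o2 | olt o2 o1].
Proof.
case: o1 => [x|]; case: o2 => [y|]; [|by constructor 1|by constructor 3|by constructor 2].
have [->|ne] := pselect (x = y); first by constructor 2.
have [xy|yx] := ord_total x y; first by constructor 1.
by constructor 3; split=> // e; apply: ne.
Qed.

Lemma olt_wf : well_founded olt.
Proof.
have accS w : Acc olt (Some w).
  apply: contrapT => nacc.
  have [|z [nz h]] := @ord_least [set w | ~ Acc olt (Some w)]; first by exists w.
  apply: nz; constructor=> -[x|//] [xz nxz]; apply: contrapT => nx.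
  by apply: nxz; apply: ord_anti (h x nx).
by case=> [w|]; [exact: accS|constructor=> -[x|//] _; exact: accS].
Qed.

Section operations.
Variables (Z : Type) (op : set (set Z)).
Hypothesis op_bigcup : forall U : nat -> set Z, (forall n, op (U n)) -> op (\bigcup_n U n).
Hypothesis op_setI : forall U V, op U -> op V -> op (U `&` V).
Hypothesis op_Fsigma : forall U, op U ->
  exists2 V : nat -> set Z, (forall n, op (V n)) & U = \bigcup_n ~` V n.

Lemma sig_cases o S : sigma_over op o S ->
  (ord_below o = set0 /\ op S) \/ exists (w : nat -> ord_carrier xi) (F : nat -> set Z),
    [/\ forall n, ord_below o (w n),
    forall n, sigma_over op (Some (w n)) (~` F n) & S = \bigcup_n F n].
Proof. by case=> [v U b oU|v w F b h]; [left|right; exists w, F]. Qed.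

Lemma sig_compl v o S : olt v o -> sigma_over op v S -> sigma_over op o (~` S).
Proof.
case: v => // w wo sS; have -> : ~` S = \bigcup_(n : nat) ~` S.
  by apply/seteqP; split=> [z|z []//]; exists 0%N.
by apply: (@sig_bigcupC _ _ _ (fun=> w)) => // n; rewrite setCK.
Qed.

(** The least element below [o] has nothing below itself, so the members of [op] have its class, and
    [op_Fsigma] climbs from there to [o]. *)
Lemma sig_op o U : op U -> sigma_over op o U.
Proof.
move=> oU; have [b0|/eqP/set0P ne] := pselect (ord_below o = set0).
  exact: sig_open.
have [w [wo h]] := ord_least ne.
have [V oV ->] := op_Fsigma oU.
apply: (@sig_bigcupC _ _ _ (fun=> w)) => // n; rewrite setCK; apply: sig_open => //.
rewrite -subset0 => x xw; apply: xw.2; apply: ord_anti xw.1 _; apply: h.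
exact: (@olt_trans (Some x) (Some w) o).
Qed.

Lemma sig_le v o S : olt v o -> sigma_over op v S -> sigma_over op o S.
Proof.
move=> vo /sig_cases[[_ oS]|[w [F [b h ->]]]]; first exact: sig_op.
apply: sig_bigcupC h => n; exact: (@olt_trans (Some (w n)) v o (b n) vo).
Qed.

Lemma sig_bigcup o (S : nat -> set Z) : (forall n, sigma_over op o (S n)) ->
  sigma_over op o (\bigcup_n S n).
Proof.
move=> h; have [b0|nb] := pselect (ord_below o = set0).
  apply: sig_open => //; apply: op_bigcup => n.
  by have [[]|[w [F [+ _ _]]]] := sig_cases (h n) => // /(_ 0%N); rewrite b0.
have h' n : exists wF : (nat -> ord_carrier xi) * (nat -> set Z), [/\
    forall k, ord_below o (wF.1 k), forall k, sigma_over op (Some (wF.1 k)) (~` wF.2 k)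
    & S n = \bigcup_k wF.2 k].
  by have [[]|[w [F hF]]] := sig_cases (h n) => //; exists (w, F).
have [wF hwF] := choice h'.
pose dec m : nat * nat := odflt (0, 0)%N (unpickle m).
have -> : \bigcup_n S n = \bigcup_m (wF (dec m).1).2 (dec m).2.
  apply/seteqP; split=> [z [n _]|z [m _ zm]].
    have [_ _ ->] := hwF n => -[k _ zk]; exists (pickle (n, k)) => //.
    by rewrite /dec pickleK.
  by exists (dec m).1 => //; have [_ _ ->] := hwF (dec m).1; exists (dec m).2.
apply: (@sig_bigcupC _ _ _ (fun m => (wF (dec m).1).1 (dec m).2)) => m.
  by have [] := hwF (dec m).1.
by have [_ + _] := hwF (dec m).1; apply.
Qed.

Lemma sig_setU o S S' : sigma_over op o S -> sigma_over op o S' -> sigma_over op o (S `|` S').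
Proof.
move=> h h'; have -> : S `|` S' = \bigcup_n (if n is 0 then S else S').
  apply/seteqP; split=> [z [Sz|Sz]|z [[|n] _ Sz]]; [by exists 0%N|by exists 1%N|by left|by right].
by apply: sig_bigcup => -[].
Qed.

(** The pieces of the two unions come from possibly different lower levels; for each pair, both
    complements are lifted to the larger level. *)
Lemma sig_setI o S S' : sigma_over op o S -> sigma_over op o S' -> sigma_over op o (S `&` S').
Proof.
move=> h h'.
have [[b oS]|[w [F [b hF eS]]]] := sig_cases h.
  have [[_ oS']|[w [F [b' _ _]]]] := sig_cases h'; last by have := b' 0%N; rewrite b.
  by apply: sig_open => //; apply: op_setI.
have [[b' _]|[w' [F' [b' hF' eS']]]] := sig_cases h'; first by have := b 0%N; rewrite b'.
have -> : S `&` S' = \bigcup_n \bigcup_k (F n `&` F' k).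
  rewrite eS eS'; apply/seteqP; split=> [z [[n _ zn] [k _ zk]]|z [n _ [k _ [zn zk]]]].
    by exists n => //; exists k.
  by split; [exists n|exists k].
apply: sig_bigcup => n; apply: sig_bigcup => k; rewrite -[_ `&` _]setCK setCI.
have [nk|[e]|kn] := olt_total (Some (w n)) (Some (w' k)).
- apply: (@sig_compl (Some (w' k)) o _ (b' k)); apply: sig_setU => //.
  exact: sig_le nk (hF n).
- by apply: (@sig_compl (Some (w n)) o _ (b n)); apply: sig_setU => //; rewrite e.
- apply: (@sig_compl (Some (w n)) o _ (b n)); apply: sig_setU => //.
  exact: sig_le kn (hF' k).
Qed.

End operations.
End hierarchy.

(** * Countable unions of Borel rectangles *)

Section rectangles.
Variables (X Y : Type) (opX : set (set X)) (opY : set (set Y)).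

Definition op2 : set (set (X * Y)) := [set W |
  (exists2 U, opX U & W = fst @^-1` U) \/ (exists2 V, opY V & W = snd @^-1` V)].

(** The potentially open sets, described without reference to finer topologies. *)
Definition rect : set (set (X * Y)) := [set W | exists E F,
  [/\ forall n : nat, <<s opX >> (E n), forall n : nat, <<s opY >> (F n)
    & W = \bigcup_n (E n `*` F n)]].

Lemma hausdorff_base_op2 : hausdorff_base opX -> hausdorff_base opY -> hausdorff_base op2.
Proof.
move=> sX sY [x y] [x' y'] ne; have [ex|nx] := pselect (x = x').
  have /sY[U [V [oU oV Uy Vy UV]]] : y <> y' by move=> ey; apply: ne; rewrite ex ey.
  exists (snd @^-1` U), (snd @^-1` V); split=> //; [by right; exists U|by right; exists V|].
  by rewrite -preimage_setI UV preimage_set0.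
have [U [V [oU oV Uy Vy UV]]] := sX _ _ nx.
exists (fst @^-1` U), (fst @^-1` V); split=> //; [by left; exists U|by left; exists V|].
by rewrite -preimage_setI UV preimage_set0.
Qed.

Lemma rect1 E F : <<s opX >> E -> <<s opY >> F -> rect (E `*` F).
Proof.
move=> hE hF; exists (fun=> E), (fun=> F); split=> //.
by apply/seteqP; split=> [z zEF|z []//]; exists 0%N.
Qed.

Lemma rect_bigcup (U : nat -> set (X * Y)) : (forall n, rect (U n)) -> rect (\bigcup_n U n).
Proof.
move=> /choice[E /choice[F h]].
pose dec m : nat * nat := odflt (0, 0)%N (unpickle m).
exists (fun m => E (dec m).1 (dec m).2), (fun m => F (dec m).1 (dec m).2); split.
- by move=> m; have [] := h (dec m).1.
- by move=> m; have [] := h (dec m).1.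
- apply/seteqP; split=> [z [n _]|z [m _ zm]].
    have [_ _ ->] := h n => -[k _ zk]; exists (pickle (n, k)) => //.
    by rewrite /dec pickleK.
  by exists (dec m).1 => //; have [_ _ ->] := h (dec m).1; exists (dec m).2.
Qed.

Lemma sigma_setI Z (op : set (set Z)) A B : <<s op >> A -> <<s op >> B -> <<s op >> (A `&` B).
Proof.
move=> a b; have -> : A `&` B = ~` \bigcup_n (if n is 0%N then ~` A else ~` B).
  rewrite setC_bigcup; apply/seteqP; split=> [z [Az Bz] [|n] _|z h]; rewrite ?setCK //.
  by have := h 0%N I; have := h 1%N I; rewrite !setCK.
by apply: (@sigmaC); apply: (@sigmaU) => -[|n]; apply: (@sigmaC).
Qed.

Lemma rect_setI U V : rect U -> rect V -> rect (U `&` V).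
Proof.
move=> [E [F [hE hF ->]]] [E' [F' [hE' hF' ->]]].
have -> : (\bigcup_n (E n `*` F n)) `&` (\bigcup_n (E' n `*` F' n)) =
    \bigcup_n \bigcup_k ((E n `&` E' k) `*` (F n `&` F' k)).
  apply/seteqP; split=> [z [[n _ [a b]] [k _ [a' b']]]|z [n _ [k _ [[a a'] [b b']]]]].
    by exists n => //; exists k.
  by split; [exists n|exists k].
apply: rect_bigcup => n; apply: rect_bigcup => k; apply: rect1;
  by apply: (@sigma_setI).
Qed.

Lemma rect_Fsigma U : rect U ->
  exists2 V : nat -> set (X * Y), (forall n, rect (V n)) & U = \bigcup_n ~` V n.
Proof.
move=> [E [F [hE hF ->]]]; exists (fun n => ~` (E n `*` F n)); last first.
  by apply: eq_bigcupr => n _; rewrite setCK.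
move=> n; have -> : ~` (E n `*` F n) = \bigcup_k (if k is 0%N then ~` E n `*` setT
    else setT `*` ~` F n).
  apply/seteqP; split=> [[x y] /not_andP[nE|nF]|[x y] [[|k] _ [/= a b]]].
  - by exists 0%N.
  - by exists 1%N.
  - by move=> [/= ? ?].
  - by move=> [/= ? ?].
by apply: rect_bigcup => -[|k]; apply: rect1; (exact: sigmaT || exact: sigmaC).
Qed.

Lemma sigma_preimage Z Z' (op : set (set Z)) (op' : set (set Z')) (f : Z -> Z') S :
  (forall U, op' U -> <<s op >> (f @^-1` U)) -> <<s op' >> S -> <<s op >> (f @^-1` S).
Proof.
move=> cf sS; apply: (sS [set S | <<s op >> (f @^-1` S)]); split=> //; split.
- by rewrite /= preimage_set0; apply: sigma_algebra0.
- by move=> A hA; rewrite /= setTD preimage_setC; apply: (@sigmaC).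
- by move=> A hA; rewrite /= preimage_bigcup; apply: (@sigmaU).
Qed.

Lemma rect_sigma : rect `<=` <<s op2 >>.
Proof.
move=> _ [E [F [hE hF ->]]]; apply: (@sigmaU) => n.
have -> : E n `*` F n = fst @^-1` (E n) `&` snd @^-1` (F n) by [].
apply: (@sigma_setI).
  apply: (@sigma_preimage _ _ _ opX) => // U oU.
  by apply: sub_sigma_algebra; left; exists U.
apply: (@sigma_preimage _ _ _ opY) => // U oU.
by apply: sub_sigma_algebra; right; exists U.
Qed.

End rectangles.

(** * From classes over Borel rectangles to potential classes *)

Section potential.
Variables (R : realType) (xi : countable_ordinal) (X Y : topologicalType).
Variables (dX : X -> X -> R) (dY : Y -> Y -> R).
Hypothesis pX : polish_metric dX.
Hypothesis pY : polish_metric dY.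
Hypothesis oX : forall U : set X, open U <-> metric_open dX U.
Hypothesis oY : forall U : set Y, open U <-> metric_open dY U.

Definition prod_mopen (d : X -> X -> R) (d' : Y -> Y -> R) : set (set (X * Y)) :=
  [set W | forall x y, W (x, y) ->
    exists2 e, 0 < e & forall a b, d x a < e -> d' y b < e -> W (a, b)].

Lemma prod_mopen_refines d1 d1' d2 d2' : refines d1 d2 -> refines d1' d2' ->
  prod_mopen d1 d1' `<=` prod_mopen d2 d2'.
Proof.
move=> r r' W oW x y Wxy; have [e e0 he] := oW x y Wxy.
have [f f0 hf] := r x e e0; have [f' f'0 hf'] := r' y e e0.
exists (Num.min f f'); first by rewrite lt_min f0.
by move=> a b; rewrite !lt_min => /andP[/hf ? _] /andP[_ /hf' ?]; apply: he.
Qed.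

(** At the base, countably many Borel sets are made open at once; at a union, the metrics obtained
    for the countably many terms are joined. *)
Lemma sig_rect_metrics o S : sigma_over (rect (@open X) (@open Y)) (o : option (ord_carrier xi)) S ->
  exists d d', [/\ polish_metric d, refines dX d, polish_metric d', refines dY d'
    & sigma_over (prod_mopen d d') o S].
Proof.
have -> : @open X = metric_open dX by apply/seteqP; split=> U /oX.
have -> : @open Y = metric_open dY by apply/seteqP; split=> U /oY.
elim=> {o S} [v _ b [E [F [hE hF ->]]]|v w F b _ /choice[d /choice[d' IH]]].
  have [d [p r h]] := borel_seq_refinement pX hE.
  have [d' [p' r' h']] := borel_seq_refinement pY hF.
  exists d, d'; split=> //; apply: sig_open => // x y [n _ [/= Ex Fy]].
  have [e e0 he] := h n x Ex; have [f f0 hf] := h' n y Fy.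
  exists (Num.min e f); first by rewrite lt_min e0.
  move=> a a'; rewrite !lt_min => /andP[xa _] /andP[_ ya]; exists n => //.
  by split; [apply: he|apply: hf].
have [mX _ _] := pX; have [mY _ _] := pY.
have [||d1 [p1 r1]] := @metric_join R X dX d mX.
- by move=> n; have [] := IH n.
- by move=> n; have [] := IH n.
have [||d2 [p2 r2]] := @metric_join R Y dY d' mY.
- by move=> n; have [] := IH n.
- by move=> n; have [] := IH n.
exists d1, d2; split=> //.
- by apply: refines_trans (r1 0%N); have [] := IH 0%N.
- by apply: refines_trans (r2 0%N); have [] := IH 0%N.
- apply: sig_bigcupC b _ => n; have [_ _ _ _] := IH n.
  by apply: sig_sub; apply: prod_mopen_refines.
Qed.

Lemma sig_rect_borel o S : sigma_over (rect (@open X) (@open Y)) (o : option (ord_carrier xi)) S ->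
  borel S.
Proof.
apply: sig_sigma; apply: subset_trans (@rect_sigma _ _ _ _) _.
apply: sub_sigma_algebra2 => _ [] [U oU ->].
  by apply: open_comp => // x _; apply: cvg_fst.
by apply: open_comp => // x _; apply: cvg_snd.
Qed.

Lemma finer_polish_metric (Z : topologicalType) (d d' : Z -> Z -> R) (md : is_metric d') :
  (forall U : set Z, open U <-> metric_open d U) -> refines d d' -> polish_metric d' ->
  finer_polish R (metric_topological md).
Proof.
move=> oZ r p; split; last exact: metric_polish.
by move=> U /oZ oU; apply/metric_topologicalE; apply: refines_open oU.
Qed.

Lemma sig_metrics_potential d d' S : polish_metric d -> refines dX d ->
  polish_metric d' -> refines dY d' ->
  sigma_over (prod_mopen d d') (None : option (ord_carrier xi)) (~` S) ->
  potentially_Pi0_1p R xi S.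
Proof.
move=> p r p' r' sS; have [md _ _] := p; have [md' _ _] := p'.
exists (metric_topological md), (metric_topological md'); split.
- exact: finer_polish_metric oX r p.
- exact: finer_polish_metric oY r' p'.
- apply/Sigma0_sig; apply: sig_sub sS => W oW.
  exact/prod_metric_openP.
Qed.

Lemma sig_rect_separable (A B D : set (X * Y)) :
  sigma_over (rect (@open X) (@open Y)) (None : option (ord_carrier xi)) D ->
  B `<=` D -> D `&` A = set0 -> separable_by_pot_Pi0_1p R xi A B.
Proof.
move=> sD BD DA; exists (~` D); split.
- by apply: (@sigmaC); apply: sig_rect_borel sD.
- have [d [d' [p r p' r' sD']]] := sig_rect_metrics sD.
  by apply: sig_metrics_potential p r p' r' _; rewrite setCK.
- by move=> z Az Dz; have : (D `&` A) z by []; rewrite DA.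
- by rewrite -subset0 => z [nD /BD].
Qed.

End potential.

Local Close Scope ring_scope.

(** * Configurations *)

Section rect_separation.
Variables (X Y : Type) (opX : set (set X)) (opY : set (set Y)).
Hypothesis sX : hausdorff_base opX.
Hypothesis sY : hausdorff_base opY.
Hypothesis aX : ana opX setT.
Hypothesis aY : ana opY setT.

Lemma ana_op2T : ana (op2 opX opY) setT.
Proof.
have [F [g [cF cg sT]]] := aX; have [F' [g' [cF' cg' sT']]] := aY.
exists (fun b => F (bproj 0 b) /\ F' (bproj 1 b)), (fun b => (g (bproj 0 b), g' (bproj 1 b))).
split.
- exact: bclosed_setI (bclosed_bproj cF) (bclosed_bproj cF').
- move=> b [Fb F'b] _ [] [U oU ->] /= Ub.
    have [n hn] := @bcont_bproj _ _ _ 0 _ cg b Fb U oU Ub.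
    by exists n => c [Fc _]; apply: hn.
  have [n hn] := @bcont_bproj _ _ _ 1 _ cg' b F'b U oU Ub.
  by exists n => c [_ Fc]; apply: hn.
- apply/seteqP; split=> // -[x y] _.
  have [b Fb <-] : (g @` F) x by rewrite -sT.
  have [b' Fb' <-] : (g' @` F') y by rewrite -sT'.
  have [c hc] := bproj_surj (fun k => if k is 0 then b else b').
  by exists c; rewrite ?hc.
Qed.

Lemma opcont_fst : opcont (op2 opX opY) opX fst.
Proof. by move=> U oU; left; exists U. Qed.

Lemma opcont_snd : opcont (op2 opX opY) opY snd.
Proof. by move=> U oU; right; exists U. Qed.

(** Lusin's theorem is applied twice: to [E] and the projection of the part of [K] over [F], then to
    [F] and the projection of the part of [K] over the Borel set [E'] just found. *)
Lemma rect_separation E F K : ana opX E -> ana opY F -> ana (op2 opX opY) K ->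
  (E `*` F) `&` K = set0 -> exists E' F', [/\ <<s opX >> E', <<s opY >> F',
    E `<=` E', F `<=` F' & (E' `*` F') `&` K = set0].
Proof.
move=> aE aF aK EFK; have s2 := hausdorff_base_op2 sX sY.
pose K1 := fst @` (K `&` snd @^-1` F).
have [||E' [bE' EE' E'K]] := lusin_separation (S1 := E) (S2 := K1) sX aE.
- apply: ana_image opcont_fst _; apply: ana_setI => //.
  exact: ana_preimage sY ana_op2T opcont_snd aF.
- rewrite -subset0 => x [Ex [[x' y] [Kxy Fy] /= e]]; subst x'.
  by have : ((E `*` F) `&` K) (x, y) by []; rewrite EFK.
pose K2 := snd @` (K `&` fst @^-1` E').
have [||F' [bF' FF' F'K]] := lusin_separation (S1 := F) (S2 := K2) sY aF.
- apply: ana_image opcont_snd _; apply: ana_setI => //.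
  apply: ana_preimage sX ana_op2T opcont_fst _.
  by have [] := sigma_op_biana sX aX bE'.
- rewrite -subset0 => y [Fy [[x y'] [Kxy Ex] /= e]]; subst y'.
  by have : (E' `&` K1) x by [split=> //; exists (x, y)]; rewrite E'K.
exists E', F'; split=> //; rewrite -subset0 => -[x y] [[/= Ex Fy] Kxy].
by have : (F' `&` K2) y by [split=> //; exists (x, y)]; rewrite F'K.
Qed.

Variable V : finType.
Let Z := ((V -> X) * (V -> Y))%type.

Definition op_conf : set (set Z) := [set W |
  (exists v U, opX U /\ W = [set c | U (c.1 v)]) \/
  (exists v U, opY U /\ W = [set c | U (c.2 v)])].

Lemma ana_confT : ana op_conf setT.
Proof.
have [F [g [cF cg sT]]] := aX; have [F' [g' [cF' cg' sT']]] := aY.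
(* Components of even number code the points of [X], those of odd number the points of [Y]. *)
pose kx (v : V) := (pickle v).*2; pose ky (v : V) := (pickle v).*2.+1.
exists (fun b => (forall v, F (bproj (kx v) b)) /\ (forall v, F' (bproj (ky v) b))),
  (fun b => (fun v => g (bproj (kx v) b), fun v => g' (bproj (ky v) b))).
split.
- by apply: bclosed_setI; apply: bclosed_forall => v; apply: bclosed_bproj.
- move=> b [Fb F'b] _ [] [v [U [oU ->]]] /= Ub.
    have [n hn] := @bcont_bproj _ _ _ (kx v) _ cg b (Fb v) U oU Ub.
    by exists n => c [Fc _]; apply: hn.
  have [n hn] := @bcont_bproj _ _ _ (ky v) _ cg' b (F'b v) U oU Ub.
  by exists n => c [_ Fc]; apply: hn.
- apply/seteqP; split=> // -[x y] _.
  have /choice[bx hbx] : forall v, exists b, F b /\ g b = x v.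
    by move=> v; have [b Fb e] : (g @` F) (x v) by [rewrite -sT]; exists b.
  have /choice[by_ hby] : forall v, exists b, F' b /\ g' b = y v.
    by move=> v; have [b Fb e] : (g' @` F') (y v) by [rewrite -sT']; exists b.
  have [c hc] := bproj_surj (fun k => if unpickle k./2 is Some v then
     (if odd k then by_ v else bx v) else (fun=> 0)).
  have cx v : bproj (kx v) c = bx v by rewrite hc /kx doubleK pickleK odd_double.
  have cy v : bproj (ky v) c = by_ v.
    by rewrite hc /ky /= odd_double /= uphalf_double pickleK.
  exists c; first by split=> v; rewrite ?cx ?cy; [have [] := hbx v|have [] := hby v].
  by congr pair; apply/funext => v; rewrite ?cx ?cy; [have [] := hbx v|have [] := hby v].
Qed.

Lemma hausdorff_base_conf : hausdorff_base op_conf.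
Proof.
move=> [x y] [x' y'] ne; have [ex|nx] := pselect (x = x').
  have [v nv] : exists v, y v <> y' v.
    by apply: contrapT => /forallNP h; apply: ne; rewrite ex; congr pair;
      apply/funext => v; apply: contrapT => /h.
  have [U [U' [oU oU' Uy U'y UU]]] := sY nv.
  exists [set c | U (c.2 v)], [set c | U' (c.2 v)]; split=> //.
  - by right; exists v, U.
  - by right; exists v, U'.
  - by rewrite -subset0 => c [a b]; have : (U `&` U') (c.2 v) by []; rewrite UU.
have [v nv] : exists v, x v <> x' v.
  by apply: contrapT => /forallNP h; apply: nx; apply/funext => v; apply: contrapT => /h.
have [U [U' [oU oU' Uy U'y UU]]] := sX nv.
exists [set c | U (c.1 v)], [set c | U' (c.1 v)]; split=> //.
- by left; exists v, U.
- by left; exists v, U'.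
- by rewrite -subset0 => c [a b]; have : (U `&` U') (c.1 v) by []; rewrite UU.
Qed.

Variables (LX : V -> set X) (LY : V -> set Y) (Te : V -> V -> Prop).
Hypothesis aLX : forall v, ana opX (LX v).
Hypothesis aLY : forall v, ana opY (LY v).

Definition conf_sat (M : V -> V -> set (X * Y)) (c : Z) :=
  [/\ forall v, LX v (c.1 v), forall v, LY v (c.2 v) &
      forall s t, Te s t -> M s t (c.1 s, c.2 t)].

Lemma ana_fin_forall (J : countType) (Q : J -> set Z) :
  (forall i, ana op_conf (Q i)) -> ana op_conf [set c | forall i, Q i c].
Proof.
move=> h; have -> : [set c | forall i, Q i c] =
    \bigcap_n (if unpickle n is Some i then Q i else setT).
  apply/seteqP; split=> [c hc n _|c hc i]; first by case: unpickle.
  by have := hc (pickle i) I; rewrite pickleK.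
apply: (ana_bigcap hausdorff_base_conf) => n; case: unpickle => //.
exact: ana_confT.
Qed.

Lemma ana_conf_sat M : (forall s t, Te s t -> ana (op2 opX opY) (M s t)) ->
  ana op_conf [set c | conf_sat M c].
Proof.
move=> aM; have aT := ana_confT.
have -> : [set c | conf_sat M c] = [set c | forall v, LX v (c.1 v)] `&`
    ([set c | forall v, LY v (c.2 v)] `&`
     [set c | forall st : V * V, Te st.1 st.2 -> M st.1 st.2 (c.1 st.1, c.2 st.2)]).
  apply/seteqP; split=> [c [a b h]|c [a [b h]]]; last by split=> // s t; apply: (h (s, t)).
  by split=> //; split=> // -[s t]; apply: h.
apply: (ana_setI hausdorff_base_conf); last apply: (ana_setI hausdorff_base_conf).
- apply: (@ana_fin_forall _ (fun v c => LX v (c.1 v))) => v.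
  apply: (ana_preimage sX aT _ (aLX v)) => U oU; by left; exists v, U.
- apply: (@ana_fin_forall _ (fun v c => LY v (c.2 v))) => v.
  apply: (ana_preimage sY aT _ (aLY v)) => U oU; by right; exists v, U.
- apply: (@ana_fin_forall _ (fun st c => Te st.1 st.2 -> M st.1 st.2 (c.1 st.1, c.2 st.2))).
  move=> [s t]; change (ana op_conf [set c : Z | Te s t -> M s t (c.1 s, c.2 t)]).
  have [Tst|nT] := pselect (Te s t); last first.
    by have -> : [set c : Z | Te s t -> M s t (c.1 s, c.2 t)] = setT by
      apply/seteqP; split=> // c _ /nT.
  have -> : [set c : Z | Te s t -> M s t (c.1 s, c.2 t)] =
      (fun c => (c.1 s, c.2 t)) @^-1` M s t.
    by apply/seteqP; split=> c /=; [apply|].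
  apply: (ana_preimage (hausdorff_base_op2 sX sY) aT _ (aM s t Tst)).
  by move=> _ [] [U oU ->]; [left; exists s, U|right; exists t, U].
Qed.

(* Removing an edge of an acyclic relation disconnects its ends, so that configurations
   satisfying all the other constraints realize a full rectangle at these ends. *)
Lemma conf_edge (M : V -> V -> set (X * Y)) s0 t0 :
  (forall v, ~ Te v v) -> rel_acyclic (fun s t => Te s t \/ Te t s) -> Te s0 t0 ->
  (forall s t, Te s t -> ana (op2 opX opY) (M s t)) ->
  let M0 s t := if (s, t) == (s0, t0) then setT else M s t in
  let E := (fun c => c.1 s0) @` conf_sat M0 in
  let F := (fun c => c.2 t0) @` conf_sat M0 in
  [/\ ana opX E, ana opY F &
    forall N : set (X * Y), ((E `*` F) `&` N !=set0) <->
      exists c, conf_sat (fun s t => if (s, t) == (s0, t0) then N else M s t) c].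
Proof.
move=> irr acy T0 aM M0 E F.
have aS : ana op_conf (conf_sat M0).
  apply: ana_conf_sat => s t Tst; rewrite /M0; case: ifP => _; last exact: aM.
  exact: ana_op2T.
split.
- by apply: ana_image aS => U oU; left; exists s0, U.
- by apply: ana_image aS => U oU; right; exists t0, U.
move=> N; split=> [[[_ _] [[/= [c [hx hy hc] <-] [c' [hx' hy' hc'] <-]] Nxy]]|[c [hx hy hc]]].
  have [CL [CR [L0 R0 LR]]] := acyclic_edge_cut irr acy T0.
  (* The first configuration is used on the component of [s0], the second elsewhere; every other
     edge has both its ends on the same side. *)
  exists (fun v => if `[< CL v >] then c.1 v else c'.1 v,
          fun v => if `[< CR v >] then c.2 v else c'.2 v); split=> [v|v|s t Tst] /=.
  - by case: ifP.
  - by case: ifP.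
  - case: eqP => [[-> ->]|ne]; first by rewrite asboolT // asboolF.
    have := hc s t Tst; have := hc' s t Tst; rewrite /M0; have /eqP/negbTE-> := ne.
    rewrite (asbool_equiv_eq (LR s t Tst ne)); by case: ifP.
exists (c.1 s0, c.2 t0); split; last by have := hc _ _ T0; rewrite eqxx.
have sM0 : conf_sat M0 c.
  split=> // s t Tst; have := hc s t Tst; rewrite /M0; by case: ifP.
by split=> /=; exists c.
Qed.

End rect_separation.

(** * The construction along the levels of the tree *)

Section construction.
Variables (xi : countable_ordinal) (X Y : Type) (opX : set (set X)) (opY : set (set Y)).
Hypothesis sX : hausdorff_base opX.
Hypothesis sY : hausdorff_base opY.
Hypothesis aX : ana opX setT.
Hypothesis aY : ana opY setT.

Let Om := option (ord_carrier xi).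
Let K := (bool * bool)%type.
Notation lt := (@olt xi).

Variables (rel cond : Om -> seq K -> seq K -> Prop) (Th : seq K -> seq Om).
Hypothesis relE : forall o s t,
  rel o s t <-> prefix s t /\ forall v, lt v o -> cond v s t.
Hypothesis rel_trans : forall o s t u, rel o s t -> rel o t u -> rel o s u.
Hypothesis cond_trans : forall o s t u,
  rel o s t -> cond o s t -> cond o t u -> cond o s u.
Hypothesis club : forall o r s t, rel o s t -> cond o r t -> cond o r s.
Hypothesis cond_fin : forall v r t, ~ cond v r t -> v \in Th r.
Hypothesis rel_nil : forall o t, rel o [::] t.

Variable Lab : set (seq K).
Hypothesis Lab_up : forall s t, rel None s t -> Lab s -> Lab t.
Hypothesis Lab_nil : ~ Lab [::].

Variable Tk : set (seq K).
Hypothesis Tk_prefix : forall s t, prefix s t -> Tk t -> Tk s.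

Variables (FA FB : set baire) (gA gB : baire -> X * Y).
Hypothesis cFA : bclosed FA.
Hypothesis cFB : bclosed FB.
Hypothesis cgA : bcont (op2 opX opY) FA gA.
Hypothesis cgB : bcont (op2 opX opY) FB gB.
Let A := gA @` FA.
Let B := gB @` FB.

Let s2 := hausdorff_base_op2 sX sY.
Let a2 := ana_op2T aX aY.

Lemma rel_linear o r s t : prefix r s -> rel o r t -> rel o s t -> rel o r s.
Proof.
move=> prs /relE[prt crt] rst; apply/relE; split=> // v vo; apply: (@club v r s t).
  by move/relE: rst => [pst cst]; apply/relE; split=> // u uv; apply: cst; apply: olt_trans vo.
exact: crt.
Qed.

Lemma relW v o s t : lt v o -> rel o s t -> rel v s t.
Proof. by move=> vo /relE[p c]; apply/relE; split=> // u uv; apply: c; apply: olt_trans vo. Qed.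

(* [rels u s t] is the relation of level [u + 1]. *)
Definition rels u s t := rel u s t /\ cond u s t.

Lemma rels_trans u r s t : rels u r s -> rels u s t -> rels u r t.
Proof.
move=> [r1 c1] [r2 c2]; split; first exact: rel_trans r2.
exact: cond_trans c2.
Qed.

Lemma rels_linear u r s t : prefix r s -> rels u r t -> rels u s t -> rels u r s.
Proof.
move=> prs [r1 c1] [r2 c2]; split; first exact: rel_linear r2.
exact: club r2 c1.
Qed.

(* [is_level o s t]: [o] is the largest level with [rel o s t]. *)
Definition is_level (o : Om) (s t : seq K) := rel o s t /\ (o = None \/ ~ cond o s t).

Lemma ex_level s t : prefix s t -> exists o, is_level o s t.
Proof.
move=> pst; have [h|nh] := pselect (rel None s t); first by exists None; split=> //; left.
have [|w [nw h]] := @ord_least xi [set w | ~ cond (Some w) s t].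
  apply: contrapT => no; apply: nh; apply/relE; split=> // -[w|//] _.
  by apply: contrapT => nc; apply: no; exists w.
exists (Some w); split; last by right.
apply/relE; split=> // -[v|//] [vw nvw]; apply: contrapT => nc; apply: nvw.
exact: ord_anti vw (h v nc).
Qed.

Definition level s t : Om := xget None [set o | is_level o s t].

Lemma levelP s t : prefix s t -> is_level (level s t) s t.
Proof. by move=> /ex_level[v hv]; apply: (@xgetPex _ None [set v | is_level v s t]); exists v. Qed.

Lemma olt_levelP w s t : prefix s t -> lt (Some w) (level s t) <-> rels (Some w) s t.
Proof.
move=> pst; have [r n] := levelP pst; split=> [wl|[rw cw]].
  by split; [exact: relW r|move/relE: r => [_]; apply].
have [//|e|lw] := olt_total (Some w) (level s t).
  by case: n; rewrite -e.
case: n => [e|nc]; first by rewrite e in lw.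
by exfalso; apply: nc; move/relE: rw => [_]; apply.
Qed.

(* The conditions inherited from one stage to the next; the clause on [Th] makes them
   finite in number and still sufficient for going back to [t] later. *)
Definition need t s w := rels (Some w) t s /\ forall r, prefix t r -> t <> r ->
  prefix r s -> r = s \/ rels (Some w) r s -> Some w \in Th r.

Let sys := Om -> seq K -> set (X * Y).

Definition conds (C : sys) (s : seq K) : set (X * Y) :=
  [set z | forall t w, prefix t s -> t <> s -> need t s w -> ~ C (Some w) t z].

Definition image_of (s : seq K) (q : seq nat) : set (X * Y) :=
  if `[< Lab s >] then piece FA gA q else piece FB gB q.

(** The last clause is the condition of the top level: an unlabelled node uses [B], and must keep
    open a later switch to [A]. *)
Definition cell (C : sys) (s : seq K) (q : seq nat) : set (X * Y) :=
  [set z | [/\ image_of s q z, conds C s z & ~ Lab s -> ~ C None [::] z]].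

(** Only nodes of length at most [p] have received their code, hence the bound. At the top level the
    set to be missed is all of [A], because a newly labelled node starts with an empty code. *)
Definition admissible (p : nat) (q : seq K -> seq nat) (C : sys) :=
  [/\ forall u t, sigma_over (rect opX opY) u (C u t),
      forall w t, (size t <= p)%N -> Tk t -> C (Some w) t `&` cell C t (q t) = set0
    & C None [::] `&` A = set0].

Definition sys_le (C C' : sys) := forall u t, C u t `<=` C' u t.

Lemma cell_anti C C' s q : sys_le C C' -> cell C' s q `<=` cell C s q.
Proof.
move=> CC z [i c n]; split=> // [t w pts nts nd Cz|nL Cz].
  by apply: (c t w) => //; apply: CC.
by apply: (n nL); apply: CC.
Qed.

Let rU := @rect_bigcup X Y opX opY.
Let rI := @rect_setI X Y opX opY.
Let rF := @rect_Fsigma X Y opX opY.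

Lemma rect_set0 : rect opX opY set0.
Proof. by rewrite -(set0X (setT : set Y)); apply: rect1; [exact: sigma_algebra0|exact: sigmaT]. Qed.

Lemma admissible0 p q : admissible p q (fun _ _ => set0).
Proof.
split; [|by move=> *; rewrite set0I|by rewrite set0I].
by move=> u t; apply: (sig_op rF); apply: rect_set0.
Qed.

(** Enlarging the family shrinks every cell, so disjointness passes to the union. *)
Lemma admissible_bigcup p q (C : nat -> sys) : (forall n, admissible p q (C n)) ->
  admissible p q (fun u t => \bigcup_n C n u t).
Proof.
move=> h; have le n : sys_le (C n) (fun u t => \bigcup_n C n u t).
  by move=> u t z Cz; exists n.
split=> [u t|w t st Tt|].
- by apply: (sig_bigcup rU) => n; have [] := h n.
- rewrite -subset0 => z [[n _ Cz] cz]; have [_ h' _] := h n.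
  by rewrite -(h' w t st Tt); split=> //; apply: cell_anti (le n) _ cz.
- by rewrite -subset0 => z [[n _ Cz] Az]; have [_ _ <-] := h n.
Qed.

Lemma sig_ana u S : sigma_over (rect opX opY) (u : Om) S ->
  ana (op2 opX opY) S /\ ana (op2 opX opY) (~` S).
Proof. by move=> sS; apply: (sigma_op_biana s2 a2); apply: sig_sigma sS; apply: rect_sigma. Qed.

Lemma ana_forall (J : countType) (Q : J -> set (X * Y)) :
  (forall i, ana (op2 opX opY) (Q i)) -> ana (op2 opX opY) [set c | forall i, Q i c].
Proof.
move=> h; have -> : [set c | forall i, Q i c] =
    \bigcap_n (if unpickle n is Some i then Q i else setT).
  apply/seteqP; split=> [c hc n _|c hc i]; first by case: unpickle.
  by have := hc (pickle i) I; rewrite pickleK.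
by apply: (ana_bigcap s2) => n; case: unpickle.
Qed.

Lemma ana_conds p q C s : admissible p q C -> ana (op2 opX opY) (conds C s).
Proof.
move=> [sC _ _].
have -> : conds C s = [set z | forall tw : seq K * ord_carrier xi, prefix tw.1 s ->
   tw.1 <> s -> need tw.1 s tw.2 -> ~ C (Some tw.2) tw.1 z].
  by apply/seteqP; split=> [z h [t w]|z h t w]; [apply: h|apply: (h (t, w))].
apply: (@ana_forall _ (fun tw z => prefix tw.1 s -> tw.1 <> s ->
  need tw.1 s tw.2 -> ~ C (Some tw.2) tw.1 z)) => -[t w] /=.
have [[p1 p2 p3]|np] := pselect [/\ prefix t s, t <> s & need t s w].
  have [_] := sig_ana (sC (Some w) t); congr ana.
  by apply/seteqP; split=> z /=; [|apply].
move: a2; congr ana; apply/seteqP; split=> // z _ p1 p2 p3.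
by exfalso; apply: np.
Qed.

Lemma ana_image_of s q : ana (op2 opX opY) (image_of s q).
Proof. by rewrite /image_of; case: ifP => _; apply: ana_piece. Qed.

Lemma ana_cell p q C s r : admissible p q C -> ana (op2 opX opY) (cell C s r).
Proof.
move=> aC; have -> : cell C s r = image_of s r `&` (conds C s `&`
    (if `[< Lab s >] then setT else ~` C None [::])).
  apply/seteqP; split=> [z [i c n]|z [i [c n]]].
    by split=> //; split=> //; case: ifP => // /asboolP /n.
  split=> // nL; move: n; rewrite asboolF //.
apply: (ana_setI s2); [exact: ana_image_of|apply: (ana_setI s2)].
  exact: ana_conds aC.
case: ifP => // _; have [sC _ _] := aC.
by have [] := sig_ana (sC None [::]).
Qed.

Lemma sig_list (I : eqType) (l : seq I) (S : I -> set (X * Y)) (u : Om) :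
  (forall i, i \in l -> sigma_over (rect opX opY) u (S i)) ->
  sigma_over (rect opX opY) u [set z | forall i, i \in l -> S i z].
Proof.
elim: l => [|i l IH] h.
  have -> : [set z | forall i, i \in [::] -> S i z] = setT `*` setT.
    by apply/seteqP; split.
  by apply: (sig_op rF); apply: rect1; exact: sigmaT.
have -> : [set z | forall j, j \in i :: l -> S j z] =
    S i `&` [set z | forall j, j \in l -> S j z].
  apply/seteqP; split=> [z hz|z [Sz hz] j].
    by split=> [|j jl]; apply: hz; rewrite inE ?eqxx // jl orbT.
  by rewrite inE => /orP[/eqP->|/hz].
apply: (sig_setI rU rI rF); first by apply: h; rewrite inE eqxx.
by apply: IH => j jl; apply: h; rewrite inE jl orbT.
Qed.

(* What is added to [C u0 t0] is a Borel rectangle containing [E x F], cut down by [M]. *)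
Lemma enlarge p q C u0 t0 (E : set X) (F : set Y) (M N : set (X * Y)) :
  admissible p q C -> ana opX E -> ana opY F -> ana (op2 opX opY) N ->
  sigma_over (rect opX opY) u0 M -> (E `*` F) `&` (M `&` N) = set0 ->
  (u0 = None -> t0 = [::] -> A `<=` N) ->
  (u0 <> None -> cell C t0 (q t0) `<=` N) ->
  exists C', [/\ admissible p q C', sys_le C C' & (E `*` F) `&` M `<=` C' u0 t0].
Proof.
move=> aC aE aF aN sM EFMN hA hN; have [sC dC AC] := aC.
have aMN : ana (op2 opX opY) (M `&` N).
  by apply: (ana_setI s2) => //; have [] := sig_ana sM.
have [E' [F' [bE' bF' EE' FF' d']]] := rect_separation sX sY aX aY aE aF aMN EFMN.
pose D := (E' `*` F') `&` M.
have sD : sigma_over (rect opX opY) u0 D.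
  by apply: (sig_setI rU rI rF) => //; apply: (sig_op rF); apply: rect1.
have DN : D `&` N = set0 by rewrite /D -setIA.
pose C' : sys := fun u t => if `[< u = u0 /\ t = t0 >] then C u t `|` D else C u t.
have CC' : sys_le C C' by move=> u t z Cz; rewrite /C'; case: ifP => // _; left.
exists C'; split=> //.
- split=> [u t|w t st Tt|].
  + rewrite /C'; case: ifP => // /asboolP[-> ->]; exact: (sig_setU rU).
  + rewrite -subset0 => z [Cz /(cell_anti CC') cz].
    move: Cz; rewrite /C'; case: ifP => [/asboolP[e1 e2] [Cz|Dz]|_ Cz].
    * by rewrite -(dC w t st Tt).
    * rewrite -DN; split=> //; apply: hN; first by rewrite -e1.
      by rewrite -e2.
    * by rewrite -(dC w t st Tt).
  + rewrite -subset0 => z [+ Az]; rewrite /C'.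
    case: ifP => [/asboolP[e1 e2] [Cz|Dz]|_ Cz].
    * by rewrite -AC.
    * by rewrite -DN; split=> //; apply: hA.
    * by rewrite -AC.
- move=> [x y] [[/= Ex Fy] Mz]; rewrite /C' asboolT //; right.
  by split=> //; split=> /=; [apply: EE'|apply: FF'].
Qed.

Definition is_pred (c s : seq K) := [/\ prefix c s, (size c < size s)%N, rel None c s &
  forall t, prefix t s -> (size c < size t < size s)%N -> ~ rel None t s].

(** When the label appears, the code restarts from the empty sequence: codes for [A] and for [B]
    refer to different closed sets. *)
Definition base (q : seq K -> seq nat) c s : seq nat :=
  if `[< Lab s /\ ~ Lab c >] then [::] else q c.

(** * Moving one edge from a level of the tree to the next *)

Section edge.
Variables (p : nat) (q : seq K -> seq nat) (s : seq K).
Hypothesis Ts : Tk s.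
Hypothesis szs : size s = p.+1.
(** In the application these are the ranges of the points at the two ends of the edge when the
    constraint of this edge is lifted; they shrink as the family grows. *)
Variables (E : sys -> set X) (F : sys -> set Y).
Hypothesis aE : forall C, admissible p q C -> ana opX (E C).
Hypothesis aF : forall C, admissible p q C -> ana opY (F C).
Hypothesis E_anti : forall C C', sys_le C C' -> E C' `<=` E C.
Hypothesis F_anti : forall C C', sys_le C C' -> F C' `<=` F C.

Let tau i := take i s.
Let th i := level (tau i) s.

Let EF C := E C `*` F C.

Let part_conds (C : sys) i : set (X * Y) :=
  [set z | forall j w, (i <= j <= p)%N -> need (tau j) s w -> ~ C (Some w) (tau j) z].

Lemma EF_anti C C' : sys_le C C' -> EF C' `<=` EF C.
Proof. by move=> CC z [/= a b]; split; [apply: E_anti a|apply: F_anti b]. Qed.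

Lemma part_conds_anti C C' i : sys_le C C' -> part_conds C' i `<=` part_conds C i.
Proof. by move=> CC z h j w ij nd Cz; apply: (h j w) => //; apply: CC. Qed.

Lemma size_tau i : (i <= p)%N -> size (tau i) = i.
Proof. by move=> ip; rewrite size_takel // szs ltnW. Qed.

Lemma prefix_tau i : prefix (tau i) s.
Proof. exact: prefix_take. Qed.

Lemma prefix_tau2 i j : (i <= j <= p)%N -> prefix (tau i) (tau j).
Proof.
move=> /andP[ij jp]; rewrite prefixE size_tau ?(leq_trans ij) //.
by rewrite /tau take_takel.
Qed.

Lemma tau_neq i j : (i < j <= p)%N -> tau i <> tau j.
Proof.
move=> /andP[ij jp] /(congr1 size); rewrite !size_tau ?(leq_trans (ltnW ij)) //.
by move=> e; rewrite e ltnn in ij.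
Qed.

Lemma prefix_between r i j : (i <= p)%N -> (j <= p)%N -> prefix (tau i) r -> tau i <> r ->
  prefix r (tau j) -> exists2 k, (i < k <= j)%N & r = tau k.
Proof.
move=> ip jp pr ne rj; exists (size r).
  have := size_prefix rj; rewrite size_tau // => ->; rewrite andbT.
  have := size_prefix pr; rewrite size_tau // leq_eqVlt => /orP[/eqP e|//].
  exfalso; apply: ne; move: pr; rewrite prefixE size_tau // => /eqP <-.
  by rewrite e take_size.
have rs : prefix r s by apply: prefix_trans rj (prefix_tau j).
by move: rs; rewrite prefixE => /eqP.
Qed.

(** The clause of [need] taken at [r = s] confines the levels to the finite list [Th s]. This
    matters because the classes are stable under finite intersections only. *)
Lemma sig_part_conds C i v : admissible p q C ->
  (forall j w, (i <= j <= p)%N -> need (tau j) s w -> lt (Some w) v) ->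
  sigma_over (rect opX opY) v (part_conds C i).
Proof.
move=> [sC _ _] hv.
pose l := [seq (j, u) | j <- iota i (p.+1 - i), u <- Th s].
pose S (ju : nat * Om) : set (X * Y) := [set z | forall w, ju.2 = Some w ->
  (i <= ju.1 <= p)%N -> need (tau ju.1) s w -> ~ C (Some w) (tau ju.1) z].
have -> : part_conds C i = [set z | forall ju, ju \in l -> S ju z].
  apply/seteqP; split=> [z h [j u] _ w /= _ ij nd|z h j w ij nd]; first exact: h.
  apply: (h (j, Some w)) => //; apply/allpairsP; exists (j, Some w); split=> //=.
    rewrite mem_iota; move: ij => /andP[ij jp]; rewrite ij /= subnKC ?ltnS //.
    exact: leq_trans ij (leqW jp).
  have [_] := nd; apply; [exact: prefix_tau| |exact: prefix_refl|by left].
  move=> /(congr1 size); move: ij => /andP[_ jp]; rewrite size_tau // szs => e.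
  by rewrite e ltnn in jp.
apply: sig_list => -[j u] _.
have [[w [e ij nd]]|no] := pselect (exists w, [/\ u = Some w, (i <= j <= p)%N &
    need (tau j) s w]).
  have -> : S (j, u) = ~` C (Some w) (tau j).
    apply/seteqP; split=> [z h|z nC w' /= e']; first exact: h.
    by move: e'; rewrite e => -[<-].
  by apply: (sig_compl (v := Some w)) => //; apply: hv nd.
have -> : S (j, u) = setT `*` setT.
  apply/seteqP; split=> // z _ w /= e ij nd; exfalso; apply: no; by exists w.
by apply: (sig_op rF); apply: rect1; exact: sigmaT.
Qed.

(** The search descends from [p] to 0 and has reached [i]; [c] is the last position from [i] on
    where the level with respect to [s] is largest. The conditions in [part_conds] are those that
    [s] will impose from the positions already visited. *)
Definition chain_state i c := [/\ (i <= c <= p)%N,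
  forall j, (i <= j <= p)%N -> ~ lt (th c) (th j),
  forall j, (c < j <= p)%N -> lt (th j) (th c) &
  forall C, admissible p q C ->
    (EF C `&` (cell C (tau c) (q (tau c)) `&` part_conds C i)) !=set0].

Lemma lt_of_nlt u (v w : Om) : lt u v -> ~ lt w v -> lt u w.
Proof.
move=> uv nwv; have [//|->//|vw] := olt_total w v.
exact: olt_trans uv vw.
Qed.

Lemma chain_start :
  (forall C, admissible p q C -> (EF C `&` cell C (tau p) (q (tau p))) !=set0) ->
  chain_state p p.
Proof.
move=> h; split.
- by rewrite leqnn.
- by move=> j /anti_leq->; apply: lt_irr; exact: olt_wf.
- by move=> j /andP[a b]; rewrite leqNgt a in b.
- move=> C aC; have [z [EFz cz]] := h C aC; exists z; split=> //; split=> //.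
  move=> j w /anti_leq <- _ Cz; have [_ dC _] := aC.
  suff : (C (Some w) (tau p) `&` cell C (tau p) (q (tau p))) z by rewrite dC ?size_tau //;
    apply: Tk_prefix Ts; apply: prefix_tau.
  by [].
Qed.

(** The node [tau c] is related to [s] at all the levels at which [tau i] is, so what [s] needs from
    [tau i] is already needed by [tau c]. *)
Lemma chain_keep i c : chain_state i.+1 c -> ~ lt (th c) (th i) -> chain_state i c.
Proof.
move=> [/andP[ic cp] hmax hrec hC] nlt; split=> //.
- by rewrite (ltnW ic).
- move=> j; rewrite leq_eqVlt => /andP[/orP[/eqP<-//|ij] jp]; apply: hmax.
  by rewrite ij.
- move=> C aC; have [z [EFz [cz pz]]] := hC C aC; exists z; split=> //; split=> //.
  move=> j w /andP[]; rewrite leq_eqVlt => /orP[/eqP<-|ij] jp nd; last first.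
    by apply: pz nd; rewrite ij.
  have [_ cnd _] := cz; apply: cnd.
  + by apply: prefix_tau2; rewrite (ltnW ic).
  + by apply: tau_neq; rewrite ic.
  have [r1 h1] := nd.
  have wi : lt (Some w) (th i) by apply/olt_levelP => //; apply: prefix_tau.
  have rc : rels (Some w) (tau c) s.
    by apply/olt_levelP; [apply: prefix_tau|apply: lt_of_nlt wi nlt].
  split; first by apply: rels_linear r1 rc; apply: prefix_tau2; rewrite (ltnW ic).
  move=> r pr nr rpc hr; apply: h1 => //; first exact: prefix_trans rpc (prefix_tau c).
  by right; case: hr => [->//|hr]; apply: rels_trans hr rc.
Qed.

(** Let [v] be the level of [tau c]. The cell of [tau c] avoids [C (Some v) (tau i)], while the
    remaining conditions have class below [v]. If no point were left in the cell of [tau i], a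
    rectangle cut down by these conditions could be added to [C (Some v) (tau i)], and the cell of
    [tau c] would be exhausted in turn. *)
Lemma chain_move i c : chain_state i.+1 c -> lt (th c) (th i) -> chain_state i i.
Proof.
move=> [/andP[ic cp] hmax hrec hC] cti.
have ip : (i <= p)%N by apply: leq_trans cp; apply: ltnW.
have lti j : (i < j <= p)%N -> lt (th j) (th i).
  move=> ij; have [//|e|ij'] := olt_total (th j) (th i).
    by exfalso; apply: (hmax j ij); rewrite e.
  by exfalso; apply: (hmax j ij); apply: olt_trans ij'.
split=> //; first by rewrite leqnn.
  move=> j; rewrite leq_eqVlt => /andP[/orP[/eqP<-|ij] jp].
    by apply: lt_irr; exact: olt_wf.
  move=> ij'; have ji : lt (th j) (th i) by apply: lti; rewrite ij.
  by apply: (lt_irr (@olt_wf xi)); apply: olt_trans ji ij'.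
case e : (th c) => [v|] in cti; last by [].
have [rc nc] := levelP (prefix_tau c); rewrite -/(th c) e in rc nc.
case: nc => // nc.
have ri : rels (Some v) (tau i) s by apply/olt_levelP => //; apply: prefix_tau.
have pic : prefix (tau i) (tau c) by apply: prefix_tau2; rewrite (ltnW ic).
(* By definition of its level, [tau c] fails the condition of level [v] towards [s]. A node [r] in
   between satisfying it would have a level above that of [tau c], against maximality; its failure
   puts [v] in [Th r]. *)
have ndv : need (tau i) (tau c) v.
  split.
    by split; [apply: rel_linear rc => //; have [] := ri|apply: club rc _; have [] := ri].
  move=> r pr nr rpc hr; have [k /andP[ik kc] er] := prefix_between ip cp pr nr rpc.
  apply: (@cond_fin _ _ s) => cr; case: hr => [erc|hr]; first by apply: nc; rewrite -erc.
  have kp : (k <= p)%N := leq_trans kc cp.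
  apply: (hmax k); first by rewrite ik.
  rewrite e /th -er; apply/olt_levelP; first by rewrite er; apply: prefix_tau.
  by split=> //; apply: rel_trans rc; have [] := hr.
move=> C aC; have [_ dC _] := aC.
have Tti : Tk (tau i) by apply: Tk_prefix Ts; apply: prefix_tau.
suff [z [EFz [cz pz]]] : (EF C `&` (part_conds C i.+1 `&` cell C (tau i) (q (tau i)))) !=set0.
  exists z; split=> //; split=> // j w; rewrite leq_eqVlt => /andP[/orP[/eqP<-|ij] jp] nd.
    move=> Cz; suff : (C (Some w) (tau i) `&` cell C (tau i) (q (tau i))) z.
      by rewrite dC // size_tau.
    by [].
  by apply: cz nd; rewrite ij.
apply: contrapT => /set0P/negP; rewrite negbK => /eqP emp.
have sM : sigma_over (rect opX opY) (Some v) (part_conds C i.+1).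
  apply: sig_part_conds aC _ => j w ij [rj _].
  rewrite -e; apply: (@lt_of_nlt _ (th j)); last exact: hmax.
  by apply/olt_levelP => //; apply: prefix_tau.
have [C' [aC' CC' hC']] : exists C', [/\ admissible p q C', sys_le C C' &
    EF C `&` part_conds C i.+1 `<=` C' (Some v) (tau i)].
  by apply: (enlarge aC (aE aC) (aF aC) (ana_cell (tau i) (q (tau i)) aC) sM emp) => // _.
have [z [EFz [[_ cz _] pz]]] := hC C' aC'.
apply: (cz (tau i) v) => //; first by apply: tau_neq; rewrite ic.
by apply: hC'; split; [exact: EF_anti EFz|exact: part_conds_anti pz].
Qed.

(** The empty sequence precedes everything, so the largest level is [None] once 0 is reached, and
    the last position where it occurs is the predecessor of [s]. *)
Lemma chain_end :
  (forall C, admissible p q C -> (EF C `&` cell C (tau p) (q (tau p))) !=set0) ->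
  exists2 c, is_pred c s & forall C, admissible p q C ->
    (EF C `&` (cell C c (q c) `&` conds C s)) !=set0.
Proof.
move=> h.
have [c [/andP[_ cp] hmax hrec hC]] : exists c, chain_state 0 c.
  suff : forall k, (k <= p)%N -> exists c, chain_state (p - k) c.
    by move=> /(_ p (leqnn p)); rewrite subnn.
  elim=> [_|k IH kp]; first by rewrite subn0; exists p; apply: chain_start.
  have [c hc] := IH (ltnW kp).
  rewrite -(subnSK kp) in hc.
  have [l|nl] := pselect (lt (th c) (th (p - k.+1))).
    by exists (p - k.+1)%N; apply: chain_move hc l.
  by exists c; apply: chain_keep.
have th0 : th 0 = None.
  have [_ [//|nc]] := levelP (prefix_tau 0); rewrite -/(th 0) in nc *.
  case e : (th 0) => [v|//] in nc *; exfalso; apply: nc.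
  rewrite /tau take0.
  by have /relE[_] := rel_nil None s; apply.
have thc : th c = None.
  case e : (th c) => [v|//]; exfalso; apply: (hmax 0) => //.
  by rewrite e th0.
exists (tau c).
  split; first exact: prefix_tau.
  - by rewrite size_tau // szs ltnS.
  - by have [] := levelP (prefix_tau c); rewrite -/(th c) thc.
  - move=> t pt /andP[ct ts] rt.
    have et : t = tau (size t) by move: pt; rewrite prefixE => /eqP.
    rewrite size_tau // in ct; rewrite szs ltnS in ts.
    have := hrec (size t); rewrite ct ts => /(_ isT); rewrite /th -et.
    have [_] := levelP pt; case: (level t s) => [v|//] [//|nc] _.
    by apply: nc; move/relE: rt => [_]; apply.
move=> C aC; have [z [EFz [cz pz]]] := hC C aC; exists z; split=> //; split=> //.
move=> t w pt nt nd; have et : t = tau (size t) by move: pt; rewrite prefixE => /eqP.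
rewrite et; apply: pz; last by rewrite -et.
rewrite /= -ltnS -szs ltn_neqAle size_prefix // andbT; apply/eqP => e.
by apply: nt; rewrite et e /tau take_size.
Qed.

(** When the label appears at [s], one more jump is made at the top level, with [A] in the role of
    the cell: the points found so far avoid [C None [::]] because [c] is unlabelled. *)
Lemma edge_step c : is_pred c s ->
  (forall C, admissible p q C -> (EF C `&` cell C (tau p) (q (tau p))) !=set0) ->
  forall C, admissible p q C -> (EF C `&` cell C s (base q c s)) !=set0.
Proof.
move=> pc /chain_end[c' pc' hC].
have ec : c' = c.
  have [p1 z1 r1 m1] := pc; have [p2 z2 r2 m2] := pc'.
  suff e : size c' = size c.
    by rewrite (prefix_take_eq p2) e -(prefix_take_eq p1).
  apply/eqP; rewrite eqn_leq; apply/andP; split; rewrite leqNgt; apply/negP => l.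
    by apply: (m1 c') => //; rewrite l.
  by apply: (m2 c) => //; rewrite l.
rewrite {}ec {pc' c'} in hC; have [pcs zc rc _] := pc.
rewrite /base; case: ifP => [/asboolP[Ls nLc]|/asboolP nL] C aC; last first.
  have [z [EFz [[iz cz nz] pz]]] := hC C aC; exists z; split=> //; split=> //.
    have -> : image_of s (q c) = image_of c (q c); last by [].
    rewrite /image_of; have [Lc|nLc] := pselect (Lab c).
      by rewrite !asboolT //; apply: Lab_up Lc.
    by rewrite !asboolF // => Ls; apply: nL.
  by move=> nLs; apply: nz => Lc; apply: nLs; apply: Lab_up Lc.
suff [z [EFz [cz Az]]] : (EF C `&` (conds C s `&` A)) !=set0.
  exists z; split=> //; split=> //; by rewrite /image_of asboolT // piece0.
apply: contrapT => /set0P/negP; rewrite negbK => /eqP emp.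
have condsE D : conds D s = part_conds D 0.
  apply/seteqP; split=> z hz.
    move=> j w jp; apply: hz; first exact: prefix_tau.
    by move=> /(congr1 size); rewrite size_tau // szs => e; rewrite e /= ltnn in jp.
  move=> t w pt nt nd; have et : t = tau (size t) by move: pt; rewrite prefixE => /eqP.
  rewrite et; apply: hz; last by rewrite -et.
  rewrite /= -ltnS -szs ltn_neqAle size_prefix // andbT; apply/eqP => e.
  by apply: nt; rewrite et e /tau take_size.
have sM : sigma_over (rect opX opY) (None : Om) (conds C s).
  by rewrite condsE; exact: (@sig_part_conds C 0 None aC (fun _ _ _ _ => I)).
have aA : ana (op2 opX opY) A by exists FA, gA.
have [C' [aC' CC' hC']] : exists C', [/\ admissible p q C', sys_le C C' &
    EF C `&` conds C s `<=` C' None [::]].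
  by apply: (enlarge aC (aE aC) (aF aC) aA sM emp) => [_ _|[]].
have [z [EFz [[_ _ nz] cz]]] := hC C' aC'.
apply: (nz nLc); apply: hC'; split; first exact: EF_anti EFz.
by move=> t w pt nt nd Cz; apply: (cz t w) => //; apply: CC'.
Qed.

End edge.

Lemma ex_pred s : (0 < size s)%N -> exists c, is_pred c s.
Proof.
move=> s0; pose P n := (n < size s)%N && `[< rel None (take n s) s >].
have exP : exists n, P n.
  by exists 0; rewrite /P s0 /=; apply/asboolP; rewrite take0; apply: rel_nil.
have ubP n : P n -> (n <= size s)%N by move=> /andP[/ltnW].
have [n /andP[ns /asboolP rn] nmax] := ex_maxnP exP ubP.
have szn : size (take n s) = n by rewrite size_takel // ltnW.
exists (take n s); split; rewrite ?szn //; first exact: prefix_take.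
move=> t pt /andP[nt ts] rt; have et : take (size t) s = t by move: pt; rewrite prefixE => /eqP.
have := nmax (size t); rewrite /P ts et asboolT // => /(_ isT).
by rewrite leqNgt nt.
Qed.

Variables (FX FY : set baire) (gX : baire -> X) (gY : baire -> Y).
Hypothesis cFX : bclosed FX.
Hypothesis cFY : bclosed FY.
Hypothesis cgX : bcont opX FX gX.
Hypothesis cgY : bcont opY FY gY.
Hypothesis surjX : forall x, (gX @` FX) x.
Hypothesis surjY : forall y, (gY @` FY) y.

Definition edge_rel p (s t : p.-tuple bool) := Tk (zip s t).

Hypothesis edge_irr : forall p (s : p.+1.-tuple bool), ~ edge_rel s s.
Hypothesis edge_acyclic : forall p,
  rel_acyclic (fun s t : p.+1.-tuple bool => edge_rel s t \/ edge_rel t s).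

Let state := ((seq K -> seq nat) * (seq bool -> seq nat) * (seq bool -> seq nat))%type.

(** The codes are fixed before [C] is chosen: this uniformity is what survives from one level to the
    next. *)
Definition good p (st : state) := forall C, admissible p st.1.1 C ->
  exists c : (p.-tuple bool -> X) * (p.-tuple bool -> Y),
    conf_sat (fun v : p.-tuple bool => piece FX gX (st.1.2 v)) (fun v : p.-tuple bool => piece FY gY (st.2 v))
      (@edge_rel p) (fun s t => cell C (zip s t) (st.1.1 (zip s t))) c.

Definition extends (f f' : seq bool -> seq nat) p :=
  (forall s, (size s <= p)%N -> f' s = f s) /\
  (forall s, size s = p.+1 -> exists j, f' s = rcons (f (take p s)) j).

Lemma trunc_subproof p (v : p.+1.-tuple bool) : size (take p v) == p.
Proof. by rewrite size_takel // size_tuple. Qed.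

Definition trunc p (v : p.+1.-tuple bool) : p.-tuple bool := Tuple (trunc_subproof v).

Lemma take_zip_trunc p (s t : p.+1.-tuple bool) :
  take p (zip s t) = zip (trunc s) (trunc t).
Proof.
rewrite /=; move: (val s) (val t) => {}s {}t; elim: p s t => [|p IH] [|x s] [|y t] //=;
  by rewrite ?take0 ?IH //; case: (take _ _).
Qed.

(** * Passing from one level of the tree to the next *)

Section level.
Variables (p : nat) (q : seq K -> seq nat) (rX rY : seq bool -> seq nat).
Variable pr : seq K -> seq K.
Hypothesis prP : forall s, (0 < size s)%N -> is_pred (pr s) s.
Let V := p.+1.-tuple bool.

Let LX (v : V) := piece FX gX (rX (take p v)).
Let LY (v : V) := piece FY gY (rY (take p v)).
Let Mnew (C : sys) (s t : V) := cell C (zip s t) (base q (pr (zip s t)) (zip s t)).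
Let Mold (C : sys) (s t : V) := cell C (take p (zip s t)) (q (take p (zip s t))).
Let Mix (l : seq (V * V)) C s t := if (s, t) \in l then Mnew C s t else Mold C s t.

Lemma Mix_anti l C C' s t : sys_le C C' -> Mix l C' s t `<=` Mix l C s t.
Proof. by move=> CC; rewrite /Mix; case: ifP => _; apply: cell_anti. Qed.

Lemma ana_Mix l C s t : admissible p q C -> ana (op2 opX opY) (Mix l C s t).
Proof. by move=> aC; rewrite /Mix; case: ifP => _; apply: ana_cell aC. Qed.

Lemma conf_sat_sub (M M' : V -> V -> set (X * Y)) c :
  (forall s t, edge_rel s t -> M s t `<=` M' s t) ->
  conf_sat LX LY (@edge_rel p.+1) M c -> conf_sat LX LY (@edge_rel p.+1) M' c.
Proof. by move=> sub [hx hy h]; split=> // s t Tst; apply: sub => //; apply: h. Qed.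

(** Initially each vertex copies the points of its truncation, so every edge satisfies the
    constraint of the shorter edge. Edges are then upgraded one by one: [conf_edge] turns the
    existence of a configuration into the meeting of a rectangle with a cell, and [edge_step]
    replaces that cell. *)
Lemma level_edges (l : seq (V * V)) : good p (q, rX, rY) ->
  forall C, admissible p q C -> exists c, conf_sat LX LY (@edge_rel p.+1) (Mix l C) c.
Proof.
move=> gd; elim: l => [|[s0 t0] l IH] C aC.
  have [[x y] [hx hy h]] := gd C aC.
  exists (fun v => x (trunc v), fun v => y (trunc v)); split=> [v|v|s t Tst] /=.
  - exact: (hx (trunc v)).
  - exact: (hy (trunc v)).
  - rewrite /Mix /= /Mold take_zip_trunc; apply: h.
    rewrite /edge_rel -take_zip_trunc; apply: Tk_prefix Tst.
    exact: prefix_take.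
have mixS C' s t : Mix ((s0, t0) :: l) C' s t =
    if (s, t) == (s0, t0) then Mnew C' s0 t0 else Mix l C' s t.
  by rewrite /Mix inE; case: eqP => [[-> ->]|].
have [triv|] := pselect ((s0, t0) \in l \/ ~ edge_rel s0 t0).
  have [c hc] := IH C aC; exists c; apply: conf_sat_sub hc => s t Tst z.
  rewrite mixS; case: eqP => [[e1 e2]|//]; subst s t.
  by case: triv => // h; rewrite /Mix h.
move=> /not_orP[/negP nl /contrapT T0].
pose M0 C' s t := if (s, t) == (s0, t0) then setT else Mix l C' s t.
pose E C' := (fun c => c.1 s0) @` conf_sat LX LY (@edge_rel p.+1) (M0 C').
pose F C' := (fun c => c.2 t0) @` conf_sat LX LY (@edge_rel p.+1) (M0 C').
have aLX v : ana opX (LX v) by apply: ana_piece.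
have aLY v : ana opY (LY v) by apply: ana_piece.
have CE C' (aC' : admissible p q C') := conf_edge sX sY aX aY aLX aLY (M := Mix l C')
  (@edge_irr p) (@edge_acyclic p) T0 (fun s t _ => ana_Mix l s t aC').
have M0_anti C1 C2 c : sys_le C1 C2 -> conf_sat LX LY (@edge_rel p.+1) (M0 C2) c ->
    conf_sat LX LY (@edge_rel p.+1) (M0 C1) c.
  move=> CC; apply: conf_sat_sub => s t _; rewrite /M0; case: ifP => // _.
  exact: Mix_anti.
have szz : size (zip s0 t0) = p.+1 by rewrite size_zip !size_tuple minnn.
have := @edge_step p q (zip s0 t0) T0 szz E F.
move=> /(_ _ _ _ _ (pr (zip s0 t0)) _ _ C aC) [].
- by move=> C' aC'; have [] := CE C' aC'.
- by move=> C' aC'; have [] := CE C' aC'.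
- by move=> C1 C2 CC _ [c hc <-]; exists c => //; apply: M0_anti hc.
- by move=> C1 C2 CC _ [c hc <-]; exists c => //; apply: M0_anti hc.
- by apply: prP; rewrite szz.
- move=> C' aC'; have [_ _ h] := CE C' aC'; apply/h.
  have [c hc] := IH C' aC'; exists c; apply: conf_sat_sub hc => s t Tst z.
  by case: eqP => [[-> ->]|//]; rewrite /Mix (negbTE nl).
- move=> z hz; have [_ _ h] := CE C aC.
  have [|c hc] := (h (Mnew C s0 t0)).1; first by exists z.
  exists c; apply: conf_sat_sub hc => s t Tst; by rewrite mixS.
Qed.

Let dflt : V := nseq_tuple p.+1 false.
Let tup (s : seq bool) : V := insubd dflt s.
(** One new digit for every vertex and every pair of vertices. There are countably many choices, as
    required for taking a union over all of them. *)
Let J := ({ffun V -> nat} * {ffun V -> nat} * {ffun V * V -> nat})%type.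

Let q' (i : J) (s : seq K) := if size s == p.+1 then
  rcons (base q (pr s) s) (i.2 (tup (unzip1 s), tup (unzip2 s))) else q s.
Let rX' (i : J) (s : seq bool) :=
  if size s == p.+1 then rcons (rX (take p s)) (i.1.1 (tup s)) else rX s.
Let rY' (i : J) (s : seq bool) :=
  if size s == p.+1 then rcons (rY (take p s)) (i.1.2 (tup s)) else rY s.

Lemma tupK (v : V) : tup v = v.
Proof. by apply: val_inj; rewrite /tup val_insubd size_tuple eqxx. Qed.

(** If each choice of digits [i] were refuted by some family [D i], the union of all these families
    would still have a configuration for the undigitized codes. The digits read off from it form a
    choice that its own family cannot refute. *)
Lemma level_step : good p (q, rX, rY) -> exists i : J, good p.+1 (q' i, rX' i, rY' i).
Proof.
move=> gd; apply: contrapT => /forallNP no.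
have q'E i s : (size s <= p)%N -> q' i s = q s.
  by move=> sp; rewrite /q'; case: eqP => // e; rewrite e ltnn in sp.
(* Families refuting different choices are admissible for different codes; admissibility for the old
   codes is what they share. *)
have admW i C : admissible p.+1 (q' i) C -> admissible p q C.
  move=> [h1 h2 h3]; split=> // w t tp Tt.
  by rewrite -(q'E i t tp); apply: h2 => //; apply: leqW.
have /choice[D hD] : forall i : J, exists C, admissible p.+1 (q' i) C /\
    ~ exists c : (V -> X) * (V -> Y),
      conf_sat (fun v : V => piece FX gX (rX' i v)) (fun v : V => piece FY gY (rY' i v))
        (@edge_rel p.+1) (fun s t => cell C (zip s t) (q' i (zip s t))) c.
  move=> i; apply: contrapT => /forallNP h; apply: (no i) => C aC.
  by apply: contrapT => nc; apply: (h C).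
pose Dn n : sys := if unpickle n is Some i then D i else fun _ _ => set0.
have aDn n : admissible p q (Dn n).
  rewrite /Dn; case: unpickle => [i|]; last exact: admissible0.
  by apply: (admW i); have [] := hD i.
have [c [hx hy hc]] := level_edges (enum {: V * V}) gd (admissible_bigcup aDn).
have /choice[jx hjx] := fun v => piece_rcons (hx v).
have /choice[jy hjy] := fun v => piece_rcons (hy v).
have /choice[je hje] : forall st : V * V, exists j, edge_rel st.1 st.2 ->
    image_of (zip st.1 st.2) (rcons (base q (pr (zip st.1 st.2)) (zip st.1 st.2)) j)
      (c.1 st.1, c.2 st.2).
  move=> [s t] /=; have [Tst|nT] := pselect (edge_rel s t); last by exists 0.
  have := hc s t Tst; rewrite /Mix mem_enum inE /= => -[+ _ _].
  rewrite /image_of; case: ifP => _ hp; have [j hj] := piece_rcons hp; by exists j.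
pose i : J := ([ffun v => jx v], [ffun v => jy v], [ffun st => je st]).
have [_] := hD i; apply; exists c; split=> [v|v|s t Tst].
- by rewrite /rX' size_tuple eqxx tupK ffunE; apply: hjx.
- by rewrite /rY' size_tuple eqxx tupK ffunE; apply: hjy.
- have := hc s t Tst; rewrite /Mix mem_enum inE /= => hM.
  have {hM}[_ cz nz] : cell (D i) (zip s t) (base q (pr (zip s t)) (zip s t)) (c.1 s, c.2 t).
    apply: cell_anti hM => u w z Dz; exists (pickle i) => //.
    by rewrite /Dn pickleK.
  split=> //; rewrite /q' size_zip !size_tuple minnn eqxx ffunE.
  by rewrite unzip1_zip ?unzip2_zip ?size_tuple // !tupK; apply: (hje (s, t)).
Qed.

Lemma level_step_extends : good p (q, rX, rY) -> exists st : state, [/\ good p.+1 st,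
  forall s, (size s <= p)%N -> st.1.1 s = q s,
  forall s, size s = p.+1 -> exists j, st.1.1 s = rcons (base q (pr s) s) j,
  extends rX st.1.2 p & extends rY st.2 p].
Proof.
move=> /level_step[i gi]; exists (q' i, rX' i, rY' i); split=> //=.
- by move=> s sp; rewrite /q'; case: eqP => // e; rewrite e ltnn in sp.
- by move=> s e; rewrite /q' e eqxx; eexists.
- split=> s sp; last by rewrite /rX' sp eqxx; eexists.
  by rewrite /rX'; case: eqP => // e; rewrite e ltnn in sp.
- split=> s sp; last by rewrite /rY' sp eqxx; eexists.
  by rewrite /rY'; case: eqP => // e; rewrite e ltnn in sp.
Qed.

End level.

Hypothesis not_separated : forall D, sigma_over (rect opX opY) (None : Om) D ->
  D `&` A = set0 -> ~ (B `<=` D).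

(** The only edge at level 0 is the empty one, and [C None [::]] is a candidate for covering [B]
    while missing [A]; a point of [B] outside it gives the configuration. *)
Lemma good0 : good 0 (fun=> [::], fun=> [::], fun=> [::]).
Proof.
move=> C [sC _ CA].
have [[x y] [Bz nC]] : exists z, B z /\ ~ C None [::] z.
  apply: contrapT => /forallNP h; apply: (not_separated (sC None [::]) CA) => z Bz.
  by apply: contrapT => nC; apply: (h z).
have [xF yF] : (gX @` FX) x /\ (gY @` FY) y by split; [exact: surjX|exact: surjY].
exists (fun=> x, fun=> y); split=> [v|v|s t Tst] /=; rewrite ?piece0 //.
have -> : zip s t = [::] by apply/size0nil; rewrite size_zip !size_tuple.
split=> //; first by rewrite /image_of asboolF // piece0.
by move=> r w; rewrite prefixs0 => /eqP e ne; exfalso; apply: ne.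
Qed.

Lemma ex_construction : exists (q : seq K -> seq nat) (rX rY : seq bool -> seq nat),
  [/\ forall s, (0 < size s)%N -> exists c j, is_pred c s /\ q s = rcons (base q c s) j,
      rX [::] = [::] /\ rY [::] = [::],
      forall s b, exists j, rX (rcons s b) = rcons (rX s) j,
      forall s b, exists j, rY (rcons s b) = rcons (rY s) j &
      forall p, exists c : (p.-tuple bool -> X) * (p.-tuple bool -> Y),
        [/\ forall v : p.-tuple bool, piece FX gX (rX v) (c.1 v),
            forall v : p.-tuple bool, piece FY gY (rY v) (c.2 v)
          & forall s t : p.-tuple bool,
            Tk (zip s t) -> image_of (zip s t) (q (zip s t)) (c.1 s, c.2 t)]].
Proof.
have /choice[pr prP] : forall s, exists c, (0 < size s)%N -> is_pred c s.
  move=> s; have [s0|/ex_pred[c hc]] := posnP (size s); last by exists c.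
  by exists [::]; rewrite ?s0.
have step n st : good n st -> exists st', good n.+1 st' /\
   [/\ forall s, (size s <= n)%N -> st'.1.1 s = st.1.1 s,
  forall s, size s = n.+1 -> exists j, st'.1.1 s = rcons (base st.1.1 (pr s) s) j,
  extends st.1.2 st'.1.2 n & extends st.2 st'.2 n].
  move=> gd; case: st gd => [[q rX] rY] gd.
  by have [st' [h1 h2 h3 h4 h5]] := level_step_extends prP gd; exists st'.
have [f [f0 gf fS]] := dependent_choice (P := good) good0 step.
have stab (T U : Type) (h : state -> seq T -> U) :
    (forall n s, (size s <= n)%N -> h (f n.+1) s = h (f n) s) ->
    forall n s, (size s <= n)%N -> h (f n) s = h (f (size s)) s.
  move=> hh n s; elim: n => [|n IH]; first by rewrite leqn0 => /eqP->.
  by rewrite leq_eqVlt => /orP[/eqP<-//|sn]; rewrite hh // IH.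
have sq := stab _ _ (fun st => st.1.1) (fun n => let: And4 a _ _ _ := fS n in a).
have sx := stab _ _ (fun st => st.1.2) (fun n => let: And4 _ _ a _ := fS n in a.1).
have sy := stab _ _ (fun st => st.2) (fun n => let: And4 _ _ _ a := fS n in a.1).
exists (fun s => (f (size s)).1.1 s), (fun s => (f (size s)).1.2 s),
  (fun s => (f (size s)).2 s); split.
- move=> s s0; exists (pr s); have ps := prP s s0.
  have [_ h _ _] := fS (size s).-1.
  have [j hj] := h s (esym (prednK s0)); exists j; split=> //.
  rewrite -{1}(prednK s0) hj; congr rcons; rewrite /base; case: ifP => // _.
  by apply: sq; have [_ szp _ _] := ps; rewrite -ltnS prednK.
- by rewrite f0.
- move=> s b; have [_ _ [_ h] _] := fS (size s).
  have [j hj] := h (rcons s b) (size_rcons _ _); exists j.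
  have e : take (size s) (rcons s b) = s by rewrite -cats1 take_size_cat.
  by rewrite size_rcons hj e.
- move=> s b; have [_ _ _ [_ h]] := fS (size s).
  have [j hj] := h (rcons s b) (size_rcons _ _); exists j.
  have e : take (size s) (rcons s b) = s by rewrite -cats1 take_size_cat.
  by rewrite size_rcons hj e.
(* The empty family suffices to extract points. Those of different levels need not agree; only their
   codes cohere. *)
- move=> p; have [c [hx hy hc]] := gf p _ (@admissible0 p (f p).1.1); exists c; split.
  + by move=> v; have := hx v; rewrite size_tuple.
  + by move=> v; have := hy v; rewrite size_tuple.
  + move=> s t Tst; have [] := hc s t Tst.
    by rewrite size_zip !size_tuple minnn.
Qed.

End construction.

Local Open Scope ring_scope.

(** * The Cantor space *)

Lemma cantor_nbhs_cylinder (a : cantor_space) n :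
  nbhs a [set c : cantor_space | forall i, (i < n)%N -> c i = a i].
Proof.
elim: n => [|n IH]; first by apply: filterS filterT => c _ i.
have h : nbhs a [set c : cantor_space | c n = a n].
  have := @proj_continuous nat (fun=> bool) n a [set a n].
  by apply; apply: discrete_set1.
apply: filterS (filterI IH h) => c [h1 h2] i; rewrite ltnS leq_eqVlt => /orP[/eqP->//|].
exact: h1.
Qed.

Lemma cantor_open_cylinder (U : set cantor_space) (a : cantor_space) : open U -> U a ->
  exists n, forall c : cantor_space, (forall i, (i < n)%N -> c i = a i) -> U c.
Proof.
move=> oU Ua.
pose F : set_system cantor_space := [set W | exists n, forall c : cantor_space,
  (forall i, (i < n)%N -> c i = a i) -> W c].
have FF : Filter F.
  split; first by exists 0%N.
    move=> P Q [n hn] [m hm]; exists (maxn n m) => c h; split.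
      by apply: hn => i im; apply: h; rewrite leq_max im.
    by apply: hm => i im; apply: h; rewrite leq_max im orbT.
  by move=> P Q PQ [n hn]; exists n => c /hn; apply: PQ.
have : F --> a.
  apply/cvg_sup => i W [V [[V0 oV0 <-] Va VW]].
  exists i.+1 => c hc; apply: VW; rewrite /preimage /=.
  by rewrite /proj hc.
by apply; apply: open_nbhs_nbhs.
Qed.

Section cantor_metric.
Variable R : realType.

Definition cantor_dist (a b : cantor_space) : R :=
  if pselect (exists n, a n != b n) is left h then einv R (ex_minn h) else 0.

Lemma cantor_dist_ge a b n : a n <> b n -> einv R n <= cantor_dist a b.
Proof.
move=> ab; rewrite /cantor_dist; case: pselect => [h|nh]; last first.
  by exfalso; apply: nh; exists n; apply/eqP.
by apply: inv_le; case: ex_minnP => m _; apply; apply/eqP.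
Qed.

Lemma cantor_dist_lt a b n :
  (forall i, (i <= n)%N -> a i = b i) -> cantor_dist a b < einv R n.
Proof.
move=> ab; rewrite /cantor_dist; case: pselect => [h|nh]; last exact: inv_gt0.
case: ex_minnP => m hm _; have nm : (n < m)%N.
  by rewrite ltnNge; apply: contra hm => mn; rewrite ab.
by rewrite /einv ltf_pV2 ?posrE ?ltr0n // ltr_nat ltnS.
Qed.

Lemma cantor_dist_agree a b n : cantor_dist a b < einv R n ->
  forall i, (i <= n)%N -> a i = b i.
Proof.
move=> h i im; apply: contrapT => /cantor_dist_ge h'.
by have := le_lt_trans h' h; rewrite ltNge inv_le.
Qed.

Lemma cantor_dist_cases a b : a = b \/ exists2 n, a n <> b n & cantor_dist a b = einv R n.
Proof.
rewrite /cantor_dist; case: pselect => [h|nh]; [right|left].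
  by case: ex_minnP => m /eqP hm _; exists m.
apply/funext => n; apply: contrapT => ab; apply: nh; exists n; exact/eqP.
Qed.

Lemma cantor_dist0 a : cantor_dist a a = 0.
Proof. by rewrite /cantor_dist; case: pselect => // h; have [n] := h; rewrite eqxx. Qed.

Lemma cantor_dist_small e : 0 < e -> exists n, forall a b : cantor_space,
  (forall i, (i <= n)%N -> a i = b i) -> cantor_dist a b < e.
Proof.
move=> /inv_small[n hn]; exists n => a b /cantor_dist_lt h; exact: lt_trans hn.
Qed.

Lemma cantor_polish_metric : polish_metric cantor_dist.
Proof.
have ge0 a b : 0 <= cantor_dist a b.
  by have [->|[n _ ->]] := cantor_dist_cases a b; rewrite ?cantor_dist0 // ltW // inv_gt0.
split.
- split=> //.
  + move=> a b; split=> [|->]; last exact: cantor_dist0.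
    have [//|[n _ ->] e] := cantor_dist_cases a b.
    by have := inv_gt0 R n; rewrite e ltxx.
  + move=> a b; apply/eqP; rewrite eq_le; apply/andP; split.
      have [->//|[n ab ->]] := cantor_dist_cases a b; apply: cantor_dist_ge.
      by move=> ba; apply: ab.
    have [->//|[n ab ->]] := cantor_dist_cases b a; apply: cantor_dist_ge.
    by move=> ba; apply: ab.
  + move=> a b c; have [->|[n ac ->]] := cantor_dist_cases a c.
      by rewrite cantor_dist0 in ge0 *; apply: addr_ge0.
    have [e|ne] := pselect (a n = b n).
      apply: (@le_trans _ _ (cantor_dist b c)); last by rewrite lerDr.
      by apply: cantor_dist_ge; rewrite -e.
    by apply: (@le_trans _ _ (cantor_dist a b)); [exact: cantor_dist_ge|rewrite lerDl].
- move=> u cu.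
  have /choice[N hN] := fun n => cu (einv R n) (inv_gt0 R n).
  exists (fun n => u (N n) n : bool) => e e0; have [n hn] := cantor_dist_small e0.
  exists (\max_(i < n.+1) N i)%N => m hm; apply: hn => i im.
  have Nm : (N i <= m)%N by apply: leq_trans hm; apply: (leq_bigmax (Ordinal (im : (i < n.+1)%N))).
  exact: (cantor_dist_agree (hN i m (N i) Nm (leqnn _)) (leqnn i)).
- apply: (@csepI _ (seq bool) _ _ (fun s => [set a : cantor_space | mkseq a (size s) = s])).
  move=> a e /cantor_dist_small[n hn]; exists (mkseq a n.+1); split.
    by rewrite /mkset size_mkseq.
  move=> b; rewrite /mkset size_mkseq => hb; apply: hn => i im.
  by have := congr1 (fun s => nth false s i) hb; rewrite !nth_mkseq.
Qed.

Lemma cantor_openP (U : set cantor_space) : open U <-> metric_open cantor_dist U.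
Proof.
split=> [oU a Ua|oU].
  have [n hn] := cantor_open_cylinder oU Ua; exists (einv R n); first exact: inv_gt0.
  by move=> b /= /cantor_dist_agree h; apply: hn => i im; rewrite h // ltnW.
rewrite openE => a Ua; have [e e0 he] := oU a Ua.
have [n hn] := cantor_dist_small e0.
apply: filterS (cantor_nbhs_cylinder a n.+1) => b hb; apply: he => /=.
by apply: hn => i im; rewrite hb.
Qed.

End cantor_metric.

Lemma mkseq_take (U : Type) (a : nat -> U) n m : (n <= m)%N -> take n (mkseq a m) = mkseq a n.
Proof. by move=> nm; rewrite /mkseq -map_take take_iota (minn_idPl nm). Qed.

Lemma closed_branches T (a b : cantor_space) : ~ branches T (a, b) ->
  exists n, forall a' b' : cantor_space, (forall i, (i < n)%N -> a' i = a i) ->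
    (forall i, (i < n)%N -> b' i = b i) -> ~ branches T (a', b').
Proof.
move=> /existsNP[n nT]; exists n => a' b' ha hb /(_ n) h; apply: nT.
have e (c c' : cantor_space) : (forall i, (i < n)%N -> c' i = c i) -> mkseq c' n = mkseq c n.
  by move=> h'; apply/eq_in_map => i; rewrite mem_iota => /h'.
by move: h; rewrite /= (e a a') // (e b b').
Qed.

(** * The two alternatives exclude each other *)

Section exclusion.
Variable R : realType.

Lemma metric_hausdorff_base (X : Type) (d : X -> X -> R) : is_metric d ->
  hausdorff_base (metric_open d).
Proof.
move=> md x y ne; have [d0 dE dC dT] := md.
have dxy : 0 < d x y by rewrite lt_neqAle d0 andbT; apply/eqP => e; apply: ne; apply/dE.
exists [set z | d x z < d x y / 2], [set z | d y z < d x y / 2]; split.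
- exact: metric_open_ball.
- exact: metric_open_ball.
- by rewrite /= (dE x x).2 //; lra.
- by rewrite /= (dE y y).2 //; lra.
- by rewrite -subset0 => z [/= a b]; have := dT x z y; rewrite (dC z y); lra.
Qed.

(** [V n] is the open neighbourhood of radius [1/(n+1)] of the complement of [U]. *)
Lemma prod_mopen_Fsigma (X Y : topologicalType) (d : X -> X -> R) (d' : Y -> Y -> R) U :
  is_metric d -> is_metric d' -> prod_mopen d d' U ->
  exists2 V : nat -> set (X * Y), (forall n, prod_mopen d d' (V n)) & U = \bigcup_n ~` V n.
Proof.
move=> [d0 dE dC dT] [d'0 d'E d'C d'T] oU.
exists (fun n => [set z | exists w, [/\ ~ U w, d z.1 w.1 < einv R n & d' z.2 w.2 < einv R n]]).
  move=> n x y [[a b] [nU /= xa yb]].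
  exists (Num.min (einv R n - d x a) (einv R n - d' y b)).
    by rewrite lt_min !subr_gt0 xa.
  move=> x' y'; rewrite !lt_min => /andP[xx _] /andP[_ yy]; exists (a, b); split=> //=.
    by have := dT x' x a; rewrite (dC x' x); lra.
  by have := d'T y' y b; rewrite (d'C y' y); lra.
apply/seteqP; split=> [[x y] Uxy|[x y] [n _ nV]].
  have [e e0 he] := oU x y Uxy; have [n hn] := inv_small e0; exists n => // -[[a b] [nU /= xa yb]].
  by apply: nU; apply: he; [exact: lt_trans hn|exact: lt_trans hn].
apply: contrapT => nU; apply: nV; exists (x, y); split=> //=.
  by rewrite (dE x x).2 //; apply: inv_gt0.
by rewrite (d'E y y).2 //; apply: inv_gt0.
Qed.

(** A limit for the finer topology is a limit for the original one, where limits are unique and [u]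
    is continuous; hence the closed graph, whose metric makes [u] continuous into the finer
    topology. *)
Lemma pullback_metric (X : topologicalType) (sigma : Topological X) (u : cantor_space -> X) :
  polish R X -> finer_polish R sigma -> continuous u ->
  exists d : cantor_space -> cantor_space -> R, [/\ polish_metric d,
    refines (cantor_dist R) d & forall U, @open (Topological.Pack sigma) U ->
      metric_open d (u @^-1` U)].
Proof.
move=> pX [fin ps] cu.
have [dX [mX _ _] oX] := polish_has_metric pX.
have [ds pds os] := polish_has_metric ps.
have cg : closed_graph (cantor_dist R) ds u.
  move=> a m h; apply: contrapT => ne.
  have [U [V [oU oV Ua Vm UV]]] := metric_hausdorff_base mX ne.
  have [e e0 he] : exists2 e : R, 0 < e & forall b, cantor_dist R a b < e -> U (u b).
    have : open (u @^-1` U) by apply: open_comp => [x _|]; [exact: cu|apply/oX].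
    by move=> /(cantor_openP R)/(_ a Ua).
  have [f f0 hf] := (os V).1 (fin V ((oX V).2 oV)) m Vm.
  have [b [ab bm]] := h (Num.min e f) ltac:(by rewrite lt_min e0).
  have : (U `&` V) (u b).
    split; first by apply: he; apply: lt_le_trans ab _; rewrite ge_min lexx.
    apply: hf => /=; have [[_ _ dC _] _ _] := pds; rewrite dC.
    by apply: lt_le_trans bm _; rewrite ge_min lexx orbT.
  by rewrite UV.
have [p1 r1 h1] := polish_metric_graph (cantor_polish_metric R) pds cg.
set d := (fun x y => _) in p1 r1 h1; exists d; split=> // U /os oU a Ua.
have [e e0 he] := oU (u a) Ua; have [f f0 hf] := h1 a e e0.
by exists f => // b /hf; apply: he.
Qed.

Lemma reduction_potential T (xi : countable_ordinal) (A1 : set (cantor_space * cantor_space))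
    (X Y : topologicalType) (A B : set (X * Y)) :
  polish R X -> polish R Y -> A1 `<=` branches T ->
  separable_by_pot_Pi0_1p R xi A B -> continuous_reduction T A1 A B ->
  potentially_Pi0_1p R xi A1.
Proof.
move=> pX pY A1T [C [_ [sigma [tau [fs ft PiC]]] AC CB]] [u [v [cu cv hA hB]]].
have [d1 [p1 r1 h1]] := pullback_metric pX fs cu.
have [d2 [p2 r2 h2]] := pullback_metric pY ft cv.
have [m1 _ _] := p1; have [m2 _ _] := p2.
pose f (ab : cantor_space * cantor_space) := (u ab.1, v ab.2).
apply: (@sig_metrics_potential R xi _ _ (cantor_dist R) (cantor_dist R)
  (@cantor_openP R) (@cantor_openP R) d1 d2) => //.
have -> : ~` A1 = ~` branches T `|` f @^-1` (~` C).
  apply/seteqP; split=> [ab nA|ab [nT /A1T//|nC Aab]]; last by apply: nC; apply: AC; apply: hA.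
  have [Tab|nT] := pselect (branches T ab); last by left.
  right=> Cab; have Bab : B (f ab) by apply: hB.
  by have : (C `&` B) (f ab) by []; rewrite CB.
apply: sig_setU.
- move=> U hU x y [n _ Uxy]; have [e e0 he] := hU n x y Uxy.
  by exists e => // a b xa yb; exists n => //; apply: he.
- apply: sig_op; first by move=> U; apply: prod_mopen_Fsigma.
  apply: (prod_mopen_refines r1 r2) => a b /closed_branches[n hn].
  exists (einv R n); first exact: inv_gt0.
  move=> a' b' /cantor_dist_agree ha /cantor_dist_agree hb; apply: hn => i im.
    by rewrite ha // ltnW.
  by rewrite hb // ltnW.
- move/Sigma0_sig: PiC; apply: sig_preimage => W /prod_openP oW a b Wab.
  have [U [V [oU oV Ua Vb UV]]] := oW _ _ Wab.
  have [e e0 he] := h1 U oU a Ua; have [e' e'0 he'] := h2 V oV b Vb.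
  exists (Num.min e e'); first by rewrite lt_min e0.
  move=> a' b'; rewrite !lt_min => /andP[aa _] /andP[_ bb]; apply: UV.
  by split; [apply: he|apply: he'].
Qed.

End exclusion.

Local Close Scope ring_scope.

(** * Limits of the construction *)

(* A derivation of [sigma_over op o S], flattened into a tree of codes indexed by [seq nat]. *)
Lemma sig_codes (xi : countable_ordinal) (Z : Type) (op : set (set Z)) o S :
  sigma_over op (o : option (ord_carrier xi)) S ->
  exists (ord : seq nat -> option (ord_carrier xi)) (G : seq nat -> set Z) (leaf : set (seq nat)),
  [/\ ord [::] = o, G [::] = S, forall a, leaf a -> op (G a),
      forall a, ~ leaf a -> G a = \bigcup_i ~` G (rcons a i) &
      forall a i, ~ leaf a -> olt (ord (rcons a i)) (ord a)].
Proof.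
elim=> {o S} [v U _ oU|v w F b _ IH].
  by exists (fun=> v), (fun=> U), setT; split=> // a => [[]|i []].
have [ord /choice[G /choice[leaf h]]] := choice IH.
exists (fun a => if a is n :: c then ord n c else v),
  (fun a => if a is n :: c then G n c else \bigcup_n F n),
  (fun a => if a is n :: c then leaf n c else False); split=> //.
- by move=> [|n c] //; have [_ _ h' _ _] := h n; apply: h'.
- move=> [|n c] /=; last by have [_ _ _ h' _] := h n; apply: h'.
  by move=> _; apply: eq_bigcupr => n _; have [_ -> _ _ _] := h n; rewrite setCK.
- move=> [|n c] i /=; last by have [_ _ _ _ h'] := h n; apply: h'.
  by move=> _; have [-> _ _ _ _] := h i; apply: b.
Qed.

Lemma piece_limit Z (op : set (set Z)) F (g : baire -> Z) b U :
  bcont op F g -> F b -> op U -> U (g b) ->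
  exists n, forall q z, (n <= size q)%N -> inN q b -> piece F g q z -> U z.
Proof.
move=> cg Fb oU Ub; have [n hn] := cg b Fb U oU Ub; exists n => q _ nq qb [c [Fc qc] <-].
apply: hn => // i im; have iq := leq_trans im nq.
by rewrite qb // qc.
Qed.

Lemma piece_closed Z F (g : baire -> Z) b : bclosed F ->
  (forall n, exists q z, [/\ (n <= size q)%N, inN q b & piece F g q z]) -> F b.
Proof.
move=> cF h; apply: cF => n; have [q [z [nq qb [c [Fc qc] _]]]] := h n.
exists c => // i im; have iq := leq_trans im nq.
by rewrite qb // qc.
Qed.

(** * Continuous maps read off from the codes of the vertices *)

Section vertex_limit.
Variables (X : Type) (opX : set (set X)) (FX : set baire) (gX : baire -> X).
Hypothesis cFX : bclosed FX.
Hypothesis cgX : bcont opX FX gX.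
Variables (rX : seq bool -> seq nat) (x : nat -> seq bool -> X).
Hypothesis rX0 : rX [::] = [::].
Hypothesis rXS : forall s b, exists j, rX (rcons s b) = rcons (rX s) j.
Hypothesis xP : forall p s, size s = p -> piece FX gX (rX s) (x p s).

Definition vertex_code (a : nat -> bool) : baire := fun n => nth 0%N (rX (mkseq a n.+1)) n.

Lemma mkseq_rcons (U : Type) (a : nat -> U) n : mkseq a n.+1 = rcons (mkseq a n) (a n).
Proof. by rewrite /mkseq -{1}addn1 iotaD map_cat /= add0n cats1. Qed.

Lemma vertex_code_inN a n : size (rX (mkseq a n)) = n /\ inN (rX (mkseq a n)) (vertex_code a).
Proof.
elim: n => [|n [sz IH]]; first by rewrite /= rX0.
have e : rX (mkseq a n.+1) = rcons (rX (mkseq a n)) (vertex_code a n).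
  rewrite /vertex_code mkseq_rcons; have [j ->] := rXS (mkseq a n) (a n).
  by rewrite nth_rcons sz ltnn eqxx.
by rewrite e size_rcons sz; split=> //; have := inN_rcons IH; rewrite sz.
Qed.

Lemma vertex_code_FX a : FX (vertex_code a).
Proof.
apply: (@piece_closed _ _ gX _ cFX) => n; exists (rX (mkseq a n)), (x n (mkseq a n)).
have [sz h] := vertex_code_inN a n; split=> //; first by rewrite sz.
by apply: xP; rewrite size_mkseq.
Qed.

Definition vertex_map (a : nat -> bool) : X := gX (vertex_code a).

Lemma vertex_map_cvg a U : opX U -> U (vertex_map a) ->
  exists N, forall p, (N <= p)%N -> U (x p (mkseq a p)).
Proof.
move=> oU Ua; have [n hn] := piece_limit cgX (vertex_code_FX a) oU Ua.
exists n => p np; have [sz h] := vertex_code_inN a p; apply: hn h _; first by rewrite sz.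
by apply: xP; rewrite size_mkseq.
Qed.

Lemma vertex_map_cont a U : opX U -> U (vertex_map a) ->
  exists n, forall c : nat -> bool, (forall i, (i < n)%N -> c i = a i) -> U (vertex_map c).
Proof.
move=> oU Ua; have [n hn] := cgX (vertex_code_FX a) oU Ua.
exists n => c ca; apply: hn; first exact: vertex_code_FX.
move=> i im; rewrite /vertex_code; congr (nth _ (rX _) _).
apply/eq_in_map => j; rewrite mem_iota add0n => /= ji.
by rewrite ca // (leq_trans ji).
Qed.

End vertex_limit.

(** Here [P] will select the true stages; the codes at the other stages may be unrelated. *)
Lemma increasing_limit (P : nat -> Prop) (q : nat -> seq nat) :
  (forall N, exists2 k, (N <= k)%N & P k) ->
  (forall i j, P i -> P j -> (i < j)%N -> prefix (q i) (q j) /\ (size (q i) < size (q j))%N) ->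
  exists b : baire, (forall k, P k -> inN (q k) b) /\
    forall n, exists N, forall k, (N <= k)%N -> P k -> (n <= size (q k))%N.
Proof.
move=> infP inc.
have large n : exists2 k, P k & (n < size (q k))%N.
  elim: n => [|n [k Pk nk]].
    have [i _ Pi] := infP 0%N; have [j ij Pj] := infP i.+1.
    by exists j => //; have [_] := inc i j Pi Pj ij; apply: leq_trans.
  have [j ij Pj] := infP k.+1; exists j => //.
  by have [_] := inc k j Pk Pj ij; apply: leq_trans.
have [f hf] := choice (fun n => let: ex_intro2 k a b := large n in ex_intro _ k (conj a b)).
have nthE i j n : P i -> P j -> (n < size (q i))%N -> (n < size (q j))%N ->
    nth 0%N (q i) n = nth 0%N (q j) n.
  wlog ij : i j / (i <= j)%N => [wl|].
    by have [ij|/ltnW ij] := leqP i j => Pi Pj ni nj; [apply: wl|apply/esym; apply: wl].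
  move=> Pi Pj ni nj; move: ij; rewrite leq_eqVlt => /orP[/eqP->//|ij].
  have [pij _] := inc i j Pi Pj ij; rewrite (prefix_take_eq pij) nth_take //.
exists (fun n => nth 0%N (q (f n)) n); split=> [k Pk i ik|n].
  by have [Pf sf] := hf i; apply: nthE.
have [k Pk nk] := large n; exists k => j kj Pj; apply: leq_trans (ltnW nk) _.
move: kj; rewrite leq_eqVlt => /orP[/eqP->//|kj].
by have [_ /ltnW] := inc k j Pk Pj kj.
Qed.

(** * Convergence along the true stages *)

Section main.
Variables (R : realType) (T : set (seq bool * seq bool)).
Hypothesis treeT : tree2x2 T.
Hypothesis acyclicT : uniformly_acyclic T.
Variable xi : countable_ordinal.
Variable A1 : set (cantor_space * cantor_space).
Hypothesis A1T : A1 `<=` branches T.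
Hypothesis SigmaA1 : Sigma0_1p xi [set p : branches T | A1 (set_val p)].
Variables X Y : topologicalType.
Hypothesis polishX : polish R X.
Hypothesis polishY : polish R Y.
Variables A B : set (X * Y).
Hypothesis analyticA : analytic R A.
Hypothesis analyticB : analytic R B.

Let K := (bool * bool)%type.

Let Tk : set (seq K) := [set s | T (unzip1 s, unzip2 s)].

Lemma Tk_prefix s t : prefix s t -> Tk t -> Tk s.
Proof.
move=> /prefix_take_eq -> h; have [_ /(_ _ _ (size s) h)] := treeT.
by rewrite /Tk /= /unzip1 /unzip2 !map_take.
Qed.

Lemma edge_relE p (s t : p.-tuple bool) : edge_rel Tk s t <-> level_rel T s t.
Proof. by rewrite /edge_rel /Tk /= unzip1_zip ?unzip2_zip ?size_tuple. Qed.

Lemma edge_irr p (s : p.+1.-tuple bool) : ~ edge_rel Tk s s.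
Proof. by move=> /edge_relE; have [h _ _] := acyclicT (ltn0Sn p); apply: h. Qed.

Lemma edge_acyclic p :
  rel_acyclic (fun s t : p.+1.-tuple bool => edge_rel Tk s t \/ edge_rel Tk t s).
Proof.
have [_ _ h] := acyclicT (ltn0Sn p); have -> // :
  (fun s t : p.+1.-tuple bool => edge_rel Tk s t \/ edge_rel Tk t s) =
  (fun s t : p.+1.-tuple bool => level_rel T s t \/ level_rel T t s).
by apply/funext => s; apply/funext => t; apply/propext; rewrite !edge_relE.
Qed.

Let fstz (z : nat -> K) : cantor_space := fun i => (z i).1.
Let sndz (z : nat -> K) : cantor_space := fun i => (z i).2.
Let Br : set (nat -> K) := [set z | branches T (fstz z, sndz z)].

(** Codes of sets are moved to sequences of pairs, so that a branch of [T] becomes a single sequence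
    with finite initial segments. *)
Let lift (G : set (branches T)) : set (nat -> K) :=
  [set z | exists2 p : branches T, set_val p = (fstz z, sndz z) & G p].

Lemma lift_ex z : Br z -> exists p : branches T, set_val p = (fstz z, sndz z).
Proof. by move=> Bz; exists (exist _ (fstz z, sndz z) (mem_set Bz)). Qed.

Lemma liftC G z : Br z -> lift (~` G) z <-> ~ lift G z.
Proof.
move=> Bz; have [p ep] := lift_ex Bz; split=> [[p1 e1 nG] [p2 e2 Gp]|n].
  by apply: nG; suff -> : p1 = p2 by []; apply: val_inj; rewrite -!set_valE e1 e2.
by exists p => // Gp; apply: n; exists p.
Qed.

Lemma lift_open G z : @open (branches T) G -> Br z -> lift G z ->
  exists k, forall z', Br z' -> mkseq z' k = mkseq z k -> lift G z'.
Proof.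
move=> [W oW <-] Bz [p ep Wp]; rewrite /preimage /= ep in Wp.
have [U [V [oU oV Uz Vz UV]]] := (prod_openP W).1 oW _ _ Wp.
have [n hn] := cantor_open_cylinder oU Uz; have [m hm] := cantor_open_cylinder oV Vz.
exists (maxn n m) => z' Bz' e; have [p' ep'] := lift_ex Bz'.
have ez i : (i < maxn n m)%N -> z' i = z i.
  move=> im; have := congr1 (fun s => nth (z i) s i) e.
  by rewrite !nth_mkseq.
exists p' => //; rewrite /preimage /= ep'; apply: UV; split=> /=.
  by apply: hn => i im; rewrite /fstz ez // leq_max im.
by apply: hm => i im; rewrite /sndz ez // leq_max im orbT.
Qed.

Lemma analytic_ana (P0 : X * Y) S : analytic R S -> ana (op2 (@open X) (@open Y)) S.
Proof.
move=> [P [f [pP cf <-]]].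
have [[x _]|nP] := pselect (exists x : P, True); last first.
  have -> : range f = set0 by rewrite -subset0 => z [x]; exfalso; apply: nP; exists x.
  exact: ana_set0.
have [d pd oP] := polish_has_metric pP.
apply: ana_image (polish_metric_ana x pd) => _ [] [U oU ->]; apply/oP; rewrite -comp_preimage.
  apply: open_comp oU => z _; apply: continuous_comp; first exact: cf.
  exact: cvg_fst.
apply: open_comp oU => z _; apply: continuous_comp; first exact: cf.
exact: cvg_snd.
Qed.

Lemma reduction_of_not_separable :
  ~ separable_by_pot_Pi0_1p R xi A B -> continuous_reduction T A1 A B.
Proof.
move=> nsep.
have [dX pdX oX] := polish_has_metric polishX; have [dY pdY oY] := polish_has_metric polishY.
have eX : @open X = metric_open dX by apply/seteqP; split=> U /oX.
have eY : @open Y = metric_open dY by apply/seteqP; split=> U /oY.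
have nsep' D : sigma_over (rect (@open X) (@open Y)) (None : option (ord_carrier xi)) D ->
    D `&` A = set0 -> ~ (B `<=` D).
  by move=> sD DA BD; apply: nsep; apply: sig_rect_separable pdX pdY oX oY _ _ _ sD BD DA.
have [[x0 y0] _] : exists z, B z.
  apply: contrapT => nB.
  apply: (nsep' set0); [|by rewrite set0I|by move=> z Bz; apply: nB; exists z].
  apply: sig_op; first exact: rect_Fsigma.
  exact: rect_set0.
have sX : hausdorff_base (@open X) by rewrite eX; apply: metric_hausdorff_base; case: pdX.
have sY : hausdorff_base (@open Y) by rewrite eY; apply: metric_hausdorff_base; case: pdY.
have aX : ana (@open X) setT by rewrite eX; apply: polish_metric_ana.
have aY : ana (@open Y) setT by rewrite eY; apply: polish_metric_ana.
have [FA [gA [cFA cgA eA]]] := analytic_ana (x0, y0) analyticA.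
have [FB [gB [cFB cgB eB]]] := analytic_ana (x0, y0) analyticB.
have [FX [gX [cFX cgX sTX]]] := aX.
have [FY [gY [cFY cgY sTY]]] := aY.
have [ord [G0 [leaf [ord0 G00 leafo nodeo ordc]]]] := sig_codes ((Sigma0_sig _ _).1 SigmaA1).
pose G a := lift (G0 a).
have leafP a z : leaf a -> Br z -> G a z ->
    exists k, forall z', Br z' -> mkseq z' k = mkseq z k -> G a z'.
  by move=> la Bz; apply: lift_open => //; apply: leafo.
have nodeP a z : ~ leaf a -> Br z -> (G a z <-> exists i, ~ G (rcons a i) z).
  move=> la Bz; rewrite /G (nodeo a la); split=> [[p ep [i _ nG]]|[i]].
    by exists i; apply/liftC => //; exists p.
  by move=> /(liftC _ Bz)[p ep nG]; exists p => //; exists i.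
pose wf := @olt_wf xi; pose tr := @olt_trans xi.
pose rel := ts_rel wf Br ord G leaf; pose cond := ts_cond wf Br ord G leaf.
pose opn := ts_open wf Br ord G leaf.
pose Th (s : seq K) := [seq ord a | a <- pmap unpickle (iota 0 (size s))].
(* The root stays unlabelled even if the code of [A1] is open there, so that the construction starts
   in [B]. *)
pose Lab : set (seq K) := [set s | opn None [::] s /\ s <> [::]].
have rel_trans o s t u : rel o s t -> rel o t u -> rel o s u by apply: ts_rel_trans.
have Lab_up s t : rel None s t -> Lab s -> Lab t.
  move=> rst [Os ns]; split; first exact: (ts_open_up _ rst).
  move=> et; apply: ns; have := ts_rel_prefix rst; rewrite et.
  by rewrite prefixs0 => /eqP.
have condf v r t : ~ cond v r t -> v \in Th r.
  move=> nc; have [a [<- ar]] := ts_cond_finite nc; apply/mapP; exists a => //.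
  rewrite mem_pmap; apply/mapP; exists (pickle a); last by rewrite pickleK.
  by rewrite mem_iota.
have surjX x : (gX @` FX) x by rewrite -sTX.
have surjY y : (gY @` FY) y by rewrite -sTY.
rewrite eA eB in nsep'.
have [q [rX [rY [qP [rX0 rY0] rXS rYS cP]]]] := @ex_construction xi X Y _ _ sX sY aX aY
  rel cond Th (fun o s t => iff_refl _) rel_trans
  (fun o s t u => @ts_cond_trans _ _ wf tr K Br ord G leaf o s t u)
  (fun o r s t => @ts_club _ _ wf tr K Br ord G leaf o r s t)
  condf (fun o t => ts_rel_nil wf Br ord G leaf o t) Lab Lab_up (fun h => h.2 erefl)
  Tk Tk_prefix FA FB gA gB cFA cFB cgA cgB FX FY gX gY cFX cFY cgX cgY surjX surjY
  edge_irr edge_acyclic nsep'.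
pose c p := sval (cid (cP p)).
have hc p := svalP (cid (cP p)).
pose tup p (s : seq bool) : p.-tuple bool := insubd (nseq_tuple p false) s.
have tupE p s : size s = p -> tval (tup p s) = s.
  by move=> sp; rewrite -[tval _]/(val (tup p s)) val_insubd sp eqxx.
pose x p s := (c p).1 (tup p s); pose y p s := (c p).2 (tup p s).
have xP p s : size s = p -> piece FX gX (rX s) (x p s).
  by move=> sp; have [h _ _] := hc p; have := h (tup p s); rewrite tupE.
have yP p s : size s = p -> piece FY gY (rY s) (y p s).
  by move=> sp; have [_ h _] := hc p; have := h (tup p s); rewrite tupE.
have contV (Z : topologicalType) (f : cantor_space -> Z) :
    (forall a U, open U -> U (f a) -> exists n, forall b : cantor_space,
      (forall i, (i < n)%N -> b i = a i) -> U (f b)) -> continuous f.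
  move=> h a U; rewrite nbhsE => -[V [oV Va] VU]; have [n hn] := h a V oV Va.
  by apply: filterS (cantor_nbhs_cylinder a n) => b hb; apply: VU; apply: hn.
pose u (a : cantor_space) := vertex_map gX rX a.
pose v (b : cantor_space) := vertex_map gY rY b.
have key (a b : cantor_space) : branches T (a, b) ->
    (A1 (a, b) -> A (u a, v b)) /\ (~ A1 (a, b) -> B (u a, v b)).
  move=> Tab; pose z i : K := (a i, b i); have Bz : Br z by [].
  pose pre k := mkseq z k.
  pose tru := ts_true wf Br ord G leaf z None.
  have IS o := ts_true_inf_sound wf tr (@olt_total xi) leafP nodeP ordc Bz o.
  have so o := (IS o).2.
  have inf := (IS None).1.
  have rel_true i j : (i <= j)%N -> tru i -> tru j -> rel None (pre i) (pre j).
    by move=> ij ti tj; apply: (ts_true_rel tr) => // w _; apply: so.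
  have A1G : A1 (a, b) <-> G [::] z.
    rewrite /G G00; split=> [Aab|[p /= -> //]].
    by have [p ep] := lift_ex Bz; exists p => //=; rewrite ep.
  have zipE k : zip (mkseq a k) (mkseq b k) = pre k.
    by rewrite /pre /mkseq; elim: (iota 0 k) => //= i l ->.
  pose pt k := (x k (mkseq a k), y k (mkseq b k)).
  have img k : image_of Lab FA FB gA gB (pre k) (q (pre k)) (pt k).
    have [_ _ h] := hc k; have := h (tup k (mkseq a k)) (tup k (mkseq b k)).
    rewrite !tupE ?size_mkseq // zipE; apply.
    by rewrite -zipE /Tk /= unzip1_zip ?unzip2_zip ?size_mkseq.
  (* The predecessor from which a true stage takes its code is again a true stage, not before [i].
     Without a change of label each step therefore lengthens the code by a digit. *)
  have inc j i : tru i -> tru j -> (i < j)%N -> (Lab (pre j) -> Lab (pre i)) ->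
      prefix (q (pre i)) (q (pre j)) /\ (size (q (pre i)) < size (q (pre j)))%N.
    elim/ltn_ind: j i => j IH i ti tj ij Lji.
    have [|c0 [l [[pc zc rc mc] ->]]] := qP (pre j).
      by rewrite size_mkseq; apply: leq_trans ij.
    rewrite size_mkseq in zc mc.
    pose m := size c0; have ec : c0 = pre m.
      by rewrite (prefix_take_eq pc) /pre mkseq_take // ltnW.
    have tm : tru m.
      apply: (@ts_true_pred _ _ wf tr _ Br ord G leaf z None m j) => //.
      - by move=> w _; apply: so.
      - exact: ltnW.
      - by rewrite -/(pre m) -ec.
    have im : (i <= m)%N.
      rewrite leqNgt; apply/negP => mi; apply: (mc (pre i)).
      - exact: ts_rel_prefix (rel_true _ _ (ltnW ij) ti tj).
      - by rewrite size_mkseq mi.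
      - exact: rel_true (ltnW ij) ti tj.
    have be : base Lab q c0 (pre j) = q (pre m).
      rewrite /base asboolF ec // => -[Lj nLm]; apply: nLm.
      exact: Lab_up (rel_true _ _ im ti tm) (Lji Lj).
    rewrite be size_rcons ltnS; move: im; rewrite leq_eqVlt => /orP[/eqP->|im].
      by rewrite prefix_rcons.
    have [|p1 z1] := IH m zc i ti tm im.
      by move=> Lm; apply: Lji; apply: Lab_up Lm; rewrite -ec.
    split; last exact: ltnW.
    by apply: prefix_trans p1 _; apply: prefix_rcons.
  (* The points [pt k] approach [(u a, v b)] through the codes of the vertices, and [g w] through
     the codes of the edges at true stages; as the base separates points, the two limits are
     equal. *)
  have concl F g k0 : bclosed F -> bcont (op2 (@open X) (@open Y)) F g ->
      (forall k, tru k -> (k0 <= k)%N -> piece F g (q (pre k)) (pt k)) ->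
      (forall i j, tru i -> tru j -> (k0 <= i)%N -> (i < j)%N -> Lab (pre j) -> Lab (pre i)) ->
      (g @` F) (u a, v b).
    move=> cF cg hp hl; pose P k := tru k /\ (k0 <= k)%N.
    have infP N : exists2 k, (N <= k)%N & P k.
      have [k] := inf (maxn N k0); rewrite geq_max => /andP[Nk kk] tk.
      by exists k.
    have [|w [wq wn]] := @increasing_limit P (fun k => q (pre k)) infP.
      by move=> i j [ti ki] [tj kj] ij; apply: inc => //; apply: hl.
    have Fw : F w.
      apply: (@piece_closed _ _ g _ cF) => n; have [N hN] := wn n; have [k Nk Pk] := infP N.
      exists (q (pre k)), (pt k); split; [exact: hN|exact: wq|].
      by case: Pk; apply: hp.
    exists w => //; apply: contrapT => ne.
    have [U [V [oU oV Uw Vuv UV]]] := hausdorff_base_op2 sX sY ne.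
    have [n hn] := piece_limit cg Fw oU Uw; have [N hN] := wn n.
    have [M hM] : exists M, forall k, (M <= k)%N -> V (pt k).
      case: oV => -[V0 oV0 eV]; rewrite eV in Vuv *.
        exact: (vertex_map_cvg cFX cgX rX0 rXS xP oV0 Vuv).
      exact: (vertex_map_cvg cFY cgY rY0 rYS yP oV0 Vuv).
    have [k] := infP (maxn N M); rewrite geq_max => /andP[Nk Mk] Pk.
    have : (U `&` V) (pt k).
      split; last exact: hM.
      by apply: hn (hN k Nk Pk) (wq k Pk) _; case: Pk; apply: hp.
    by rewrite UV.
  split=> [/A1G/(so None [::] ord0)[k tk Ok]|nA1].
    have [k0 kk0 tk0] := inf k.+1.
    have L0 : Lab (pre k0).
      split; last by move=> /(congr1 size); rewrite size_mkseq => e; rewrite e in kk0.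
      apply: (ts_open_up _ _ Ok) => //; apply: rel_true => //; exact: ltnW.
    have L k' : tru k' -> (k0 <= k')%N -> Lab (pre k').
      by move=> tk' k0k; apply: Lab_up L0; apply: rel_true.
    rewrite eA; apply: (concl FA gA k0) => // [k' tk' kk'|i j ti tj ki _ _]; last exact: L.
    by have := img k'; rewrite /image_of asboolT //; apply: L.
  have nL k : tru k -> ~ Lab (pre k).
    by move=> tk [Ok _]; apply: nA1; apply/A1G; apply/(so None [::] ord0); exists k.
  rewrite eB; apply: (concl FB gB 0%N) => // [k tk _|i j _ tj _ _ /(nL j tj)//].
  by have := img k; rewrite /image_of asboolF //; apply: nL.
exists u, v; split.
- by apply: contV => a U oU Ua; apply: (vertex_map_cont cFX cgX rX0 rXS xP oU Ua).
- by apply: contV => a U oU Ua; apply: (vertex_map_cont cFY cgY rY0 rYS yP oU Ua).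
- by move=> [a b] Aab; have [h _] := key a b (A1T Aab); apply: h.
- by move=> [a b] [Tab nA]; have [_ h] := key a b Tab; apply: h.
Qed.

End main.

Theorem theorem13 (R : realType) (T : set (seq bool * seq bool))
    (treeT : tree2x2 T) (acyclicT : uniformly_acyclic T)
    (xi : countable_ordinal)
    (A1 : set (cantor_space * cantor_space))
    (A1T : A1 `<=` branches T)
    (* A1 is Sigma^0_{1+xi} in the subspace topology of [T] *)
    (SigmaA1 : Sigma0_1p xi [set p : branches T | A1 (set_val p)])
    (X Y : topologicalType) (polishX : polish R X) (polishY : polish R Y)
    (A B : set (X * Y))
    (analyticA : analytic R A) (analyticB : analytic R B)
    (disjAB : A `&` B = set0) :
  (separable_by_pot_Pi0_1p R xi A B \/ continuous_reduction T A1 A B) /\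
  (~ potentially_Pi0_1p R xi A1 ->
     (separable_by_pot_Pi0_1p R xi A B /\ ~ continuous_reduction T A1 A B) \/
     (~ separable_by_pot_Pi0_1p R xi A B /\ continuous_reduction T A1 A B)).
Proof.
have dich : ~ separable_by_pot_Pi0_1p R xi A B -> continuous_reduction T A1 A B.
  exact: reduction_of_not_separable.
have [sep|nsep] := pselect (separable_by_pot_Pi0_1p R xi A B); last first.
  by split; [right; apply: dich|right; split=> //; apply: dich].
split=> [|npot]; [by left|left; split=> // red].
by apply: npot; apply: reduction_potential polishX polishY A1T sep red.
Qed.
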